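(* Let $1\leqslant p<\infty$, and let $(G_n,S_n)_{n\in\mathbb{N}}$ be the sequence of Cayley graphs of the groups $G_n=(\mathbb{Z}/2^n\mathbb{Z})^2\rtimes_{Q_n}H_{3n-3}$ constructed in the context. It satisfies the following two properties. (1) There exists $C>0$ such that for all $n\in\mathbb{N}$, every function $f$ from $G_n$ to an $L^p$-space satisfies, for every $h\in(\mathbb{Z}/2^n\mathbb{Z})^2$, $$\sum_{g\in G_n}\|f(gh)-f(g)\|^p\leqslant C\sum_{g\in G_n,\,s\in S_n}\|f(gs)-f(g)\|^p.$$ If $X$ is a uniformly curved Banach space, then this inequality holds for functions with values in $X$, for some exponent $1\leqslant p<\infty$ (and some constant $C>0$ independent of $n$). In particular, the sequence $(G_n,S_n)_{n\in\mathbb{N}}$ does not (uniformly) coarsely embed into any uniformly curved Banach space. (2) On the other hand, if $(X_n)_{n\in\mathbb{N}}$ is a sequence of expander graphs and $h_n\colon X_n\to(G_n,S_n)$ is a sequence of $1$-Lipschitz maps, then there exist a constant $c>0$ and a sequence $y_n\in(G_n,S_n)$ such that for all $n$ the cardinality of $h_n^{-1}(\{y_n\})$ is at least $c|X_n|$ and its diameter is at least $c\,\mathrm{diam}(X_n)$.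
   Context: Construction. For a group $\Gamma$ put $\Gamma_0(\Gamma):=\Gamma$ and let $\Gamma_{j+1}(\Gamma)$ be the subgroup of $\Gamma_j(\Gamma)$ generated by the squares of elements of $\Gamma_j(\Gamma)$. Let $\mathbb{F}_3$ be the free group on $U=\{u_1,u_2,u_3\}$, let $H_j:=\mathbb{F}_3/\Gamma_j(\mathbb{F}_3)$ and let $t_i^{(j)}$ be the image of $u_i$ in $H_j$. Let $Q=\ker(\mathrm{SL}(2,\mathbb{Z})\twoheadrightarrow\mathrm{SL}(2,\mathbb{Z}/2\mathbb{Z}))$, which is generated by 3 elements, and let $\pi\colon\mathbb{F}_3\twoheadrightarrow Q$ be a morphism mapping $U$ to a generating subset of $Q$. For $n\geqslant1$ let $Q_n$ be the image of $Q$ in $\mathrm{SL}(2,\mathbb{Z}/2^n\mathbb{Z})$; it has order $2^{3n-3}$, and there is an epimorphism $H_{3n-3}\twoheadrightarrow Q_n$ mapping each $t_i^{(3n-3)}$ to the image of $\pi(u_i)$. For a group $V$, a group $L$ of automorphisms of $V$ and a group $K$ surjecting onto $L$, $V\rtimes_LK$ denotes the semi-direct product in which $K$ acts on $V$ via its quotient $L$. Set $G:=\mathbb{Z}^2\rtimes_Q\mathbb{F}_3$ (standard action of $Q$ on $\mathbb{Z}^2$), let $S\subset G$ be the union of $U$ and the standard basis of $\mathbb{Z}^2$, and for $n\geqslant1$ set $G_n:=(\mathbb{Z}/2^n\mathbb{Z})^2\rtimes_{Q_n}H_{3n-3}$, a quotient of $G$; let $S_n$ be the image of $S$ in $G_n$.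 By convention $G_0=\{e\}$. $(G_n,S_n)$ is the Cayley graph with word metric. Coarse embedding: a sequence of maps $\phi_n\colon X_n\to Y$ from metric spaces $(X_n,d_n)$ to a metric space $(Y,d_Y)$ is a (uniform) coarse embedding of $(X_n)$ into $Y$ if there are two proper functions $\rho,\gamma\colon[0,\infty)\to[0,\infty)$ (independent of $n$) with $\rho(d_n(x,y))\leqslant d_Y(\phi_n(x),\phi_n(y))\leqslant\gamma(d_n(x,y))$ for all $n$ and all $x,y\in X_n$. Expander: for a finite connected graph $X$ and a set $A$ of vertices, $\partial A$ is the set of edges between $A$ and $X\setminus A$, and $h(X)=\min_{1\leqslant|A|\leqslant|X|/2}|\partial A|/|A|$. An expander is a sequence $(X_n)$ of finite connected graphs with uniformly bounded degree, $|X_n|\to\infty$, and $h(X_n)\geqslant c_0$ for all $n$ for some constant $c_0>0$. An $L^p$-space is a Banach space $L^p(\Omega,\nu)$ for some measure space $(\Omega,\nu)$. Uniformly curved Banach space: a Banach space $X$ for which there is a function $\varepsilon\mapsto\Delta_X(\varepsilon)$ tending to $0$ as $\varepsilon\to0^+$ such that, for every measure space $(\Omega,\mu)$, every operator $T\colon L^2(\Omega,\mu)\to L^2(\Omega,\mu)$ with $\|T\|\leqslant\varepsilon$ that is simultaneously of norm $\leqslant1$ on $L^1$ and on $L^\infty$ has norm $\leqslant\Delta_X(\varepsilon)$ on $L^2(\Omega,\mu,X)$, the Banach space of square-summable measurable functions $\Omega\to X$.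
   Formalization: In (2) the diameter bound is claimed only for all sufficiently large n (the cardinality bound for all n), since a small X_n such as a single edge mapped injectively has only fibres of diameter 0; L^p-spaces and Banach spaces are taken over the reals. *)

(* Defs.v *)
From HB Require Import structures.
From mathcomp Require Import all_boot all_order all_algebra all_fingroup zify ring.
From mathcomp Require Import generic_quotient.
From mathcomp Require Import all_classical all_reals all_analysis.

Set Implicit Arguments.
Unset Strict Implicit.
Unset Printing Implicit Defensive.

Import Order.TTheory GRing.Theory Num.Theory.
Import numFieldNormedType.Exports.

Local Open Scope classical_set_scope.
Local Open Scope ring_scope.

(* The letter (a, true) stands for the generator a and (a, false) for its
   inverse; elements of the free group are the reduced words. *)
Section FreeGroup.
Variable A : choiceType.
Implicit Types (x y : A * bool) (u v w : seq (A * bool)).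

Definition letter_inv x := (x.1, ~~ x.2).
Definition reduced w := sorted (fun x y => y != letter_inv x) w.

Record free_group := FreeGroup {fword : seq (A * bool); _ : reduced fword}.

HB.instance Definition _ := [isSub for fword].
HB.instance Definition _ := [Choice of free_group by <:].

Definition cons_reduce x w :=
  if w is y :: w' then if y == letter_inv x then w' else x :: w else [:: x].

Definition mulw u v := foldr cons_reduce v u.
Definition invw u := rev (map letter_inv u).

Lemma letter_invK : involutive letter_inv.
Proof. by case=> a b; rewrite /letter_inv /= negbK. Qed.

Lemma letter_inv_neq x : letter_inv x != x.
Proof. by case: x => a []; rewrite /letter_inv /= xpair_eqE andbF. Qed.

Lemma reduced_behead x w : reduced (x :: w) -> reduced w.
Proof. exact: path_sorted. Qed.

Lemma reduced_cons_reduce x w : reduced w -> reduced (cons_reduce x w).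
Proof.
case: w => [//|y w] /= yw; case: eqP => [_|/eqP yx]; first exact: path_sorted yw.
by rewrite /= yx.
Qed.

Lemma reduced_mulw u v : reduced v -> reduced (mulw u v).
Proof. by move=> rv; elim: u => //= x u; apply: reduced_cons_reduce. Qed.

Lemma cons_reduceK x w : reduced w ->
  cons_reduce (letter_inv x) (cons_reduce x w) = w.
Proof.
case: w => [_|y w] /=; first by rewrite letter_invK eqxx.
case: (eqVneq y (letter_inv x)) => [-> /=|_ _]; last first.
  by rewrite /= letter_invK eqxx.
case: w => [//|z w] /= /andP[zx _].
by rewrite (negPf zx).
Qed.

Lemma cons_reduceVK x w : reduced w ->
  cons_reduce x (cons_reduce (letter_inv x) w) = w.
Proof.
by move=> rw; rewrite -{1}[x]letter_invK cons_reduceK.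
Qed.

Lemma mulw_cons_reduce x u w : reduced u -> reduced w ->
  mulw (cons_reduce x u) w = cons_reduce x (mulw u w).
Proof.
case: u => [//|y u] ru rw /=; case: eqP => [->|//].
by rewrite cons_reduceVK // reduced_mulw.
Qed.

Lemma mulw1 u : reduced u -> mulw u [::] = u.
Proof.
elim: u => //= x u IHu ru; rewrite IHu ?(reduced_behead ru) //.
by case: u ru {IHu} => //= y u /andP[/negPf->].
Qed.

Lemma mulwA u v w : reduced v -> reduced w ->
  mulw u (mulw v w) = mulw (mulw u v) w.
Proof.
move=> rv rw; elim: u => //= x u ->.
by rewrite mulw_cons_reduce // reduced_mulw.
Qed.

Lemma mulw_cat u1 u2 w : mulw (u1 ++ u2) w = mulw u1 (mulw u2 w).
Proof. by rewrite /mulw foldr_cat. Qed.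

Lemma mulVw_gen u w : reduced w -> mulw (invw u) (mulw u w) = w.
Proof.
elim: u w => // x u IHu w rw.
rewrite /invw /= rev_cons -cats1 mulw_cat /= cons_reduceK ?reduced_mulw //.
exact: IHu.
Qed.

Lemma invwK : involutive invw.
Proof.
by move=> u; rewrite /invw map_rev revK -map_comp map_id_in // => x _ /=;
  exact: letter_invK.
Qed.

Lemma reduced_invw u : reduced u -> reduced (invw u).
Proof.
move=> ru; rewrite /reduced /invw rev_sorted sorted_map.
apply: sub_sorted ru => x y /= yx; rewrite letter_invK.
by apply: contraNneq yx => ->.
Qed.

Lemma freduced (g : free_group) : reduced (fword g).
Proof. exact: valP g. Qed.

Definition fone : free_group := @FreeGroup [::] isT.
Definition fmul (g h : free_group) :=
  FreeGroup (reduced_mulw (fword g) (freduced h)).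
Definition finvg (g : free_group) := FreeGroup (reduced_invw (freduced g)).

Lemma fmulA : associative fmul.
Proof. by move=> g h k; apply: val_inj; rewrite /= mulwA ?freduced. Qed.
Lemma fmul1 : left_id fone fmul.
Proof. by move=> g; apply: val_inj. Qed.
Lemma fmulr1 : right_id fone fmul.
Proof. by move=> g; apply: val_inj; rewrite /= mulw1 ?freduced. Qed.
Lemma fmulV : left_inverse fone finvg fmul.
Proof.
move=> g; apply: val_inj => /=.
by rewrite -[X in mulw _ X](mulw1 (freduced g)) mulVw_gen.
Qed.
Lemma fmulrV : right_inverse fone finvg fmul.
Proof.
move=> g; apply: val_inj => /=.
rewrite -[X in mulw X _]invwK -[X in mulw _ X]mulw1 ?reduced_invw ?freduced//.
by rewrite mulVw_gen.
Qed.

HB.instance Definition _ :=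
  isGroup.Build free_group fmulA fmul1 fmulr1 fmulV fmulrV.

Definition fgen (a : A) : free_group := @FreeGroup [:: (a, true)] isT.

Lemma free_group_ind (P : free_group -> Prop) :
  P 1%g -> (forall a g, P g -> P (fgen a * g)%g) ->
  (forall a g, P g -> P ((fgen a)^-1 * g)%g) -> forall g, P g.
Proof.
move=> P1 Pg PV [w rw]; elim: w rw => [|[a b] w IHw] rw.
  by rewrite (_ : FreeGroup rw = 1%g) //; apply: val_inj.
have rw' := reduced_behead rw.
have E : cons_reduce (a, b) w = (a, b) :: w.
  by case: w rw {IHw rw'} => //= y w /andP[/negPf->].
case: b => [|] in rw E *.
- rewrite (_ : FreeGroup rw = fgen a * FreeGroup rw')%g; first exact/Pg/IHw.
  exact: val_inj.
- rewrite (_ : FreeGroup rw = (fgen a)^-1 * FreeGroup rw')%g; first exact/PV/IHw.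
  exact: val_inj.
Qed.

End FreeGroup.

Section SquaresSeries.
Variable G : groupType.
Local Open Scope group_scope.
Implicit Types (A : set G) (x y z : G).

Definition is_subgroup A :=
  [/\ A 1, forall x y, A x -> A y -> A (x * y) & forall x, A x -> A x^-1].

Definition gen_subgroup A : set G := smallest is_subgroup A.

Lemma gen_subgroup_subgroup A : is_subgroup (gen_subgroup A).
Proof.
split=> [B [[]//]|x y Ax Ay B BA|x Ax B BA].
- by case: (BA) => -[_ BM _] _; apply: BM; [apply: Ax|apply: Ay].
- by case: (BA) => -[_ _ BV] _; apply: BV; apply: Ax.
Qed.

Fixpoint squares_series j : set G :=
  if j is i.+1 then gen_subgroup [set x ^+ 2 | x in squares_series i] else setT.

Lemma squares_series_subgroup j : is_subgroup (squares_series j).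
Proof. by case: j => [|j]; [split|apply: gen_subgroup_subgroup]. Qed.

Lemma squares_series1 j : squares_series j 1.
Proof. by case: (squares_series_subgroup j). Qed.
Lemma squares_seriesM j x y :
  squares_series j x -> squares_series j y -> squares_series j (x * y).
Proof. by case: (squares_series_subgroup j) => _ + _; exact. Qed.
Lemma squares_seriesV j x : squares_series j x -> squares_series j x^-1.
Proof. by case: (squares_series_subgroup j) => _ _; exact. Qed.

Lemma squares_series_sq j x : squares_series j x -> squares_series j.+1 (x ^+ 2).
Proof. by move=> jx; apply: sub_gen_smallest; exists x. Qed.

Lemma squares_seriesJ j x y : squares_series j x -> squares_series j (x ^ y).
Proof.
elim: j x y => // j IHj x y.
have sub : gen_subgroup [set x ^+ 2 | x in squares_series j] `<=`
    [set x | squares_series j.+1 (x ^ y)].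
  apply: smallest_sub => [|_ [z jz <-]] /=.
    split=> [|u v|u] /=; first by rewrite conj1g; exact: (squares_series1 j.+1).
    - by rewrite conjMg; exact: (@squares_seriesM j.+1).
    - by rewrite conjVg; exact: (@squares_seriesV j.+1).
  rewrite conjXg; apply: squares_series_sq; exact: IHj.
exact: sub.
Qed.

Variable j : nat.

Definition squares_rel : rel G := fun x y => `[< squares_series j (x^-1 * y) >].

Lemma squares_rel_equiv : equiv_class_of squares_rel.
Proof.
split=> [x|x y|y x z]; rewrite /squares_rel.
- by apply/asboolP; rewrite mulVg; exact: squares_series1.
- by apply: asbool_equiv_eq; split => /squares_seriesV; rewrite invgM invgK.
- move=> /asboolP xy /asboolP yz; apply/asboolP.
  by have := squares_seriesM xy yz; rewrite mulgA mulgK.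
Qed.
Canonical squares_rel_equivRel := EquivRelPack squares_rel_equiv.

Definition squares_quotient : Type := {eq_quot squares_rel}%qT.
HB.instance Definition _ := Choice.on squares_quotient.
HB.instance Definition _ := EqQuotient.on squares_quotient.

Definition proj_sq (x : G) : squares_quotient := \pi_(squares_quotient)%qT x.

Lemma proj_sqP x y :
  proj_sq x = proj_sq y <-> squares_series j (x^-1 * y).
Proof.
rewrite /proj_sq; split=> [/eqP|xy]; last apply/eqP.
  by rewrite eqmodE => /asboolP.
by rewrite eqmodE; apply/asboolP.
Qed.

Lemma proj_sq_reprK (a : squares_quotient) : proj_sq (repr a) = a.
Proof. exact: reprK. Qed.

Definition sq_one : squares_quotient := proj_sq 1.
Definition sq_mul (a b : squares_quotient) := proj_sq (repr a * repr b).
Definition sq_inv (a : squares_quotient) := proj_sq (repr a)^-1.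

Lemma sq_mulE x y : sq_mul (proj_sq x) (proj_sq y) = proj_sq (x * y).
Proof.
apply/proj_sqP; rewrite invgM.
have /proj_sqP jx := proj_sq_reprK (proj_sq x).
have /proj_sqP jy := proj_sq_reprK (proj_sq y).
set u := repr _ in jx *; set v := repr _ in jy *.
have -> : v^-1 * u^-1 * (x * y) = (u^-1 * x) ^ v * (v^-1 * y).
  by rewrite /conjg !mulgA mulgK.
by apply: squares_seriesM => //; exact: squares_seriesJ.
Qed.

Lemma sq_invE x : sq_inv (proj_sq x) = proj_sq x^-1.
Proof.
apply/proj_sqP; rewrite invgK.
have /proj_sqP jx := proj_sq_reprK (proj_sq x).
set u := repr _ in jx *.
have -> : u * x^-1 = ((u^-1 * x) ^ u^-1)^-1.
  by rewrite /conjg !invgM !invgK !mulgA mulgK.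
exact/squares_seriesV/squares_seriesJ.
Qed.

Lemma sq_mulA : associative sq_mul.
Proof.
move=> a b c; rewrite -[a]proj_sq_reprK -[b]proj_sq_reprK -[c]proj_sq_reprK.
by rewrite !sq_mulE mulgA.
Qed.
Lemma sq_mul1 : left_id sq_one sq_mul.
Proof. by move=> a; rewrite -[a]proj_sq_reprK sq_mulE mul1g. Qed.
Lemma sq_mulr1 : right_id sq_one sq_mul.
Proof. by move=> a; rewrite -[a]proj_sq_reprK sq_mulE mulg1. Qed.
Lemma sq_mulV : left_inverse sq_one sq_inv sq_mul.
Proof. by move=> a; rewrite -[a]proj_sq_reprK sq_invE sq_mulE mulVg. Qed.
Lemma sq_mulrV : right_inverse sq_one sq_inv sq_mul.
Proof. by move=> a; rewrite -[a]proj_sq_reprK sq_invE sq_mulE mulgV. Qed.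

HB.instance Definition _ :=
  isGroup.Build squares_quotient sq_mulA sq_mul1 sq_mulr1 sq_mulV sq_mulrV.

Lemma proj_sqM : {morph proj_sq : x y / x * y}.
Proof. by move=> x y; rewrite -sq_mulE. Qed.
HB.instance Definition _ :=
  isMultiplicative.Build G squares_quotient proj_sq proj_sqM.

End SquaresSeries.

(* The quotients G/Gamma_j(G) of a free group of finite rank are finite: given
   finitely many representatives of G/Gamma_j, Schreier's lemma yields a finite
   set E generating Gamma_j, and the image of Gamma_j in G/Gamma_(j+1) is
   abelian of exponent 2, hence consists of the products of subsets of E. *)
Section Finiteness.
Variable k : nat.
Notation F := (free_group 'I_k).
Local Open Scope group_scope.
Notation sqs := (@squares_series F).

Definition letters : seq F :=
  [seq fgen i | i <- enum 'I_k] ++ [seq (fgen i)^-1 | i <- enum 'I_k].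

Lemma letters_ind (P : F -> Prop) :
  P 1 -> (forall x g, x \in letters -> P g -> P (x * g)) -> forall g, P g.
Proof.
move=> P1 PM; apply: free_group_ind => // a g Pg; apply: PM => //.
- by rewrite mem_cat; apply/orP; left; apply/mapP; exists a; rewrite ?mem_enum.
- by rewrite mem_cat; apply/orP; right; apply/mapP; exists a; rewrite ?mem_enum.
Qed.

Lemma sq_cong_trans j (x y z : F) :
  sqs j (x^-1 * y) -> sqs j (y^-1 * z) -> sqs j (x^-1 * z).
Proof. by move=> xy yz; have := squares_seriesM xy yz; rewrite mulgA mulgK. Qed.

Lemma sq_comm j (a e : F) : sqs j a -> sqs j e -> sqs j.+1 [~ a, e].
Proof.
move=> ja je.
have -> : [~ a, e] = (a^-1) ^+ 2 * (a * e^-1) ^+ 2 * e ^+ 2.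
  rewrite /commg /conjg !expgS !expg0 !mulg1 !mulgA mulgVK.
  by rewrite mulgVK.
have sq := @squares_series_sq F j.
have jV x := @squares_seriesV F j x.
apply: squares_seriesM; last exact: sq.
apply: squares_seriesM; apply: sq; first exact: jV.
by apply: squares_seriesM => //; exact: jV.
Qed.

Lemma sub_products j (E : seq F) e m : {in E, forall x, sqs j x} ->
  e \in E -> size m = size E ->
  exists2 m', size m' = size E &
    sqs j.+1 ((\prod_(x <- mask m' E) x)^-1 * (e * \prod_(x <- mask m E) x)).
Proof.
elim: E m => // a E IHE [//|b m] jE eE [sm].
have ja : sqs j a by apply: jE; rewrite mem_head.
have jE' : {in E, forall x, sqs j x} by move=> x xE; apply: jE; rewrite inE xE orbT.
have [ea|nea] := eqVneq e a.
  exists (~~ b :: m); first by rewrite /= sm.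
  case: b => /=; rewrite ?big_cons ea; last first.
    by rewrite mulVg; exact: (@squares_series1 F j.+1).
  have -> (P : F) : P^-1 * (a * (a * P)) = (a ^+ 2) ^ P.
    by rewrite conjgE !mulgA.
  apply: (@squares_seriesJ F j.+1); exact: squares_series_sq.
move: eE; rewrite inE (negPf nea) /= => eE.
have je := jE' _ eE.
have [m' sm' Pm'] := IHE m jE' eE sm.
exists (b :: m'); first by rewrite /= sm'.
case: b => /=; rewrite ?big_cons //.
set P' := \prod_(x <- _) x in Pm' *; set P := \prod_(x <- _) x in Pm' *.
have -> : (a * P')^-1 * (e * (a * P)) =
          (P'^-1 * (e * P)) * [~ e, a] ^ P.
  by rewrite commgEl !conjgE invgM !mulgA !(mulgVK, mulgK).
apply: (@squares_seriesM F j.+1) => //.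
by apply: (@squares_seriesJ F j.+1); exact: sq_comm.
Qed.

Definition transversal j (s : seq F) :=
  forall g, exists2 x, x \in s & sqs j (x^-1 * g).

Lemma transversal_step j s : transversal j s -> exists s', transversal j.+1 s'.
Proof.
move=> sP.
have [r rs rP] : exists2 r : F -> F, forall g, r g \in s & forall g, sqs j ((r g)^-1 * g).
  have /choice[r rP] : forall g, exists x, x \in s /\ sqs j (x^-1 * g).
    by move=> g; have [x xs xg] := sP g; exists x.
  by exists r => g; case: (rP g).
pose E := (r 1)^-1 :: [seq (r (a * x))^-1 * (a * x) | a <- letters, x <- s].
have jE : {in E, forall x, sqs j x}.
  move=> y; rewrite inE => /predU1P[->|/allpairsP[[a x] /= [_ _ ->]]] //.
  by have := rP 1; rewrite mulg1.
have prodE g : exists2 x, x \in s & exists2 m, size m = size E &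
    sqs j.+1 ((x * \prod_(y <- mask m E) y)^-1 * g).
  elim/letters_ind: g => [|a g aL [x xs [m sm mg]]].
    exists (r 1) => //; exists (true :: nseq (size E).-1 false).
      by rewrite /= size_nseq.
    rewrite {2}/E [mask _ _]/= mask_false big_cons big_nil !mulg1 mulgV invg1.
    exact: (@squares_series1 F j.+1).
  exists (r (a * x)) => //.
  have eE : (r (a * x))^-1 * (a * x) \in E.
    by rewrite inE; apply/orP; right; apply/allpairsP; exists (a, x).
  have [m' sm' m'P] := sub_products jE eE sm.
  exists m' => //.
  set P' := \prod_(x <- mask m' E) x in m'P *.
  set P := \prod_(x <- mask m E) x in m'P mg.
  have := @squares_seriesM F j.+1 _ _ m'P mg; congr (squares_series _ _).
  by rewrite !invgM !mulgA !(mulgVK, mulgK).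
exists [seq x * \prod_(y <- mask (m : bitseq) E) y | x <- s, m <- map val (enum {: (size E).-tuple bool})].
move=> g; have [x xs [m sm mg]] := prodE g.
exists (x * \prod_(y <- mask m E) y) => //.
apply/allpairsP; exists (x, m) => /=; split=> //.
apply/mapP; exists (Tuple (introT eqP sm)) => //.
by rewrite mem_enum.
Qed.

Lemma transversal_exists j : exists s, transversal j s.
Proof.
elim: j => [|j [s /transversal_step//]].
by exists [:: 1] => g; exists 1; rewrite ?inE.
Qed.

Variable j : nat.
Local Notation H := (squares_quotient F j).

Definition sq_enum : seq H :=
  undup (map (proj_sq j) (projT1 (cid (transversal_exists j)))).

Lemma mem_sq_enum a : a \in sq_enum.
Proof.
rewrite mem_undup; case: cid => s sP /=.
rewrite -[a]proj_sq_reprK; have [x xs /proj_sqP<-] := sP (repr a).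
exact: map_f.
Qed.

Lemma sq_enumP : Finite.axiom sq_enum.
Proof. by move=> a; rewrite count_uniq_mem ?undup_uniq // mem_sq_enum. Qed.

Lemma sq_indexK :
  pcancel (fun a : H => index a sq_enum) (fun i => onth sq_enum i).
Proof.
by move=> a; rewrite onthE (nth_map a) ?index_mem ?nth_index ?mem_sq_enum.
Qed.

HB.instance Definition _ :=
  Choice_isCountable.Build H sq_indexK.
HB.instance Definition _ := fintype.isFinite.Build H sq_enumP.

End Finiteness.

Section SL2.
Variable R : comNzRingType.

Record SL2 := MkSL2 {mxSL :> 'M[R]_2; _ : \det mxSL == 1}.

HB.instance Definition _ := [isSub for mxSL].
HB.instance Definition _ := [Choice of SL2 by <:].

Lemma detSL (A : SL2) : \det A = 1.
Proof. exact/eqP/(valP A). Qed.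

Fact SL_one_subproof : \det (1%:M : 'M[R]_2) == 1.
Proof. by rewrite det1. Qed.
Fact SL_mul_subproof (A B : SL2) : \det (A *m B) == 1.
Proof. by rewrite det_mulmx !detSL mulr1. Qed.
Fact SL_inv_subproof (A : SL2) : \det (\adj A) == 1.
Proof.
have := congr1 determinant (mul_mx_adj A).
by rewrite det_mulmx detSL mul1r det1 => ->.
Qed.

Definition SL_one := MkSL2 SL_one_subproof.
Definition SL_mul A B := MkSL2 (SL_mul_subproof A B).
Definition SL_inv A := MkSL2 (SL_inv_subproof A).

Lemma SL_mulA : associative SL_mul.
Proof. by move=> A B C; apply: val_inj; rewrite /= mulmxA. Qed.
Lemma SL_mul1 : left_id SL_one SL_mul.
Proof. by move=> A; apply: val_inj; rewrite /= mul1mx. Qed.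
Lemma SL_mulr1 : right_id SL_one SL_mul.
Proof. by move=> A; apply: val_inj; rewrite /= mulmx1. Qed.
Lemma SL_mulV : left_inverse SL_one SL_inv SL_mul.
Proof. by move=> A; apply: val_inj; rewrite /= mul_adj_mx detSL. Qed.
Lemma SL_mulrV : right_inverse SL_one SL_inv SL_mul.
Proof. by move=> A; apply: val_inj; rewrite /= mul_mx_adj detSL. Qed.

HB.instance Definition _ :=
  isGroup.Build SL2 SL_mulA SL_mul1 SL_mulr1 SL_mulV SL_mulrV.

End SL2.

Fact red2_subproof (A : SL2 int) :
  \det (map_mx (intr : int -> 'Z_2) A) == 1.
Proof. by rewrite det_map_mx detSL rmorph1. Qed.

Definition red2 (A : SL2 int) : SL2 'Z_2 := MkSL2 (red2_subproof A).

Lemma red2M : {morph red2 : A B / (A * B)%g}.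
Proof. by move=> A B; apply: val_inj; rewrite /= map_mxM. Qed.
HB.instance Definition _ := isMultiplicative.Build _ _ red2 red2M.

Definition in_ker_red2 : {pred SL2 int} := [pred A | red2 A == 1%g].

Lemma ker_red2_group_closed : group_closed in_ker_red2.
Proof.
have red1 : red2 1%g = 1%g by apply: val_inj; rewrite /= map_mx1.
have redV A : red2 A^-1%g = (red2 A)^-1%g.
  by apply: (@mulgI _ (red2 A)); rewrite -red2M !mulgV.
split; first by rewrite inE red1.
by move=> A B; rewrite !inE red2M redV => /eqP-> /eqP->; rewrite mulgV.
Qed.

Record Q := MkQ {SL_of_Q :> SL2 int; _ : SL_of_Q \in in_ker_red2}.

HB.instance Definition _ := [isSub for SL_of_Q].
HB.instance Definition _ := [Choice of Q by <:].
HB.instance Definition _ :=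
  SubChoice_isSubGroup.Build _ _ Q ker_red2_group_closed.

Notation F3 := (free_group 'I_3).
Notation Hj := (squares_quotient F3).

(* Z/2^n as an additive group; the cyclic group 'I_m.+1 is used because 'Z_m is
   Z/2 for m = 1, whereas G_0 has to be trivial. *)
Notation Zmod2 n := 'I_(2 ^ n).-1.+1.
Notation Vn n := 'cV[Zmod2 n]_2.

Definition mxact n (A : 'M[int]_2) (v : Vn n) : Vn n :=
  \col_i \sum_(j < 2) v j 0 *~ A i j.

Lemma mxactD n A : {morph @mxact n A : v w / v + w}.
Proof.
move=> v w; apply/colP => i; rewrite !mxE -big_split /=.
by apply: eq_bigr => j _; rewrite mxE mulrzDl.
Qed.

Lemma mxactM n A B (v : Vn n) : mxact (A *m B) v = mxact A (mxact B v).
Proof.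
apply/colP => i; rewrite !mxE.
under [RHS]eq_bigr => k _ do rewrite mxE mulrz_suml.
rewrite exchange_big /=; apply: eq_bigr => j _.
rewrite mxE mulrz_sumr; apply: eq_bigr => k _.
by rewrite -mulrzA mulrC.
Qed.

Lemma mxactDl n A B (v : Vn n) : mxact (A + B) v = mxact A v + mxact B v.
Proof.
apply/colP => i; rewrite !mxE -big_split /=.
by apply: eq_bigr => j _; rewrite mxE mulrzDr.
Qed.

Lemma mxact1 n (v : Vn n) : mxact 1%:M v = v.
Proof.
apply/colP => i; rewrite !mxE (bigD1 i) //= mxE eqxx mulr1z big1 ?addr0 //.
by move=> j ji; rewrite mxE eq_sym (negPf ji).
Qed.

Lemma Zmod2_char n (x : Zmod2 n) : x *+ (2 ^ n) = 0.
Proof.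
have E : (2 ^ n = (2 ^ n).-1.+1)%N by rewrite prednK ?expn_gt0.
rewrite [X in _ *+ X]E; move: (_.-1) x => p x.
by apply: val_inj; rewrite Zp_mulrn /= modnMl.
Qed.

Section Construction.
Variable pi : {multiplicative F3 -> Q}.

Definition pimx (w : F3) : 'M[int]_2 := mxSL (SL_of_Q (pi w)).

Lemma pimxM u v : pimx (u * v)%g = pimx u *m pimx v.
Proof. by rewrite /pimx gmulfM. Qed.

Lemma pimx1 : pimx 1%g = 1%:M.
Proof.
have pi1 : pi 1%g = 1%g.
  by apply: (@mulgI _ (pi 1%g)); rewrite -gmulfM !mulg1.
by rewrite /pimx pi1.
Qed.

Lemma pimxV u : pimx u *m pimx u^-1%g = 1%:M.
Proof. by rewrite -pimxM mulgV pimx1. Qed.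

Lemma pimx_congr2 w : exists B, pimx w = 1%:M + 2 *: B.
Proof.
have /eqP/(congr1 (@mxSL _)) /= /matrixP E := valP (pi w).
exists (\matrix_(i, j) (((pimx w - 1%:M) i j) %/ 2)%Z).
apply/matrixP => i j; rewrite !mxE mulrC divzK ?subrKC//.
have := E i j; rewrite !mxE -/(pimx w) => Eij.
have ch2 : 2%N \in [pchar 'Z_2] by exact: (@pchar_Fp 2 isT).
by rewrite (dvdz_pcharf ch2) rmorphB /= Eij rmorph_nat subrr.
Qed.

(* Gamma_j(F_3) is mapped into the congruence subgroup of level 2^(j+1). *)
Lemma pimx_squares_series j w : squares_series j w ->
  exists B, pimx w = 1%:M + 2 ^+ j.+1 *: B.
Proof.
elim: j w => [w _|j IHj w]; first exact: pimx_congr2.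
pose C := [set w | exists B, pimx w = 1%:M + 2 ^+ j.+2 *: B].
suff : squares_series j.+1 `<=` C by apply.
apply: smallest_sub => [|_ [u /IHj[B uB] <-]].
  split=> [|u v [B uB] [B' vB]|u [B uB]].
  - by exists 0; rewrite pimx1 scaler0 addr0.
  - exists (B' + B *m pimx v); rewrite pimxM {1}uB mulmxDl mul1mx {1}vB.
    by rewrite -scalemxAl scalerDr addrA.
  - exists (- (B *m pimx u^-1%g)).
    have := pimxV u; rewrite {1}uB mulmxDl mul1mx -scalemxAl => <-.
    by rewrite scalerN addrK.
exists (B + 2 ^+ j *: (B *m B)); rewrite pimxM uB.
rewrite mulmxDl mul1mx mulmxDr mulmx1 -!scalemxAl -!scalemxAr.
move: (B *m B) => D; apply/matrixP => a b; rewrite !mxE !exprS; ring.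
Qed.

Lemma mxact_squares_series n w (v : Vn n) :
  squares_series (3 * n - 3)%N w -> mxact (pimx w) v = v.
Proof.
move=> /pimx_squares_series[B ->]; rewrite mxactDl mxact1.
rewrite [X in _ + X](_ : _ = 0) ?addr0 //.
apply/colP => i; rewrite !mxE big1 // => j _; rewrite !mxE.
have /subnK<- : (n <= (3 * n - 3).+1)%N by lia.
rewrite exprD mulrAC mulrzA; move: (_ *~ (_ * _)) => y.
by rewrite -natrX natz -pmulrn Zmod2_char.
Qed.

Section Level.
Variable n : nat.
Notation Hn := (Hj (3 * n - 3)%N).

(* The action of H_(3n-3) through its quotient Q_n, the image of Q modulo 2^n;
   it does not depend on the representative by HactE below. *)
Definition Hact (k : Hn) (v : Vn n) : Vn n := mxact (pimx (repr k)) v.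

Lemma HactE (w : F3) v : Hact (proj_sq _ w) v = mxact (pimx w) v.
Proof.
rewrite /Hact; have /proj_sqP := proj_sq_reprK (proj_sq (3 * n - 3) w).
set u := repr _ => uw; rewrite -[in RHS](mulVKg u w) pimxM mxactM.
by rewrite (mxact_squares_series _ uw).
Qed.

(* Library actions are right actions, hence the inverse; in the semi-direct
   product, k v k^-1 = Hact k v. *)
Definition Hact_r (v : Vn n) (k : Hn) : Vn n := Hact k^-1%g v.

Lemma HactM k l v : Hact (k * l)%g v = Hact k (Hact l v).
Proof.
rewrite -[k]proj_sq_reprK -[l]proj_sq_reprK -gmulfM !HactE.
by rewrite pimxM mxactM.
Qed.

Lemma Hact1 v : Hact 1%g v = v.
Proof. by rewrite -[1%g]/(proj_sq _ 1%g) HactE pimx1 mxact1. Qed.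

Fact Hact_r1 : Hact_r^~ 1%g =1 id.
Proof. by move=> v; rewrite /Hact_r invg1 Hact1. Qed.
Fact Hact_rM v : act_morph Hact_r v.
Proof. by move=> k l; rewrite /Hact_r invMg HactM. Qed.
Canonical Hact_r_action := TotalAction Hact_r1 Hact_rM.

Fact Hact_r_group_action : is_groupAction [set: Vn n]%SET Hact_r_action.
Proof.
move=> k _; rewrite inE; apply/andP; split.
  by apply/fintype.subsetP => v _; rewrite inE.
apply/morphicP => v w _ _; rewrite !actpermE /=.
exact: mxactD.
Qed.
Definition Haction := GroupAction Hact_r_group_action.

(* G_n = (Z/2^n)^2 >< H_(3n-3); the subtraction is truncated, so G_0 = 1. *)
Definition Gn : finGroupType := sdprod_by Haction.

Definition inV (v : Vn n) : Gn := sdpair1 Haction v.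
Definition inH (k : Hn) : Gn := sdpair2 Haction k.

(* The images of the u_i and of the standard basis of Z^2. *)
Definition Sn : {set Gn} :=
  ([set inH (proj_sq _ (fgen i)) | i : 'I_3] :|:
   [set inV (\col_j inZp (i == j)) | i : 'I_2])%SET.

Lemma inVJ v k : (inH k * inV v * (inH k)^-1)%g = inV (Hact k v).
Proof.
have := sdpair_act Haction (finset.in_setT v) (finset.in_setT k^-1%g).
rewrite /= /Hact_r invgK /inV => ->.
by rewrite [sdpair2 _ _](morphV (sdpair2_morphism Haction)) ?finset.in_setT // conjgE invgK mulgA.
Qed.

End Level.

Lemma card_G0 : #|Gn 0| = 1%N.
Proof.
apply/eqP/fintype1P; exists 1%g => x.
apply/val_inj/injective_projections.
  rewrite -[LHS]proj_sq_reprK -[RHS]proj_sq_reprK; exact/proj_sqP.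
by apply/colP => i; apply: val_inj; case: (_ i _) => -[] //; case: (_ i _) => -[].
Qed.

End Construction.

Section Graphs.
Variable T : finType.
Implicit Types (e : rel T) (A : {set T}).

Definition connected_graph e :=
  [/\ symmetric e, irreflexive e, (0 < #|T|)%N & forall x y, connect e x y].

(* By convention #|T| if there is no path from x to y. *)
Definition gdist e (x y : T) : nat :=
  find (fun k => [exists p : k.-tuple T, path e x p && (last x p == y)])
       (iota 0 #|T|).

Definition diam e A : nat := \max_(x in A) \max_(y in A) gdist e x y.

(* Each edge between A and its complement is counted once, oriented from A to
   the complement. *)
Definition edge_boundary e A : {set T * T} :=
  finset (fun xy : T * T => [&& xy.1 \in A, xy.2 \notin A & e xy.1 xy.2]).

(* The minimum over the empty family is +oo, i.e. for one-vertex graphs. *)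
Definition cheeger (R : realType) e : \bar R :=
  \big[mine/+oo%E]_(A : {set T} | (0 < #|A|)%N && (2 * #|A| <= #|T|)%N)
    (#|edge_boundary e A|%:R / #|A|%:R)%:E.

End Graphs.

Definition expander (R : realType) (X : nat -> finType)
    (e : forall n, rel (X n)) : Prop :=
  [/\ forall n, connected_graph (e n),
      exists D : nat, forall n (x : X n), (#|e n x| <= D)%N,
      (#|X n|)%N @[n --> \oo] --> \oo
    & exists2 c0 : R, 0 < c0 & forall n, (c0%:E <= cheeger R (e n))%E].

Definition cayley (gT : finGroupType) (S : {set gT}) : rel gT :=
  fun x y => (x != y) && ((x^-1 * y \in S) || (y^-1 * x \in S))%g.

Definition word_dist (gT : finGroupType) (S : {set gT}) : gT -> gT -> nat :=
  gdist (cayley S).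

(* A proper function [0, +oo[ -> [0, +oo[ : preimages of bounded sets are
   bounded. Only the values at nonnegative arguments matter. *)
Definition proper_function (R : realType) (rho : R -> R) : Prop :=
  (forall t, 0 <= t -> 0 <= rho t) /\
  (forall M, exists B, forall t, 0 <= t -> rho t <= M -> t <= B).

Definition coarse_embedding (R : realType) (X : nat -> Type)
    (dX : forall n, X n -> X n -> R) (Y : Type) (dY : Y -> Y -> R)
    (phi : forall n, X n -> Y) : Prop :=
  exists rho gamma : R -> R,
    [/\ proper_function rho, proper_function gamma &
        forall n (x y : X n),
          rho (dX n x y) <= dY (phi n x) (phi n y) <= gamma (dX n x y)].

Definition relative_poincare (R : realType) (gT : finGroupType)
    (S : {set gT}) (h : gT) (E : zmodType) (N : E -> R) (p C : R)
    (f : gT -> E) : Prop :=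
  \sum_(g : gT) N (f (g * h)%g - f g) `^ p <=
    C * \sum_(g : gT) \sum_(s in S) N (f (g * s)%g - f g) `^ p.

Section UniformlyCurved.
Variable R : realType.

(* LfunType is the type of the representatives of the classes forming L^p(nu),
   so Lpnorm is only a seminorm on it. *)
Definition Lpnorm d (T : measurableType d) (nu : {measure set T -> \bar R})
    (p : R) (p1 : (1 <= p%:E)%E) (f : LfunType nu p1) : R :=
  fine ('N[nu]_p%:E [EFin \o f])%E.

Section Bochner.
Variables (d : measure_display) (T : measurableType d).
Variables (mu : {measure set T -> \bar R}) (X : completeNormedModType R).

Definition strongly_measurable (F : T -> X) : Prop :=
  exists2 s : nat -> T -> X,
    forall n, finite_set (range (s n)) /\
              forall x, measurable (s n @^-1` [set x]) &
    forall t, s n t @[n --> \oo] --> F t.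

Definition bochner_norm2 (F : T -> X) : \bar R :=
  ('N[mu]_2%:E [EFin \o (fun t => `|F t|%R)])%E.

(* Representatives of the elements of L^2(T, mu, X). *)
Definition bochner_L2 (F : T -> X) : Prop :=
  strongly_measurable F /\ (bochner_norm2 F < +oo)%E.

Local Notation L2 := (LfunType mu (lee1n 2)).

(* Operators of L^2 are given on representatives, hence linear up to almost
   everywhere equality. *)
Definition L2_linear (U : L2 -> L2) : Prop :=
  forall (a : R) (f g : L2), U (a *: f + g) = a *: U f + U g %[ae mu].

Definition Lq_bounded (U : L2 -> L2) (q : \bar R) (c : R) : Prop :=
  forall f : L2, ('N[mu]_q [EFin \o U f] <= c%:E * 'N[mu]_q [EFin \o f])%E.

(* U (x) id_X extends to an operator of norm at most c on L^2(T, mu, X). *)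
Definition bochner_bounded (U : L2 -> L2) (c : R) : Prop :=
  exists UX : (T -> X) -> T -> X,
    [/\ forall F, bochner_L2 F -> bochner_L2 (UX F),
        forall (a : R) F G, bochner_L2 F -> bochner_L2 G ->
          UX (fun t => a *: F t + G t) = (fun t => a *: UX F t + UX G t)
            %[ae mu],
        forall (f : L2) (x : X),
          UX (fun t => f t *: x) = (fun t => U f t *: x) %[ae mu] &
        forall F, bochner_L2 F ->
          (bochner_norm2 (UX F) <= c%:E * bochner_norm2 F)%E].

End Bochner.

Definition uniformly_curved (X : completeNormedModType R) : Prop :=
  exists2 Delta : R -> R, Delta eps @[eps --> 0^'+] --> 0 &
    forall eps : R, 0 < eps ->
    forall (d : measure_display) (T : measurableType d)
      (mu : {measure set T -> \bar R})
      (U : LfunType mu (lee1n 2) -> LfunType mu (lee1n 2)),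
      L2_linear U -> Lq_bounded U 2%:E eps ->
      Lq_bounded U 1%E 1 -> Lq_bounded U +oo%E 1 ->
      bochner_bounded X U (Delta eps).

End UniformlyCurved.

(* Main.v *)
Require Import Defs.
From HB Require Import structures.
From mathcomp Require Import all_boot all_order all_algebra all_fingroup zify ring lra.
From mathcomp Require Import all_classical all_reals all_analysis.
From mathcomp Require Import ess_sup_inf measurable_realfun.

Set Implicit Arguments.
Unset Strict Implicit.
Unset Printing Implicit Defensive.

(** The group V = (Z/2^n)^2 is normal in G_n, with quotient H = F_3/Gamma_(3n-3).

The Poincare inequalities come from a spectral gap relative to V
([relative_T]), in the way one proves that Z^2 has relative property (T) in
its semi-direct product with SL(2, Z). Under right translations by V, a real
function f on G_n has a spectral measure on the dual of V, which is again
(Z/2^n)^2. When the gradient of f is small, translations by the two basis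
vectors force this measure to concentrate near 0, where the action of matrices
on (Z/2^n)^2 looks like the one on Z^2, and translations by words that map to
the elementary matrices with entry 2 or -2 make it almost invariant under
those. As these matrices play ping-pong on the plane ([ping_pong]), almost all
the mass must sit at 0, that is, f is almost V-invariant.

From the exponent 2 one passes to indicator functions, hence to the exponent 1
by decomposing functions into cuts ([cut_cone]), hence to any exponent p by
applying the exponent 1 to the p-th power of f, once its means over the cosets
of V have been subtracted ([poincare_extrapolation]); an L^p-space is then
treated pointwise. For a uniformly curved target, the spectral gap makes a
power of the lazy random walk, restricted to the functions with mean zero on
the cosets of V, small on L^2, whereas it is bounded on L^1 and L^oo; uniform
curvature makes it small on vector-valued functions too, and these are then
controlled by their gradient ([uniformly_curved_poincare]). A coarse embedding
is excluded since the inequality would put all of V, which has 4^n elements, in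
a ball of bounded radius ([no_coarse_embedding]).

For maps from an expander, the quotient H is treated with walls. Each edge of
the Cayley graph of F/Gamma_j defines a wall in F/Gamma_(j+1), according to the
parity of the number of times that a path crosses the edge. The expansion
inequality summed over all walls bounds the mean wall distance between two
points of the image. Below the girth of F/Gamma_j, which tends to infinity
([girth_squares_series]), the wall distance determines the word metric
([short_representative]). So a definite proportion of the expander lies over
one point of H ([wall_fibre]), that is, in one coset of V. The abelian group V
with the metric induced from G_n has uniform polynomial growth, hence Folner
sets of bounded size, and an expander cannot be spread over their translates:
a definite proportion lies over one point ([abelian_fibre]). The claim on
diameters follows, since both the diameter of a large subset of an expander
and the one of the expander are of the order of the logarithm of the number of
vertices ([fibre_diameter]). *)

Import Order.TTheory GRing.Theory Num.Theory.
Import numFieldNormedType.Exports.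

Local Open Scope classical_set_scope.
Local Open Scope ring_scope.

(** * Power functions and the cone of cuts *)

Section CutCone.
Variables (R : realType) (T : finType).

(** A function is a positive combination of indicator functions along which the
distances between values add up, so it is enough to check on cuts a linear
inequality between such distances. The induction lowers the top level of f onto
the next one, which splits off one indicator function. *)
Lemma cut_cone (w : T -> T -> R) :
  (forall A : {set T}, 0 <= \sum_x \sum_y w x y * ((x \in A) != (y \in A))%:R) ->
  forall f : T -> R, 0 <= \sum_x \sum_y w x y * `|f x - f y|.
Proof.
move=> wA f.
have [n] := ubnP #|[set xy : T * T | f xy.1 < f xy.2]%SET|.
elim: n f => // n IHn f fn.
have [[[a b] /= ab]|ab0] := pselect (exists xy : T * T, f xy.1 < f xy.2); last first.
  rewrite big1 // => x _; rewrite big1 // => y _.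
  suff -> : f x = f y by rewrite subrr normr0 mulr0.
  apply/eqP; rewrite eq_le !leNgt; apply/andP; split; apply/negP => xy; apply: ab0.
    by exists (y, x).
  by exists (x, y).
have [t _ tmax'] := arg_maxP f (isT : xpredT a).
have tmax x : f x <= f t by exact: tmax'.
have at_ : f a < f t by apply: (lt_le_trans ab); exact: tmax.
have [s /= st smax'] := @arg_maxP _ _ _ a (fun x => f x < f t) f at_.
have smax x : f x < f t -> f x <= f s by exact: smax'.
pose f' x := Num.min (f x) (f s).
pose A := [set x | f x == f t]%SET.
have notA x : x \notin A -> f x <= f s.
  by rewrite inE => xt; apply: smax; rewrite lt_neqAle xt tmax.
have decomp x y : `|f x - f y| = `|f' x - f' y| +
    (f t - f s) * ((x \in A) != (y \in A))%:R.
  have f'A z : f' z = if z \in A then f s else f z.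
    rewrite /f'; case: ifPn => [|/notA zs]; last exact/min_idPl.
    by rewrite inE => /eqP->; apply/min_idPr/ltW.
  rewrite !f'A; have [xA|/notA xA] := boolP (x \in A);
    have [yA|/notA yA] := boolP (y \in A) => /=; rewrite ?mulr0 ?mulr1 ?addr0 //.
  - by move: xA yA; rewrite !inE => /eqP-> /eqP->; rewrite !subrr.
  - move: xA; rewrite inE => /eqP->.
    rewrite !ger0_norm ?subr_ge0 ?tmax//; ring.
  - move: yA; rewrite inE => /eqP->.
    rewrite !ler0_norm ?subr_le0 ?tmax//; ring.
rewrite (_ : \sum_x _ = \sum_x \sum_y w x y * `|f' x - f' y| + (f t - f s) *
    \sum_x \sum_y w x y * ((x \in A) != (y \in A))%:R).
  apply: addr_ge0; last by apply: mulr_ge0 => //; rewrite subr_ge0 ltW.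
  apply: IHn; rewrite -ltnS; apply: leq_trans fn; rewrite ltnS; apply: proper_card; apply/properP; split.
    apply/fintype.subsetP => -[x y]; rewrite !inE /= /f'; rewrite !lt_min !gt_min.
    by case/andP => /orP[->//|sy] /orP[xs|]; [exact: lt_trans xs sy|rewrite ltxx].
  by exists (s, t); rewrite !inE //= /f' minxx (min_idPr _) ?ltxx// ltW.
rewrite mulr_sumr -big_split; apply: eq_bigr => x _.
rewrite mulr_sumr -big_split; apply: eq_bigr => y _.
by rewrite decomp mulrDr /=; congr (_ + _); rewrite mulrCA.
Qed.

End CutCone.

Section PowerInequalities.
Variables (R : realType) (p : R).
Hypothesis p1 : 1 <= p.
Implicit Types x y : R.

Let p0 : 0 < p. Proof. exact: lt_le_trans p1. Qed.
Let pn0 : p != 0. Proof. exact: lt0r_neq0. Qed.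

Lemma le_powRp x y : 0 <= x -> x <= y -> x `^ p <= y `^ p.
Proof.
by move=> x0 xy; apply: ge0_ler_powR; rewrite ?nnegrE ?(ltW p0)// (le_trans x0).
Qed.

Lemma powR_max_le x y z : 0 <= x -> 0 <= y -> 0 <= z -> z <= Num.max x y ->
  z `^ p <= x `^ p + y `^ p.
Proof.
move=> x0 y0 z0; rewrite le_max => /orP[] /(le_powRp z0) /le_trans; apply.
  by rewrite lerDl powR_ge0.
by rewrite lerDr powR_ge0.
Qed.

Lemma powR_add_le x y : 0 <= x -> 0 <= y -> (x + y) `^ p <= 2 `^ p * (x `^ p + y `^ p).
Proof.
move=> x0 y0; apply: (@le_trans _ _ ((2 * Num.max x y) `^ p)).
  apply: le_powRp; first exact: addr_ge0.
  by rewrite mulr_natl mulr2n lerD ?le_max ?lexx ?orbT.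
rewrite powRM ?le_max ?x0// ler_wpM2l ?powR_ge0//.
by apply: powR_max_le => //; rewrite le_max x0.
Qed.

Lemma powR_norm_sub_le x y : `|x - y| `^ p <= 2 `^ p * (`|x| `^ p + `|y| `^ p).
Proof.
apply: le_trans (powR_add_le _ _) => //.
by apply: le_powRp => //; rewrite ler_normB.
Qed.

Lemma powRp_split x : 0 <= x -> x `^ p = x * x `^ (p - 1).
Proof.
move=> x0; rewrite -[X in X * _](powRr1 x0) -powRD ?subrKC//.
by rewrite (negPf pn0).
Qed.

Lemma le_powRpB1 x y : 0 <= x -> x <= y -> x `^ (p - 1) <= y `^ (p - 1).
Proof.
by move=> x0 xy; apply: ge0_ler_powR; rewrite ?nnegrE ?subr_ge0// (le_trans x0).
Qed.

Lemma powR_superadd x y : 0 <= x -> 0 <= y -> x `^ p + y `^ p <= (x + y) `^ p.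
Proof.
move=> x0 y0; rewrite !powRp_split ?addr_ge0// mulrDl.
by apply: lerD; rewrite ler_wpM2l// le_powRpB1// ?lerDl ?lerDr.
Qed.

(** A substitute for Jensen's inequality that loses a factor 2^p and needs no
convexity: with b half the mean, x b^(p-1) <= b^p + x^p for every term x, and
the sum of these bounds gives b^p <= mean of the x^p. *)
Lemma powR_mean_le (I : finType) (A : {set I}) (x : I -> R) :
  (forall i, 0 <= x i) ->
  ((\sum_(i in A) x i) / #|A|%:R) `^ p <= 2 `^ p / #|A|%:R * \sum_(i in A) x i `^ p.
Proof.
move=> x0; set a := _ / _.
have a0 : 0 <= a by rewrite divr_ge0// sumr_ge0.
have [A0|An0] := eqVneq (#|A|%:R : R) 0.
  by rewrite /a A0 invr0 !mulr0 mul0r powR0.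
have [b ab b0] : exists2 b, a = 2 * b & 0 <= b.
  by exists (a / 2); [field|rewrite divr_ge0].
have key i : i \in A -> x i * b `^ (p - 1) <= b `^ p + x i `^ p.
  move=> _; have [xb|bx] := leP (x i) b.
    rewrite (le_trans (ler_wpM2r _ xb)) ?powR_ge0// -powRp_split//.
    by rewrite lerDl powR_ge0.
  rewrite (@le_trans _ _ (x i `^ p))// ?lerDr ?powR_ge0//.
  by rewrite (powRp_split (x0 i)) ler_wpM2l// le_powRpB1// ltW.
have : \sum_(i in A) x i * b `^ (p - 1) <= \sum_(i in A) (b `^ p + x i `^ p).
  exact: ler_sum.
rewrite -mulr_suml big_split /= sumr_const.
have -> : \sum_(i in A) x i = 2 * (#|A|%:R * b).
  by rewrite mulrCA -ab /a mulrC divfK.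
rewrite -[2 * _ * _]mulrA -[#|A|%:R * _ * _]mulrA -(powRp_split b0) => H.
rewrite ab.
rewrite powRM// -!mulrA ler_wpM2l ?powR_ge0//.
rewrite ler_pdivlMl ?lt_def ?An0//=.
move: H; rewrite -[b `^ p *+ _]mulr_natl.
by move: (#|A|%:R * _) => u; lra.
Qed.

(** The Mazur map from L^p to L^1. *)
Definition mazur x := Num.sg x * `|x| `^ p.

Lemma mazurN x : mazur (- x) = - mazur x.
Proof. by rewrite /mazur sgrN normrN mulNr. Qed.
Lemma ge0_mazur x : 0 <= x -> mazur x = x `^ p.
Proof.
rewrite le_eqVlt => /predU1P[<-|x0]; first by rewrite /mazur sgr0 mul0r powR0.
by rewrite /mazur gtr0_sg// mul1r gtr0_norm.
Qed.
Lemma norm_mazur x : `|mazur x| = `|x| `^ p.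
Proof.
wlog x0 : x / 0 <= x => [H|].
  by have [/H//|/ltW x0] := leP 0 x; rewrite -[x]opprK mazurN !normrN H ?normrN ?oppr_ge0.
by rewrite ge0_mazur// !ger0_norm// powR_ge0.
Qed.

Lemma sym2_ind (P : R -> R -> Prop) : (forall x y, P x y -> P y x) ->
  (forall x y, P x y -> P (- x) (- y)) ->
  (forall x y, 0 <= x -> y <= x -> `|y| <= x -> P x y) -> forall x y, P x y.
Proof.
move=> Ps Pn H x y.
wlog xy : x y / `|y| <= `|x| => [W|].
  by have [/W//|/ltW/W] := leP `|y| `|x|; exact: Ps.
wlog x0 : x y xy / 0 <= x => [W|].
  have [/W|/ltW x0] := leP 0 x; first exact.
  by rewrite -[x]opprK -[y]opprK; apply: Pn; apply: W; rewrite ?normrN// oppr_ge0.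
move: xy; rewrite (ger0_norm x0) => xy; apply: H => //.
by rewrite (le_trans (ler_norm _)).
Qed.

(** For equal signs this is superadditivity of the p-th power; for opposite signs
it is [powR_add_le]. *)
Lemma mazur_lower x y : `|x - y| `^ p <= 2 `^ p * `|mazur x - mazur y|.
Proof.
move: x y; apply: sym2_ind => [x y|x y|x y x0 yx nyx].
- by rewrite distrC (distrC (mazur y)).
- by rewrite !mazurN -!opprD !normrN.
have [y0|/ltW y0] := leP 0 y.
  rewrite !ge0_mazur// ger0_norm ?subr_ge0// ger0_norm ?subr_ge0 ?le_powRp//.
  have := @powR_superadd (x - y) y; rewrite subr_ge0 subrK => /(_ yx y0) H.
  rewrite (@le_trans _ _ (x `^ p - y `^ p))// ?lerBrDr//.
  rewrite ler_peMl// ?subr_ge0 ?le_powRp//.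
  by rewrite -[leLHS](powRr0 2) ler_powR ?ler1n// ltW.
rewrite -[y]opprK mazurN !ge0_mazur ?oppr_ge0// !opprK.
rewrite !ger0_norm ?addr_ge0 ?powR_ge0 ?oppr_ge0//.
by rewrite powR_add_le ?oppr_ge0.
Qed.

(** Either x and y are relatively close, and then so are their p-th powers, or
|x - y|^p is at least a multiple of max(|x|, |y|)^p. Having eps as small as one
likes is what lets [poincare_extrapolation] absorb the first term. *)
Lemma mazur_upper (eps : R) : 0 < eps -> exists2 K : R, 0 <= K & forall x y,
  `|mazur x - mazur y| <= eps * (`|x| `^ p + `|y| `^ p) + K * `|x - y| `^ p.
Proof.
move=> e0.
have [k pk] : exists k : nat, p <= k%:R.
  by exists (Num.bound p); rewrite ltW// archi_boundP// ltW.
have k0 : 0 < k%:R :> R by rewrite (lt_le_trans p0).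
pose d := Num.min 1 (eps / k%:R).
have d0 : 0 < d by rewrite lt_min ltr01 divr_gt0.
have d1 : d <= 1 by rewrite ge_min lexx.
have kd : k%:R * d <= eps by rewrite mulrC -ler_pdivlMr// ge_min lexx orbT.
exists (2 * d^-1 `^ p); first by rewrite mulr_ge0 ?powR_ge0.
apply: sym2_ind => [x y|x y|x y x0 yx nyx].
- by rewrite distrC [`|y - x|]distrC [`|y| `^ p + _]addrC.
- by rewrite !mazurN -!opprD !normrN.
have [dx|dx] := leP (d * x) (x - y).
  have xy0 : 0 <= x - y by rewrite subr_ge0.
  rewrite -[X in X <= _]add0r lerD//.
    by rewrite mulr_ge0 ?(ltW e0)// addr_ge0 ?powR_ge0.
  apply: (le_trans (ler_normB _ _)); rewrite !norm_mazur (ger0_norm x0) (ger0_norm xy0).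
  apply: (@le_trans _ _ (2 * x `^ p)); first by rewrite mulr_natl mulr2n lerD2l le_powRp.
  rewrite -mulrA ler_wpM2l// -powRM ?invr_ge0 ?(ltW d0)//.
  by rewrite le_powRp// ler_pdivlMl.
have xy : (1 - d) * x <= y by rewrite mulrBl mul1r; lra.
have y0 : 0 <= y by rewrite (le_trans _ xy)// mulr_ge0// subr_ge0.
rewrite ler_wpDr ?mulr_ge0 ?powR_ge0//.
rewrite !ge0_mazur// ger0_norm ?subr_ge0 ?le_powRp// !ger0_norm//.
apply: (@le_trans _ _ (eps * x `^ p)); last by rewrite ler_wpM2l ?(ltW e0)// lerDl powR_ge0.
have := @le_powRp _ _ (mulr_ge0 _ x0) xy; rewrite subr_ge0 => /(_ d1) H.
suff : (1 - eps) * x `^ p <= y `^ p by lra.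
apply: le_trans H; rewrite powRM ?subr_ge0// ler_wpM2r ?powR_ge0//.
apply: (@le_trans _ _ ((1 - d) ^+ k)).
  apply: (@le_trans _ _ (1 - k%:R * d)); first by rewrite lerB.
  (* Bernoulli's inequality, for an integer k >= p. *)
  elim: (k) => [|i IH]; first by rewrite mul0r subr0 expr0.
  rewrite exprS; apply: (@le_trans _ _ ((1 - d) * (1 - i%:R * d))); last first.
    by rewrite ler_wpM2l// subr_ge0.
  rewrite -natr1 -subr_ge0 (_ : _ - _ = i%:R * d ^+ 2); last by ring.
  by rewrite mulr_ge0 ?exprn_ge0 ?(ltW d0).
have [->|dn1] := eqVneq d 1.
  by rewrite subrr powR0// expr0n; case: eqP k0 => [->|//]; rewrite ltxx.
have dlt : d < 1 by rewrite lt_neqAle dn1.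
rewrite -powR_mulrn ?subr_ge0//; apply: ger_powR => //.
by rewrite subr_gt0 dlt /= gerBl ltW.
Qed.

End PowerInequalities.

(** * Extrapolation of relative Poincare inequalities *)

Section CosetMean.
Variables (R : realType) (gT : finGroupType).

Lemma sum_mulgr (E : nmodType) (F : gT -> E) h : \sum_g F (g * h)%g = \sum_g F g.
Proof. by rewrite [RHS](reindex_inj (mulIg h)). Qed.

Variable V : {group gT}.

(** The conditional expectation onto the functions that are invariant under right
translations by V. *)
Definition coset_mean (E : lmodType R) (f : gT -> E) (g : gT) : E :=
  #|V|%:R^-1 *: \sum_(h in V) f (g * h)%g.

Lemma card_group_unit : #|V|%:R != 0 :> R.
Proof. by rewrite pnatr_eq0 -lt0n cardG_gt0. Qed.

Variable E : lmodType R.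
Implicit Type f : gT -> E.

Lemma coset_meanV f g h : h \in V -> coset_mean f (g * h) = coset_mean f g.
Proof.
move=> hV; rewrite /coset_mean; congr (_ *: _).
rewrite [RHS](reindex_inj (mulgI h)).
by apply: eq_big => k; rewrite ?groupMl// mulgA.
Qed.

Lemma coset_meanB f1 f2 g :
  coset_mean (fun x => f1 x - f2 x) g = coset_mean f1 g - coset_mean f2 g.
Proof. by rewrite /coset_mean -scalerBr sumrB. Qed.

Lemma coset_mean_const (c : E) g : coset_mean (fun=> c) g = c.
Proof.
by rewrite /coset_mean sumr_const -[c *+ _]scaler_nat scalerA mulVf ?scale1r// card_group_unit.
Qed.

Lemma coset_mean_idem f g : coset_mean (coset_mean f) g = coset_mean f g.
Proof.
rewrite -[RHS](coset_mean_const _ g) /coset_mean; congr (_ *: _).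
by apply: eq_bigr => h hV; exact: coset_meanV.
Qed.

(** Since V is normal, subtracting the coset means only changes the gradient by
the coset means of the gradient. *)
Lemma coset_mean_mulr f g s : fingroup.normal V [set: gT]%SET ->
  coset_mean f (g * s)%g = coset_mean (fun x => f (x * s)%g) g.
Proof.
case/andP => _ /fintype.subsetP /(_ s); rewrite finset.in_setT => /(_ isT) nVs.
rewrite /coset_mean; congr (_ *: _).
rewrite (reindex_inj (conjg_inj s)); apply: eq_big => h.
  by rewrite memJ_norm.
by move=> _; rewrite conjgE !mulgA mulgK.
Qed.

End CosetMean.

Section Extrapolation.
Variable R : realType.
Local Notation normR := (Num.norm : R -> R).

(** On indicator functions the exponents 1 and 2 give the same inequality, and the
exponent 1 extends from cuts to all functions. *)
Lemma poincare_cut (gT : finGroupType) (S : {set gT}) (h : gT) (C : R) :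
  (forall f : gT -> R, relative_poincare S h normR 2 C f) ->
  forall f : gT -> R, \sum_g `|f (g * h)%g - f g| <=
    C * \sum_g \sum_(s in S) `|f (g * s)%g - f g|.
Proof.
move=> P2 f.
pose w x y : R := C * (\sum_(s in S) (y == x * s)%g%:R) - (y == x * h)%g%:R.
have wE (F : gT -> gT -> R) : \sum_x \sum_y w x y * F x y =
    C * (\sum_x \sum_(s in S) F x (x * s)%g) - \sum_x F x (x * h)%g.
  have single x z : \sum_y (y == z)%:R * F x y = F x z.
    rewrite (bigD1 z)//= eqxx mul1r big1 ?addr0// => y /negPf->.
    by rewrite mul0r.
  rewrite mulr_sumr -sumrB; apply: eq_bigr => x _.
  under eq_bigr => y _ do rewrite mulrBl -mulrA.
  rewrite sumrB single; congr (_ - _); rewrite -mulr_sumr; congr (_ * _).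
  under eq_bigr => y _ do rewrite mulr_suml.
  by rewrite exchange_big; apply: eq_bigr => s _ /=; rewrite single.
suff /cut_cone/(_ f) : forall A : {set gT},
    0 <= \sum_x \sum_y w x y * ((x \in A) != (y \in A))%:R.
  rewrite (wE (fun x y => `|f x - f y|)) subr_ge0.
  under eq_bigr => x _ do rewrite distrC.
  move/le_trans; apply; rewrite le_eqVlt; apply/orP; left; apply/eqP.
  congr (_ * _); apply: eq_bigr => x _; apply: eq_bigr => s _; exact: distrC.
move=> A; rewrite wE subr_ge0.
have := P2 (fun x => (x \in A)%:R); rewrite /relative_poincare.
have E x y : `|(y \in A)%:R - (x \in A)%:R| `^ 2 = ((x \in A) != (y \in A))%:R :> R.
  case: (x \in A); case: (y \in A); rewrite ?subrr ?subr0 ?sub0r ?normrN ?normr0 ?normr1 ?powR0 ?powR1//.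
under eq_bigr => x _ do rewrite E.
move/le_trans; apply.
rewrite le_eqVlt; apply/orP; left; apply/eqP; congr (_ * _).
by apply: eq_bigr => x _; apply: eq_bigr => s _; rewrite E.
Qed.

(** Relative form of Matousek's extrapolation. Let f' be f minus its means over
the cosets of V. The exponent 1 is applied to the Mazur image of f'. As f' has
mean zero on cosets, the left-hand sides dominate on average the p-th power of
the norm of f' ([TV] below). By [mazur_upper] the right-hand side is at most a
small multiple of that power, to be absorbed, plus a multiple of the gradient of
f', which is controlled by the one of f. The constant only depends on p, C and
the bound m on the number of generators. *)
Lemma poincare_extrapolation (p C : R) (m : nat) : 1 <= p -> 0 <= C ->
  exists2 C' : R, 0 < C' &
    forall (gT : finGroupType) (S : {set gT}) (V : {group gT}),
      fingroup.normal V [set: gT]%SET -> (#|S| <= m)%N ->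
      (forall h (f : gT -> R), h \in V -> relative_poincare S h normR 2 C f) ->
      forall h (f : gT -> R), h \in V -> relative_poincare S h normR p C' f.
Proof.
move=> p1 C0.
have p0 : 0 < p by exact: lt_le_trans p1.
pose b : R := 2 `^ p.
have b0 : 0 < b by exact: powR_gt0.
pose eps := (4 * (b * b * (C + 1) * (m%:R + 1)))^-1.
have eps0 : 0 < eps by rewrite invr_gt0 !mulr_gt0// ltr_wpDl.
have [K K0 upper] := mazur_upper p1 eps0.
pose D := 2 * (b * b * (C * K)) * (b * (1 + b)).
exists (b * (2 * D) + 1).
  by rewrite ltr_wpDl// !mulr_ge0 ?addr_ge0 ?(ltW b0)//.
move=> gT S V nV Sm P2 h0 f h0V.
pose f' g := f g - (coset_mean V (f : gT -> R^o) g : R).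
pose T := \sum_g `|f' g| `^ p.
pose En := \sum_g \sum_(s in S) `|f (g * s)%g - f g| `^ p.
pose E' := \sum_g \sum_(s in S) `|f' (g * s)%g - f' g| `^ p.
have T0 : 0 <= T by apply: sumr_ge0 => g _; exact: powR_ge0.
have En0 : 0 <= En by apply: sumr_ge0 => g _; apply: sumr_ge0 => s _; exact: powR_ge0.
have V0 := @card_group_unit R _ V.
have V00 : 0 < #|V|%:R :> R by rewrite ltr0n cardG_gt0.
have mean_le (u : gT -> R) g : `|(coset_mean V (u : gT -> R^o) g : R)| `^ p <=
    b / #|V|%:R * \sum_(h in V) `|u (g * h)%g| `^ p.
  apply: le_trans (powR_mean_le p1 _ (fun h => normr_ge0 (u (g * h)%g))).
  apply: le_powRp => //.
  rewrite /coset_mean /= /GRing.scale /= normrM gtr0_norm ?invr_gt0//.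
  by rewrite mulrC ler_wpM2r ?invr_ge0 ?(ltW V00)// ler_norm_sum.
have E'_le : E' <= b * (1 + b) * En.
  rewrite /E' /En exchange_big [X in _ * X]exchange_big mulr_sumr.
  apply: ler_sum => s _ /=.
  pose d g := f (g * s)%g - f g.
  have f'd g : f' (g * s)%g - f' g = d g - (coset_mean V (d : gT -> R^o) g : R).
    rewrite /f' coset_mean_mulr// /d.
    rewrite (@coset_meanB R _ V R^o (fun g => f (g * s)%g) f); ring.
  apply: (@le_trans _ _ (\sum_g b * (`|d g| `^ p + b / #|V|%:R * \sum_(h in V) `|d (g * h)%g| `^ p))).
    apply: ler_sum => g _; rewrite f'd (le_trans (powR_norm_sub_le p1 _ _))//.
    by rewrite ler_wpM2l ?(ltW b0)// lerD2l.
  rewrite -mulr_sumr -mulrA ler_wpM2l ?(ltW b0)// big_split /= -mulr_sumr exchange_big /=.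
  have sumd h : \sum_g `|d (g * h)%g| `^ p = \sum_g `|d g| `^ p.
    exact: (sum_mulgr (fun g => `|d g| `^ p)).
  rewrite [X in b / _ * X](eq_bigr (fun=> \sum_g `|d g| `^ p)); last by move=> h _; exact: sumd.
  rewrite sumr_const -[X in b / _ * X]mulr_natl mulrA divfK// mulrDl mul1r.
  by rewrite lexx.
have mean0 g : (coset_mean V (f' : gT -> R^o) g : R) = 0.
  rewrite /f' (@coset_meanB R _ V R^o f (coset_mean V (f : gT -> R^o))).
  by rewrite coset_mean_idem subrr.
(* The mean of f' over a coset is 0, so f' g is the mean of f' g - f' (g h). *)
have TV : T <= b / #|V|%:R * \sum_(h in V) \sum_g `|f' (g * h)%g - f' g| `^ p.
  rewrite exchange_big mulr_sumr; apply: ler_sum => g _ /=.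
  apply: le_trans (mean_le (fun x => f' x - f' g) g).
  rewrite (@coset_meanB R _ V R^o f' (fun=> f' g)) mean0 coset_mean_const.
  by rewrite sub0r normrN.
have sumf' h : \sum_g `|f' (g * h)%g| `^ p = T.
  exact: (sum_mulgr (fun g => `|f' g| `^ p)).
have hb h : h \in V -> \sum_g `|f' (g * h)%g - f' g| `^ p <=
    b * (C * (eps * (2 * m%:R * T) + K * E')).
  move=> hV; apply: (@le_trans _ _ (\sum_g b * `|mazur p (f' (g * h)%g) - mazur p (f' g)|)).
    by apply: ler_sum => g _; exact: mazur_lower.
  rewrite -mulr_sumr ler_wpM2l ?(ltW b0)//.
  apply: (le_trans (poincare_cut (fun f => P2 h f hV) (fun g => mazur p (f' g)))).
  rewrite ler_wpM2l//.
  apply: (@le_trans _ _ (\sum_g \sum_(s in S) (eps * (`|f' (g * s)%g| `^ p + `|f' g| `^ p) +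
      K * `|f' (g * s)%g - f' g| `^ p))).
    by apply: ler_sum => g _; apply: ler_sum => s _; exact: upper.
  under eq_bigr => g _ do rewrite big_split /= -!mulr_sumr.
  rewrite big_split /= -!mulr_sumr lerD2r ler_wpM2l ?(ltW eps0)//.
  rewrite exchange_big /=.
  rewrite (eq_bigr (fun=> T + T)); last first.
    by move=> s _; rewrite big_split; congr (_ + _); exact: sumf'.
  rewrite sumr_const (_ : (T + T) *+ #|S| = 2 * #|S|%:R * T).
    by rewrite ler_wpM2r// ler_wpM2l// ler_nat.
  by rewrite -[_ *+ _]mulr_natl; ring.
have T_le : T <= b * (b * (C * (eps * (2 * m%:R * T) + K * E'))).
  apply: (le_trans TV); rewrite -mulrA ler_wpM2l ?(ltW b0)//.
  rewrite ler_pdivrMl//; move: hb; set Z := b * _ => hb.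
  by rewrite mulr_natl -sumr_const; exact: ler_sum.
(* The choice of eps makes the coefficient of T on the right at most 1 / 2. *)
have T_D : T <= D * En.
  have small : b * (b * (C * (eps * (2 * m%:R * T)))) <= T / 2.
    rewrite (_ : b * _ = (4 * (b * b * C * m%:R) * eps) * (T / 2)); last by field.
    rewrite ler_piMl ?divr_ge0// ler_pdivrMr ?mul1r; last by rewrite !mulr_gt0// ltr_wpDl.
    rewrite ler_wpM2l// -!mulrA !ler_wpM2l ?(ltW b0)// ler_pM// lerDl//.
  have : T <= 2 * (b * b * (C * K) * E').
    have -> : b * b * (C * K) * E' = b * (b * (C * (K * E'))) by ring.
    move: T_le small; rewrite !mulrDr.
    by move: (b * (b * (C * (eps * _)))) (b * (b * (C * (K * _)))) => u v; lra.
  move/le_trans; apply; rewrite /D -!mulrA !ler_wpM2l ?(ltW b0)//.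
  by rewrite mulrA.
have -> : relative_poincare S h0 normR p (b * (2 * D) + 1) f =
   (\sum_g `|f' (g * h0)%g - f' g| `^ p <= (b * (2 * D) + 1) * En).
  rewrite /relative_poincare; congr (is_true (_ <= _)).
  apply: eq_bigr => g _; rewrite /f' coset_meanV//; congr (`|_| `^ _); ring.
apply: (@le_trans _ _ (\sum_g b * (`|f' (g * h0)%g| `^ p + `|f' g| `^ p))).
  by apply: ler_sum => g _; exact: powR_norm_sub_le.
rewrite -mulr_sumr big_split /= sumf' -/T -mulr2n -[T *+ 2]mulr_natl.
apply: (@le_trans _ _ (b * (2 * (D * En)))).
  by rewrite !ler_wpM2l ?(ltW b0).
by rewrite [leRHS]mulrDl mul1r !mulrA lerDl.
Qed.

End Extrapolation.

(** * The lazy random walk relative to a normal subgroup *)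

Section Averages.
Variables (R : realType) (gT : finGroupType).

Definition avg (A : {set gT}) (E : lmodType R) (f : gT -> E) (g : gT) : E :=
  #|A|%:R^-1 *: \sum_(a in A) f (g * a)%g.

(** The variance is nonnegative. *)
Lemma mean_sqr (I : finType) (A : {set I}) (x : I -> R) :
  (#|A|%:R^-1 * \sum_(i in A) x i) ^+ 2 <= #|A|%:R^-1 * \sum_(i in A) x i ^+ 2.
Proof.
set n : R := #|A|%:R; set s := \sum_(i in A) x i.
have [n0|n0] := eqVneq n 0; first by rewrite n0 invr0 !mul0r expr0n.
have npos : 0 < n by rewrite lt_def n0 ler0n.
have : 0 <= \sum_(i in A) (x i - n^-1 * s) ^+ 2 by apply: sumr_ge0 => i _; exact: sqr_ge0.
have [t tE] : exists t, t = n^-1 * s by eexists.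
have st : s = n * t by rewrite tE mulVKf.
rewrite -tE.
have -> : \sum_(i in A) (x i - t) ^+ 2 = \sum_(i in A) x i ^+ 2 - n * t ^+ 2.
  transitivity (\sum_(i in A) (x i ^+ 2 - 2 * t * x i + t ^+ 2)).
    by apply: eq_bigr => i _; ring.
  rewrite big_split /= sumrB -mulr_sumr sumr_const -/s -[_ *+ #|A|]mulr_natl -/n.
  by rewrite st; ring.
by rewrite subr_ge0 -ler_pdivlMl.
Qed.

Variables (E : normedModType R).
Implicit Types (A : {set gT}) (f : gT -> E).

Definition energy2 f : R := \sum_g `|f g| ^+ 2.

Lemma energy2_ge0 f : 0 <= energy2 f.
Proof. by apply: sumr_ge0 => g _; rewrite sqr_ge0. Qed.

Lemma norm_avg A f g : `|avg A f g| <= #|A|%:R^-1 * \sum_(a in A) `|f (g * a)%g|.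
Proof.
rewrite normrZ ger0_norm ?invr_ge0//.
by rewrite ler_wpM2l ?invr_ge0// ler_norm_sum.
Qed.

Lemma norm2_avg A f g : `|avg A f g| ^+ 2 <= #|A|%:R^-1 * \sum_(a in A) `|f (g * a)%g| ^+ 2.
Proof.
apply: le_trans (mean_sqr A (fun a => `|f (g * a)%g|)); rewrite ler_sqr ?nnegrE ?norm_avg//.
by rewrite mulr_ge0 ?invr_ge0// sumr_ge0.
Qed.

Lemma avg_sum A (F : gT -> R) : (forall g, 0 <= F g) ->
  \sum_g #|A|%:R^-1 * \sum_(a in A) F (g * a)%g <= \sum_g F g.
Proof.
move=> F0; rewrite -mulr_sumr exchange_big /=.
rewrite (eq_bigr (fun=> \sum_g F g)); last by move=> a _; exact: (sum_mulgr F).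
rewrite sumr_const -[(\sum_g F g) *+ _]mulr_natl mulrA ler_piMl ?sumr_ge0//.
by have [->|n0] := eqVneq (#|A|%:R : R) 0; rewrite ?mulr0// mulVf.
Qed.

Lemma energy2_avg A f : energy2 (avg A f) <= energy2 f.
Proof.
apply: le_trans (avg_sum A (fun g => sqr_ge0 `|f g|)).
by apply: ler_sum => g _; exact: norm2_avg.
Qed.

Lemma norm2_add (x y : E) : `|x + y| ^+ 2 <= 2 * `|x| ^+ 2 + 2 * `|y| ^+ 2.
Proof.
apply: (@le_trans _ _ ((`|x| + `|y|) ^+ 2)).
  by rewrite ler_sqr ?nnegrE ?addr_ge0// ler_normD.
rewrite -subr_ge0 (_ : _ - _ = (`|x| - `|y|) ^+ 2); last by ring.
exact: sqr_ge0.
Qed.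

Lemma energy2_add f1 f2 : energy2 (fun g => f1 g + f2 g) <= 2 * energy2 f1 + 2 * energy2 f2.
Proof.
rewrite /energy2 !mulr_sumr -big_split; apply: ler_sum => g _; exact: norm2_add.
Qed.

Lemma energy2_sub f1 f2 : energy2 (fun g => f1 g - f2 g) <= 2 * energy2 f1 + 2 * energy2 f2.
Proof.
apply: le_trans (energy2_add f1 (fun g => - f2 g)) _.
by rewrite lerD2l ler_wpM2l//; apply: ler_sum => g _; rewrite normrN.
Qed.

End Averages.

Section LazyWalk.
Variables (R : realType) (gT : finGroupType) (S : {set gT}) (V : {group gT}).
Hypothesis nV : fingroup.normal V [set: gT]%SET.

(** Thanks to the half of the identity, |lazy f|^2 is at most the scalar product
of lazy f and f for any contraction in place of the average over S, so S does
not have to be symmetric. *)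
Definition lazy (E : lmodType R) (f : gT -> E) (g : gT) : E := 2^-1 *: (f g + avg S f g).
Definition walk (E : lmodType R) k (f : gT -> E) : gT -> E := iter k (@lazy E) f.
Definition centred (E : lmodType R) (f : gT -> E) (g : gT) : E := f g - coset_mean V f g.
(** The half compensates for the norm of [centred] on L^1 and L^oo. *)
Definition walk_op (E : lmodType R) k (f : gT -> E) (g : gT) : E := 2^-1 *: walk k (centred f) g.

Section Lmod.
Variable E : lmodType R.
Implicit Types (A : {set gT}) (f : gT -> E).

Lemma coset_mean_avg f : coset_mean V f = avg V f. Proof. by []. Qed.

Lemma coset_mean_lazy f g : coset_mean V (lazy f) g = lazy (coset_mean V f) g.
Proof.
rewrite /lazy /coset_mean -scaler_sumr !scalerA [in RHS]scalerDr [_ * 2^-1]mulrC -!scalerA -scalerDr.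
rewrite big_split /= scalerDr; congr (_ *: (_ + _)).
rewrite /avg -scaler_sumr !scalerA [_ * #|S|%:R^-1]mulrC -scalerA exchange_big /=.
congr (_ *: _); rewrite scaler_sumr; apply: eq_bigr => s _.
by have := coset_mean_mulr f g s nV; rewrite /coset_mean => ->.
Qed.

Lemma centred_mean f g : coset_mean V (centred f) g = 0.
Proof. by rewrite /centred coset_meanB coset_mean_idem subrr. Qed.

Lemma lazyB f1 f2 g : lazy (fun x => f1 x - f2 x) g = lazy f1 g - lazy f2 g.
Proof.
rewrite /lazy -scalerBr; congr (_ *: _).
by rewrite /avg sumrB scalerBr opprD addrACA.
Qed.

Lemma lazyP (a : R) f1 f2 g : lazy (fun x => a *: f1 x + f2 x) g = a *: lazy f1 g + lazy f2 g.
Proof.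
rewrite /lazy /avg big_split /= -scaler_sumr.
rewrite !scalerDr !scalerA ![_ * a]mulrC addrACA; congr (_ + _ + _); rewrite ?scalerA.
Qed.

Lemma walkP k (a : R) f1 f2 g :
  walk k (fun x => a *: f1 x + f2 x) g = a *: walk k f1 g + walk k f2 g.
Proof.
elim: k g => //= k IH g; rewrite -lazyP; congr (lazy _ g); apply/funext => x; exact: IH.
Qed.

Lemma centredP (a : R) f1 f2 g :
  centred (fun x => a *: f1 x + f2 x) g = a *: centred f1 g + centred f2 g.
Proof.
rewrite /centred /coset_mean big_split /= -scaler_sumr !scalerDr scalerN !scalerA [_ * a]mulrC.
by rewrite opprD addrACA.
Qed.

Lemma walk_opP k (a : R) f1 f2 g :
  walk_op k (fun x => a *: f1 x + f2 x) g = a *: walk_op k f1 g + walk_op k f2 g.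
Proof.
rewrite /walk_op (_ : centred _ = (fun x => a *: centred f1 x + centred f2 x)).
  by rewrite walkP scalerDr !scalerA [2^-1 * a]mulrC.
by apply/funext => x; exact: centredP.
Qed.

Lemma walk_mean0 k f : (forall g, coset_mean V f g = 0) -> forall g, coset_mean V (walk k f) g = 0.
Proof.
move=> f0; elim: k => //= k IH g; rewrite coset_mean_lazy.
rewrite (_ : coset_mean V (walk k f) = fun=> 0); last by apply/funext.
by rewrite /lazy /avg big1// scaler0 addr0 scaler0.
Qed.

End Lmod.

Section Norms.
Variable E : normedModType R.
Implicit Types (A : {set gT}) (f : gT -> E).

Lemma energy2_lazy f : energy2 (lazy f) <= energy2 f.
Proof.
apply: (@le_trans _ _ (2^-1 * energy2 f + 2^-1 * energy2 (avg S f))); last first.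
  have := energy2_avg S f; lra.
rewrite /energy2 !mulr_sumr -big_split; apply: ler_sum => g _ /=.
rewrite normrZ exprMn ger0_norm ?invr_ge0//.
have := norm2_add (f g) (avg S f g); rewrite expr2; lra.
Qed.

(** The constant that telescoping f - walk k f produces, with 2 |x|^2 + 2 |y|^2 as
the bound for |x + y|^2. *)
Definition walk_cst (k : nat) : R := iter k (fun c => 2 + 2 * c) 0.
Lemma walk_cst_ge0 k : 0 <= walk_cst k.
Proof. by elim: k => //= k IH; rewrite addr_ge0// mulr_ge0. Qed.

Lemma energy2_walk_sub k f :
  energy2 (fun g => f g - walk k f g) <= walk_cst k * energy2 (fun g => f g - lazy f g).
Proof.
elim: k => [|k IH] /=.
  by rewrite mul0r /energy2 big1// => g _; rewrite subrr normr0 expr0n.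
rewrite -/(walk_cst k) mulrDl -mulrA.
rewrite (_ : (fun g => _) = fun g => (f g - lazy f g) + lazy (fun x => f x - walk k f x) g).
  apply: (le_trans (energy2_add _ _)); rewrite lerD2l ler_wpM2l//.
  exact: le_trans (energy2_lazy _) IH.
by apply/funext => g; rewrite lazyB addrA subrK.
Qed.

Lemma energy2_lazy_sub f : (0 < #|S|)%N ->
  energy2 (fun g => f g - lazy f g) <= \sum_g \sum_(s in S) `|f (g * s)%g - f g| ^+ 2.
Proof.
move=> S0; have S0R : 0 < #|S|%:R :> R by rewrite ltr0n.
apply: ler_sum => g _.
have -> : f g - lazy f g = 2^-1 *: (#|S|%:R^-1 *: \sum_(s in S) (f g - f (g * s)%g)).
  rewrite sumrB sumr_const scalerBr -[f g *+ _]scaler_nat scalerA mulVf ?gt_eqF// scale1r.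
  rewrite /lazy -/(avg S f g) scalerBr scalerDr opprD addrA; congr (_ - _).
  by rewrite -[X in X - _](scale1r (f g)) -scalerBl; congr (_ *: _); lra.
rewrite normrZ exprMn ger0_norm ?invr_ge0//.
have H : `|#|S|%:R^-1 *: \sum_(s in S) (f g - f (g * s)%g)| ^+ 2 <=
    \sum_(s in S) `|f (g * s)%g - f g| ^+ 2.
  apply: (@le_trans _ _ ((#|S|%:R^-1 * \sum_(s in S) `|f (g * s)%g - f g|) ^+ 2)).
    rewrite ler_sqr ?nnegrE// ?mulr_ge0 ?invr_ge0 ?sumr_ge0//.
    rewrite normrZ ger0_norm ?invr_ge0// ler_wpM2l ?invr_ge0//.
    by apply: (le_trans (ler_norm_sum _ _ _)); apply: ler_sum => s _; rewrite distrC.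
  apply: (le_trans (mean_sqr S (fun s => `|f (g * s)%g - f g|))); rewrite ler_piMl ?sumr_ge0//.
  by rewrite invf_le1// ler1n.
apply: le_trans H; rewrite ler_piMl ?sqr_ge0//; lra.
Qed.

Lemma energy2_centred f : energy2 (centred f) <= 4 * energy2 f.
Proof.
apply: (le_trans (energy2_sub _ _)).
have := energy2_avg V f; rewrite -coset_mean_avg; lra.
Qed.

End Norms.

Section Scalar.
Notation Ro := (R^o : normedModType R).
Implicit Types (A : {set gT}) (f : gT -> R).

Lemma sum_norm_lazy f : \sum_g `|lazy (f : gT -> Ro) g : R| <= \sum_g `|f g|.
Proof.
apply: (@le_trans _ _ (2^-1 * \sum_g `|f g| + 2^-1 * \sum_g `|avg S (f : gT -> Ro) g : R|)).
  rewrite !mulr_sumr -big_split; apply: ler_sum => g _ /=.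
  rewrite /lazy /GRing.scale /= normrM ger0_norm ?invr_ge0// -mulrDr.
  by rewrite ler_wpM2l ?invr_ge0// ler_normD.
have : \sum_g `|avg S (f : gT -> Ro) g : R| <= \sum_g `|f g|.
  apply: le_trans (avg_sum S (fun g => normr_ge0 (f g))).
  by apply: ler_sum => g _; exact: (@norm_avg R gT Ro).
lra.
Qed.

Lemma sum_norm_walk_op k f : \sum_g `|walk_op k (f : gT -> Ro) g : R| <= \sum_g `|f g|.
Proof.
have walk_le f' : \sum_g `|walk k (f' : gT -> Ro) g : R| <= \sum_g `|f' g|.
  by elim: k => //= k; apply: le_trans; exact: sum_norm_lazy.
have : \sum_g `|centred (f : gT -> Ro) g : R| <= 2 * \sum_g `|f g|.
  have : \sum_g `|avg V (f : gT -> Ro) g : R| <= \sum_g `|f g|.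
    apply: le_trans (avg_sum V (fun g => normr_ge0 (f g))).
    by apply: ler_sum => g _; exact: (@norm_avg R gT Ro).
  move=> H; apply: (@le_trans _ _ (\sum_g (`|f g| + `|avg V (f : gT -> Ro) g : R|))).
    by apply: ler_sum => g _; exact: ler_normB.
  rewrite big_split /=; lra.
have := walk_le (centred (f : gT -> Ro)).
rewrite /walk_op /GRing.scale /=.
under [X in _ -> _ -> X <= _]eq_bigr => g _ do rewrite normrM ger0_norm ?invr_ge0//.
rewrite -mulr_sumr; lra.
Qed.

Lemma sup_avg A f (M : R) : 0 <= M -> (forall g, `|f g| <= M) -> forall g, `|avg A (f : gT -> Ro) g : R| <= M.
Proof.
move=> M0 fM g; apply: (le_trans (@norm_avg R gT Ro A f g)).
apply: (@le_trans _ _ (#|A|%:R^-1 * (#|A|%:R * M))).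
  rewrite ler_wpM2l ?invr_ge0// mulr_natl -sumr_const; apply: ler_sum => a _; exact: fM.
rewrite mulrA ler_piMl//; have [->|n0] := eqVneq (#|A|%:R : R) 0; by rewrite ?mulr0// mulVf.
Qed.

Lemma sup_walk_op k f (M : R) : 0 <= M -> (forall g, `|f g| <= M) ->
  forall g, `|walk_op k (f : gT -> Ro) g : R| <= M.
Proof.
move=> M0 fM.
have c g : `|centred (f : gT -> Ro) g : R| <= 2 * M.
  apply: (le_trans (ler_normB _ _)); have := sup_avg V M0 fM g; have := fM g.
  rewrite /coset_mean /avg; lra.
have w g : `|walk k (centred (f : gT -> Ro)) g : R| <= 2 * M.
  elim: k g => //= k IH g; rewrite /lazy /GRing.scale /= normrM ger0_norm ?invr_ge0//.
  have := @sup_avg S (walk k (centred (f : gT -> Ro))) _ (mulr_ge0 (ler0n _ 2) M0) IH g.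
  have := IH g; have := ler_normD (walk k (centred (f : gT -> Ro)) g : R) (avg S (walk k (centred (f : gT -> Ro))) g).
  lra.
move=> g; rewrite /walk_op /GRing.scale /= normrM ger0_norm ?invr_ge0//.
have := w g; lra.
Qed.

Variable C : R.
Hypothesis C0 : 0 < C.
Hypothesis S0 : (0 < #|S|)%N.
Hypothesis poinc : forall (f : gT -> R) h, h \in V ->
  \sum_g (f (g * h)%g - f g) ^+ 2 <= C * \sum_g \sum_(s in S) (f (g * s)%g - f g) ^+ 2.

(** With a the average of f over S, the gradient term is 2 |S| (|f|^2 - <f, a>),
and |lazy f|^2 = (|f|^2 + 2 <f, a> + |a|^2) / 4 with |a| <= |f|. The relative
inequality bounds |f|^2 by the gradient because f has mean zero on cosets. *)
Lemma spectral_gap f : (forall g, coset_mean V (f : gT -> Ro) g = 0 :> R) ->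
  energy2 (lazy (f : gT -> Ro)) <= (1 - (4 * #|S|%:R * C)^-1) * energy2 (f : gT -> Ro).
Proof.
move=> f0; have S0R : 0 < #|S|%:R :> R by rewrite ltr0n.
set e2 := energy2 (f : gT -> Ro).
pose en := \sum_g \sum_(s in S) (f (g * s)%g - f g) ^+ 2.
have e2_le : e2 <= C * en.
  apply: (@le_trans _ _ (#|V|%:R^-1 * \sum_(h in V) \sum_g (f (g * h)%g - f g) ^+ 2)).
    rewrite exchange_big mulr_sumr; apply: ler_sum => g _ /=.
    apply: le_trans (mean_sqr V (fun h => f (g * h)%g - f g)).
    have -> : #|V|%:R^-1 * \sum_(h in V) (f (g * h)%g - f g) = - f g.
      have := f0 g; rewrite /coset_mean /GRing.scale /= sumrB sumr_const mulrBr => ->.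
      by rewrite -[f g *+ _]mulr_natl mulrA mulVf ?card_group_unit// mul1r sub0r.
    by rewrite sqrrN real_normK ?num_real.
  rewrite ler_pdivrMl ?ltr0n ?cardG_gt0// mulr_natl -sumr_const.
  by apply: ler_sum => h hV; exact: poinc.
have key : energy2 (lazy (f : gT -> Ro)) <= e2 - (4 * #|S|%:R)^-1 * en.
  pose a : gT -> R := avg S (f : gT -> Ro).
  have a2 : \sum_g a g ^+ 2 <= e2.
    apply: le_trans (energy2_avg S (f : gT -> Ro)).
    by apply: ler_sum => g _; rewrite real_normK ?num_real.
  have e2E : e2 = \sum_g f g ^+ 2 by apply: eq_bigr => g _; rewrite real_normK ?num_real.
  have cross : en = 2 * #|S|%:R * (e2 - \sum_g f g * a g).
    rewrite /en.
    transitivity (\sum_g ((\sum_(s in S) f (g * s)%g ^+ 2) - 2 * #|S|%:R * (f g * a g) + #|S|%:R * f g ^+ 2)).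
      apply: eq_bigr => g _.
      have -> : #|S|%:R * f g ^+ 2 = \sum_(s in S) f g ^+ 2 by rewrite sumr_const mulr_natl.
      have -> : 2 * #|S|%:R * (f g * a g) = \sum_(s in S) 2 * f g * f (g * s)%g.
        rewrite -mulr_sumr (_ : \sum_(s in S) f (g * s)%g = #|S|%:R * a g); first by ring.
        by rewrite /a /avg /GRing.scale /= mulVKf ?gt_eqF.
      rewrite -sumrB -big_split; apply: eq_bigr => s _ /=; ring.
    rewrite big_split /= sumrB -!mulr_sumr exchange_big /= -e2E.
    rewrite (eq_bigr (fun=> e2)); last by move=> s _; rewrite e2E; exact: (sum_mulgr (fun g => f g ^+ 2)).
    rewrite sumr_const -[e2 *+ _]mulr_natl; ring.
  have -> : energy2 (lazy (f : gT -> Ro)) = 4^-1 * (e2 + 2 * \sum_g f g * a g + \sum_g a g ^+ 2).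
    rewrite e2E mulr_sumr -!big_split mulr_sumr; apply: eq_bigr => g _ /=.
    rewrite real_normK ?num_real// /lazy /GRing.scale /= -/(a g); by field.
  rewrite cross; move: a2; move: (\sum_g a g ^+ 2) (\sum_g f g * a g) => x y a2.
  rewrite (_ : (4 * #|S|%:R)^-1 * (2 * #|S|%:R * (e2 - y)) = 2^-1 * (e2 - y)); first by lra.
  by field; rewrite gt_eqF.
apply: (le_trans key); rewrite mulrBl mul1r lerD2l lerN2.
rewrite (_ : (4 * #|S|%:R * C)^-1 * e2 = (4 * #|S|%:R)^-1 * (C^-1 * e2)); last by rewrite invfM mulrA.
rewrite ler_wpM2l ?invr_ge0 ?mulr_ge0//.
by rewrite ler_pdivrMl.
Qed.

Lemma walk_decay k f : (forall g, coset_mean V (f : gT -> Ro) g = 0 :> R) ->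
  0 <= 1 - (4 * #|S|%:R * C)^-1 ->
  energy2 (walk k (f : gT -> Ro)) <= (1 - (4 * #|S|%:R * C)^-1) ^+ k * energy2 (f : gT -> Ro).
Proof.
move=> f0 k0; elim: k => [|k IH] /=; first by rewrite expr0 mul1r.
apply: (le_trans (spectral_gap (walk_mean0 k f0))).
by rewrite exprS -[leRHS]mulrA ler_wpM2l.
Qed.

Lemma walk_op_decay k f : 0 <= 1 - (4 * #|S|%:R * C)^-1 ->
  energy2 (walk_op k (f : gT -> Ro)) <= (1 - (4 * #|S|%:R * C)^-1) ^+ k * energy2 (f : gT -> Ro).
Proof.
move=> k0; have -> : energy2 (walk_op k (f : gT -> Ro)) = 4^-1 * energy2 (walk k (centred (f : gT -> Ro))).
  rewrite /energy2 mulr_sumr; apply: eq_bigr => g _; rewrite normrZ exprMn ger0_norm ?invr_ge0//.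
  by congr (_ * _); field.
rewrite ler_pdivrMl// mulrCA (le_trans (walk_decay k (fun g => centred_mean (f : gT -> Ro) g) k0))//.
by rewrite ler_wpM2l ?exprn_ge0// energy2_centred.
Qed.

End Scalar.

End LazyWalk.

(** * Finite groups as discrete measure spaces, and Banach-valued functions *)

(** A copy of gT, to carry the discrete sigma-algebra. *)
Definition points (gT : finGroupType) : Type := gT.
HB.instance Definition _ (gT : finGroupType) := Choice.on (points gT).
HB.instance Definition _ (gT : finGroupType) := isPointed.Build (points gT) 1%g.
HB.instance Definition _ (gT : finGroupType) := @isMeasurable.Build default_measure_display
  (points gT) discrete_measurable discrete_measurable0
  discrete_measurableC discrete_measurableU.

Section CountingMeasure.
Variables (R : realType) (gT : finGroupType).
Notation T := (points gT).

Definition counting_seq (i : nat) : {measure set T -> \bar R} := \d_(nth (1%g : T) (enum gT) i).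
Definition card_measure : {measure set T -> \bar R} := msum counting_seq #|gT|.
Notation cm := card_measure.

Lemma integral_points (f : T -> \bar R) : (forall x, 0 <= f x)%E ->
  (\int[cm]_x f x = \sum_(g : gT) f g)%E.
Proof.
move=> f0; rewrite ge0_integral_measure_sum//.
rewrite -[RHS]big_enum (big_nth 1%g) -cardE big_mkord; apply: eq_bigr => i _.
by rewrite integral_dirac//= diracT mul1e.
Qed.

(** No point is negligible. *)
Lemma ae_points (P : T -> Prop) : (\forall x \ae cm, P x) -> forall x, P x.
Proof.
case=> B [mB B0 PB] x; apply: contrapT => nP.
have Bx : B x by apply: PB.
have xi : (index (x : gT) (enum gT) < #|gT|)%N by rewrite cardE index_mem mem_enum.
have : (1 <= cm B)%E.
  rewrite /card_measure /= /msum (bigD1 (Ordinal xi))//=.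
  rewrite /counting_seq nth_index ?mem_enum// diracE mem_set//.
  by rewrite leeDl// sume_ge0.
by rewrite B0 lee_fin ler10.
Qed.

Lemma Lnorm2_points (F : T -> R) :
  ('N[cm]_2%:E [EFin \o F] = (Num.sqrt (\sum_(g : gT) `|F g| ^+ 2))%:E)%E.
Proof.
rewrite unlock /= integral_points; last by move=> x; rewrite lee_fin powR_ge0.
rewrite (eq_bigr (fun g : gT => (`|F g| ^+ 2)%:E)); last first.
  by move=> g _; rewrite powR_mulrn.
by rewrite sumEFin poweR_EFin powR12_sqrt// sumr_ge0// => g _; exact: sqr_ge0.
Qed.

Lemma Lnorm1_points (F : T -> R) : ('N[cm]_1 [EFin \o F] = (\sum_(g : gT) `|F g|)%:E)%E.
Proof. by rewrite Lnorm1 integral_points// sumEFin. Qed.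

Lemma Lfun_points (F : T -> R) : F \in Lfun cm 2%:E.
Proof.
by rewrite inE; apply/andP; split; rewrite inE//= /finite_norm Lnorm2_points ltry.
Qed.

Definition to_L2 (F : T -> R) : LfunType cm (lee1n 2) := Lfun_Sub (lee1n 2) (Lfun_points F).

End CountingMeasure.

Section TransferToBanach.
Variables (R : realType) (gT : finGroupType) (S : {set gT}) (V : {group gT}).
Variable k : nat.
Notation T := (points gT).
Notation cm := (card_measure R gT).
Notation Ro := (R^o : normedModType R).
Notation L2 := (LfunType cm (lee1n 2)).

Definition walk_L2 (f : L2) : L2 := to_L2 (walk_op S V k (f : gT -> Ro) : T -> R).

Lemma walk_L2_linear : L2_linear walk_L2.
Proof.
move=> a f g; apply/nearW => x _ /=.
exact: (@walk_opP R gT S V Ro k a (f : gT -> Ro) (g : gT -> Ro) x).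
Qed.

Lemma walk_L2_bounded1 : Lq_bounded walk_L2 1%E 1.
Proof.
move=> f; rewrite mul1e !Lnorm1_points lee_fin.
exact: sum_norm_walk_op.
Qed.

Lemma walk_L2_boundedoo : Lq_bounded walk_L2 +oo%E 1.
Proof.
move=> f; rewrite mul1e unlock /=; case: ifPn => // cm0.
have ge := ae_points (ess_sup_ge cm (abse \o (EFin \o f))).
move: ge; set M := ess_sup _ _; case: M => [M| |] ge; last 2 first.
- exact: leey.
- by have := ge (1%g : gT); rewrite leeNy_eq.
have fM (g : gT) : `|f g| <= M by rewrite -lee_fin; exact: ge.
have M0 : 0 <= M by exact: le_trans (fM 1%g).
apply/ess_supP/nearW => x /=; rewrite lee_fin.
exact: (@sup_walk_op R gT S V k (f : gT -> R) M M0 fM x).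
Qed.

Lemma walk_L2_bounded2 (eps : R) : 0 <= eps ->
  (forall f : gT -> R, energy2 (walk_op S V k (f : gT -> Ro)) <= eps ^+ 2 * energy2 (f : gT -> Ro)) ->
  Lq_bounded walk_L2 2%:E eps.
Proof.
move=> e0 H f; rewrite !Lnorm2_points -EFinM lee_fin.
rewrite -[X in X * _](ger0_norm e0) -sqrtr_sqr -sqrtrM ?sqr_ge0//.
by rewrite ler_wsqrtr// H.
Qed.

Variable X : completeNormedModType R.
Implicit Type F : gT -> X.

Lemma bochner_norm2_points F : bochner_norm2 cm (F : T -> X) = (Num.sqrt (energy2 F))%:E.
Proof.
rewrite /bochner_norm2 (Lnorm2_points (fun t : T => `|F t|)).
by congr (Num.sqrt _)%:E; apply: eq_bigr => g _; rewrite normr_id.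
Qed.

Lemma bochner_L2_points F : bochner_L2 cm (F : T -> X).
Proof.
split; last by rewrite bochner_norm2_points ltry.
exists (fun=> F) => [n|t]; last exact: cvg_cst.
split=> //; apply/finite_seqP; exists (map F (enum gT)).
apply/seteqP; split => [_ [g _ <-]|_ /mapP[g _ ->]]; last by exists g.
by apply/mapP; exists g; rewrite ?mem_enum.
Qed.

Lemma avg_scale A (f : gT -> R) (x : X) g :
  avg A (fun t => f t *: x) g = (avg A (f : gT -> Ro) g : R) *: x.
Proof. by rewrite /avg -scaler_suml scalerA. Qed.

Lemma walk_op_scale (f : gT -> R) (x : X) g :
  walk_op S V k (fun t => f t *: x) g = (walk_op S V k (f : gT -> Ro) g : R) *: x.
Proof.
have lazy_scale (f' : gT -> R) g' : lazy S (fun t => f' t *: x) g' = (lazy S (f' : gT -> Ro) g' : R) *: x.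
  by rewrite /lazy avg_scale -scalerDl scalerA.
have walk_scale (f' : gT -> R) g' : walk S k (fun t => f' t *: x) g' = (walk S k (f' : gT -> Ro) g' : R) *: x.
  elim: k g' => //= i IH g'; rewrite -lazy_scale; congr (lazy S _ g').
  exact/funext.
rewrite /walk_op -scalerA -walk_scale; congr (_ *: walk S k _ g).
apply/funext => t; rewrite /centred scalerBl; congr (_ - _).
exact: avg_scale.
Qed.

(** An operator on L^2(X) that extends the scalar one has to be [walk_op], because
both are linear and agree on products of a scalar function and a vector. *)
Lemma walk_op_bochner (c : R) : bochner_bounded X walk_L2 c ->
  forall F, energy2 (walk_op S V k F) <= c ^+ 2 * energy2 F.
Proof.
case=> UX [UXL2 UXlin UXtens UXbnd] F.
have lin (a : R) F1 F2 g : UX (fun t => a *: F1 t + F2 t) g = a *: UX F1 g + UX F2 g.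
  exact: (ae_points (UXlin a F1 F2 (bochner_L2_points _) (bochner_L2_points _)) g I).
have tens (f : T -> R) (x : X) g : UX (fun t => f t *: x) g = walk_op S V k (fun t => f t *: x) g.
  rewrite walk_op_scale; exact: (ae_points (UXtens (to_L2 f) x) g I).
have UXE : UX F = walk_op S V k F.
  (* F is rebuilt from its values by adding one point of the group at a time. *)
  pose part (s : seq gT) (t : gT) : X := \sum_(u <- s) (t == u)%:R *: F u.
  have partE : F = part (enum gT).
    apply/funext => t; rewrite /part big_enum (bigD1 t)//= eqxx scale1r big1 ?addr0//.
    by move=> u /negPf ut; rewrite eq_sym ut scale0r.
  suff H s : UX (part s) =1 walk_op S V k (part s) by rewrite partE; exact/funext.
  elim: s => [|u s IH] g.
    rewrite (_ : part [::] = fun t => (0 : R) *: (0 : X)); first exact: (tens (fun=> 0) 0).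
    by apply/funext => t; rewrite /part big_nil scale0r.
  rewrite (_ : part (u :: s) = fun t => 1 *: ((t == u)%:R *: F u) + part s t).
    by rewrite lin walk_opP IH; congr (_ *: _ + _); exact: (tens (fun t : T => ((t : gT) == u)%:R)).
  by apply/funext => t; rewrite /part big_cons scale1r.
have := UXbnd F (bochner_L2_points F); rewrite UXE !bochner_norm2_points -EFinM lee_fin.
move=> H; have := energy2_ge0 (walk_op S V k F); have := energy2_ge0 F.
move: (energy2 _) (energy2 _) H => a b H a0 b0.
rewrite -[leLHS]sqr_sqrtr// -[X in _ * X]sqr_sqrtr// -exprMn -[leRHS]real_normK ?num_real//.
by rewrite ler_sqr ?nnegrE ?sqrtr_ge0// (le_trans H)// ler_norm.
Qed.

End TransferToBanach.

(** * Fourier analysis on (Z/N)^2 *)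

Section CyclicTrig.
Variables (R : realType) (m : nat).
Notation Z := 'I_m.+1.
Implicit Types x y z : Z.

Definition zangle (k : nat) : R := (pi *+ 2) / m.+1%:R * k%:R.
Definition zcos x : R := cos (zangle x).
Definition zsin x : R := sin (zangle x).

Lemma zangle_modn k : exists l : nat, zangle k = zangle (k %% m.+1) + pi *+ 2 *+ l.
Proof.
exists (k %/ m.+1)%N; rewrite {1}(divn_eq k m.+1) /zangle natrD natrM -mulr_natr.
by field; rewrite nat1r pnatr_eq0.
Qed.

Lemma zcosD x y : zcos (x + y) = zcos x * zcos y - zsin x * zsin y.
Proof.
rewrite -cosD /zcos /zangle -mulrDr -natrD -!/(zangle _).
by have [l ->] := zangle_modn (x + y)%N; rewrite (periodicn (@cosD2pi R)).
Qed.

Lemma zsinD x y : zsin (x + y) = zsin x * zcos y + zcos x * zsin y.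
Proof.
rewrite -sinD /zsin /zangle -mulrDr -natrD -!/(zangle _).
by have [l ->] := zangle_modn (x + y)%N; rewrite (periodicn (@sinD2pi R)).
Qed.

Lemma zcos0 : zcos 0 = 1. Proof. by rewrite /zcos /zangle mulr0 cos0. Qed.
Lemma zsin0 : zsin 0 = 0. Proof. by rewrite /zsin /zangle mulr0 sin0. Qed.
Lemma zcos_sin x : zcos x ^+ 2 + zsin x ^+ 2 = 1.
Proof. exact: cos2Dsin2. Qed.

Lemma zcosN x : zcos (- x) = zcos x.
Proof.
have := zcosD (- x) x; have := zsinD (- x) x; rewrite addNr zcos0 zsin0 => s0 c1.
have := zcos_sin x; set c := zcos x in s0 c1 *; set s := zsin x in s0 c1 *.
move: (zcos (- x)) (zsin (- x)) s0 c1 => C S s0 c1 cs; apply/eqP; rewrite -subr_eq0.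
rewrite (_ : C - c = s * (S * c + C * s) - c * (1 - (C * c - S * s)) -
   C * (c ^+ 2 + s ^+ 2 - 1)); last by ring.
by rewrite -s0 -c1 cs !subrr !mulr0 !subr0.
Qed.
Lemma zsinN x : zsin (- x) = - zsin x.
Proof.
have := zcosD (- x) x; have := zsinD (- x) x; rewrite addNr zcos0 zsin0 => s0 c1.
have := zcos_sin x; rewrite zcosN in s0 c1 *; set c := zcos x in s0 c1 *; set s := zsin x in s0 c1 *.
move: (zsin (- x)) s0 c1 => S s0 c1 cs; apply/eqP; rewrite -subr_eq0 opprK.
rewrite (_ : S + s = c * (S * c + c * s) + s * (1 - (c * c - S * s)) -
   S * (c ^+ 2 + s ^+ 2 - 1)); last by ring.
by rewrite -s0 -c1 cs !subrr !mulr0 !addr0 subr0.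
Qed.

(** This is 1 - 2 sin^2 of half the angle, which lies strictly between 0 and pi. *)
Lemma zcos_lt1 x : x != 0 -> zcos x < 1.
Proof.
move=> x0; have {}x0 : (0 < (x : nat))%N.
  by rewrite lt0n; apply: contraNneq x0 => x0; apply/eqP/val_inj.
rewrite /zcos (_ : zangle x = (pi / m.+1%:R * x%:R) *+ 2).
  rewrite cos_mulr2n cos2sin2 mulr2n.
  have : 0 < sin (pi / m.+1%:R * x%:R) :> R.
    apply: sin_gt0_pi; rewrite !mulr_gt0 ?ltr0n ?invr_gt0 ?pi_gt0//= -mulrA.
    by rewrite gtr_pMr ?pi_gt0// ltr_pdivrMl ?ltr0n// mulr1 ltr_nat.
  move=> /(exprn_gt0 2); move: (sin _ ^+ 2) => s; lra.
by rewrite /zangle !mulr2n; field; rewrite nat1r pnatr_eq0.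
Qed.

End CyclicTrig.

Section Fourier.
Variables (R : realType) (m : nat).
Notation Z := 'I_m.+1.
Notation V := 'cV['I_m.+1]_2.
Implicit Types (chi v w : V).
Notation c_ := (@zcos R m).
Notation s_ := (@zsin R m).

Definition dot chi v : Z := \sum_i v i 0 *+ (chi i 0 : nat).

Lemma dotC chi v : dot chi v = dot v chi.
Proof. by apply: eq_bigr => i _; apply: val_inj; rewrite !Zp_mulrn /= mulnC. Qed.

Lemma dotDr chi v w : dot chi (v + w) = dot chi v + dot chi w.
Proof. by rewrite /dot -big_split; apply: eq_bigr => i _; rewrite mxE mulrnDl. Qed.

Lemma dotDl chi chi' v : dot (chi + chi') v = dot chi v + dot chi' v.
Proof. by rewrite dotC dotDr !(dotC v). Qed.

Lemma dot0l v : dot 0 v = 0.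
Proof. by apply: (addIr (dot 0 v)); rewrite -dotDl !add0r. Qed.
Lemma dot0r v : dot v 0 = 0. Proof. by rewrite dotC dot0l. Qed.

Lemma dotNr chi v : dot chi (- v) = - dot chi v.
Proof. by apply: (addIr (dot chi v)); rewrite -dotDr !addNr dot0r. Qed.

Definition basis_vec (i : 'I_2) : V := \col_j inZp (i == j).

Lemma dot_basis chi i : dot chi (basis_vec i) = chi i 0.
Proof.
rewrite /dot (bigD1 i)//= big1 ?addr0 => [|j ji].
  by rewrite mxE eqxx Zp_mulrn; apply: val_inj; rewrite /= modnMml mul1n modn_small.
by rewrite mxE eq_sym (negPf ji) Zp_mulrn; apply: val_inj; rewrite /= modnMml mul0n mod0n.
Qed.

Lemma basis_sep chi : chi != 0 -> exists i, dot chi (basis_vec i) != 0.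
Proof.
move=> chi0; have [i ci] : exists i, chi i 0 != 0.
  apply/not_existsP => H; move/eqP: chi0; apply; apply/colP => i.
  by rewrite mxE; have /negP/negPn/eqP := H i.
by exists i; rewrite dot_basis.
Qed.

(** A translation on which the character v is nontrivial rotates the vector formed
by the sum of the cosines and the sum of the sines by a nonzero angle. *)
Lemma char_orthogonality v : \sum_chi c_ (dot chi v) = #|{: V}|%:R * (v == 0)%:R.
Proof.
have [->|v0] := eqVneq v 0.
  rewrite mulr1 -sumr_const; apply: eq_bigr => chi _; by rewrite dot0r zcos0.
rewrite mulr0.
have [i vi] := basis_sep v0; set e := basis_vec i in vi.
rewrite dotC in vi.
set A := LHS; pose B := \sum_chi s_ (dot chi v).
set z := dot e v in vi.
have EA : A = A * c_ z - B * s_ z.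
  rewrite {1}/A (reindex_inj (addIr e)) /= /A /B !mulr_suml -sumrB.
  by apply: eq_bigr => chi _; rewrite dotDl zcosD.
have EB : B = B * c_ z + A * s_ z.
  rewrite {1}/B (reindex_inj (addIr e)) /= /A /B !mulr_suml -big_split.
  by apply: eq_bigr => chi _; rewrite dotDl zsinD.
have cs := zcos_sin R z; have c1 := zcos_lt1 R vi.
move: (c_ z) (s_ z) cs c1 EA EB => c s cs c1 EA EB.
have : A * (2 * (1 - c)) = 0.
  have -> : A * (2 * (1 - c)) = (1 - c) * (A - (A * c - B * s)) - s * (B - (B * c + A * s))
      + A * (1 - (c ^+ 2 + s ^+ 2)) by ring.
  by rewrite -EA -EB cs !subrr !mulr0 subrr addr0.
move/eqP; rewrite !mulf_eq0 subr_eq0 pnatr_eq0 orFb => /orP[/eqP//|/eqP c1'].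
by move: c1; rewrite c1' ltxx.
Qed.

Lemma plancherel (phi : V -> R) :
  \sum_chi ((\sum_v c_ (dot chi v) * phi v) ^+ 2 + (\sum_v s_ (dot chi v) * phi v) ^+ 2)
  = #|{: V}|%:R * \sum_v phi v ^+ 2.
Proof.
transitivity (\sum_chi \sum_v \sum_w phi v * phi w * c_ (dot chi (v - w))).
  apply: eq_bigr => chi _; rewrite !expr2 !mulr_suml -big_split; apply: eq_bigr => v _ /=.
  rewrite !mulr_sumr -big_split; apply: eq_bigr => w _ /=.
  rewrite dotDr dotNr zcosD zcosN zsinN; ring.
rewrite exchange_big mulr_sumr; apply: eq_bigr => v _ /=.
rewrite exchange_big (bigD1 v)//= [X in _ + X]big1 ?addr0.
  by rewrite -mulr_sumr char_orthogonality subrr eqxx mulr1 mulrC expr2.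
move=> w wv; rewrite -mulr_sumr char_orthogonality subr_eq0 eq_sym (negPf wv).
by rewrite !mulr0.
Qed.

End Fourier.

Section SpectralMeasure.
Variables (R : realType) (m : nat) (gT : finGroupType).
Notation V := 'cV['I_m.+1]_2.
Variable iota : V -> gT.
Hypothesis iotaD : forall v w, iota (v + w) = (iota v * iota w)%g.
Implicit Types (chi v w : V) (f : gT -> R).

Definition fcos f chi g := \sum_v zcos R (dot chi v) * f (g * iota v)%g.
Definition fsin f chi g := \sum_v zsin R (dot chi v) * f (g * iota v)%g.
(** Up to normalization, the spectral measure of f under right translations by V;
the trigonometric functions stand for the real and imaginary parts of the
Fourier coefficients on each coset. *)
Definition mass f chi := \sum_g (fcos f chi g ^+ 2 + fsin f chi g ^+ 2).
Definition normsq f := #|{: V}|%:R ^+ 2 * \sum_g f g ^+ 2.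

Lemma mass_ge0 f chi : 0 <= mass f chi.
Proof. by apply: sumr_ge0 => g _; rewrite addr_ge0 ?sqr_ge0. Qed.

Lemma sum_mass f : \sum_chi mass f chi = normsq f.
Proof.
rewrite exchange_big /=.
under eq_bigr => g _ do rewrite (plancherel (fun v => f (g * iota v)%g)).
rewrite -mulr_sumr exchange_big /= /normsq expr2 -mulrA; congr (_ * _).
rewrite (eq_bigr (fun=> \sum_g f g ^+ 2)); first by rewrite sumr_const [RHS]mulr_natl.
by move=> v _; exact: (sum_mulgr (fun g => f g ^+ 2)).
Qed.

(** The factor 3 / 2 is less than 2, which is what ping-pong requires. *)
Lemma mass_sub f1 f2 chi : mass f1 chi <= 3 / 2 * mass f2 chi + 3 * mass (fun x => f1 x - f2 x) chi.
Proof.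
rewrite /mass !mulr_sumr -big_split; apply: ler_sum => g _ /=.
have -> : fcos (fun x => f1 x - f2 x) chi g = fcos f1 chi g - fcos f2 chi g.
  by rewrite /fcos -sumrB; apply: eq_bigr => v _; rewrite mulrBr.
have -> : fsin (fun x => f1 x - f2 x) chi g = fsin f1 chi g - fsin f2 chi g.
  by rewrite /fsin -sumrB; apply: eq_bigr => v _; rewrite mulrBr.
move: (fcos f1 _ _) (fcos f2 _ _) (fsin f1 _ _) (fsin f2 _ _) => a b c d.
have key (x y : R) : x ^+ 2 <= 3 / 2 * y ^+ 2 + 3 * (x - y) ^+ 2.
  rewrite -subr_ge0 (_ : _ - _ = 2 * (x - 3 / 2 * y) ^+ 2); last by field.
  by rewrite mulr_ge0 ?sqr_ge0.
have := key a b; have := key c d; lra.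
Qed.

Lemma mass_translate f v chi :
  mass (fun x => f (x * iota v)%g - f x) chi = (2 - 2 * zcos R (dot chi v)) * mass f chi.
Proof.
rewrite /mass mulr_sumr; apply: eq_bigr => g _.
set c := zcos R (dot chi v); set s := zsin R (dot chi v).
have cs : c ^+ 2 + s ^+ 2 = 1 := zcos_sin R _.
have shift (a : V -> R) : \sum_w a w * (f (g * iota w * iota v)%g - f (g * iota w)%g) =
   \sum_w (a (w - v) - a w) * f (g * iota w)%g.
  under eq_bigr => w _ do rewrite mulrBr -mulgA -iotaD.
  rewrite sumrB (reindex_inj (addIr (- v))) /= -sumrB.
  by apply: eq_bigr => w _; rewrite subrK mulrBl.
have -> : fcos (fun x => f (x * iota v)%g - f x) chi g =
    (c - 1) * fcos f chi g + s * fsin f chi g.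
  rewrite /fcos shift !mulr_sumr -big_split; apply: eq_bigr => w _ /=.
  by rewrite dotDr dotNr zcosD zcosN zsinN -/c -/s; ring.
have -> : fsin (fun x => f (x * iota v)%g - f x) chi g =
    (c - 1) * fsin f chi g - s * fcos f chi g.
  rewrite /fsin shift !mulr_sumr -sumrB; apply: eq_bigr => w _ /=.
  by rewrite dotDr dotNr zsinD zcosN zsinN -/c -/s; ring.
move: (fcos f chi g) (fsin f chi g) => x y.
have s2 : s ^+ 2 = 1 - c ^+ 2 by rewrite -cs addrAC subrr add0r.
transitivity (((c - 1) ^+ 2 + s ^+ 2) * (x ^+ 2 + y ^+ 2)); first by ring.
by rewrite s2; ring.
Qed.

(** An element that normalizes V permutes the spectral components. *)
Lemma mass_conj f k (a a' : V -> V) : injective a ->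
  (forall v, iota (a v) = k * iota v * k^-1)%g ->
  (forall chi v, dot chi (a v) = dot (a' chi) v) ->
  forall chi, mass (fun x => f (x * k)%g) chi = mass f (a' chi).
Proof.
move=> inja ka aa' chi.
rewrite /mass -(sum_mulgr (fun g => fcos f (a' chi) g ^+ 2 + fsin f (a' chi) g ^+ 2) k).
apply: eq_bigr => g _; congr (_ ^+ 2 + _ ^+ 2).
- rewrite /fcos (reindex_inj inja); apply: eq_bigr => v _ /=.
  by rewrite aa' ka !mulgA mulgVK.
- rewrite /fsin (reindex_inj inja); apply: eq_bigr => v _ /=.
  by rewrite aa' ka !mulgA mulgVK.
Qed.

End SpectralMeasure.

(** * Ping-pong on the dual of (Z/2^n)^2 *)

Section SignedLift.
Variable m : nat.
Notation Z := 'I_m.+1.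

Definition zred (x : int) : Z := inZp 1 *~ x.
(** The representative of least absolute value. *)
Definition slift (z : Z) : int := if (2 * z <= m.+1)%N then (z : nat)%:Z else (z : nat)%:Z - m.+1%:Z.

Lemma zredD x y : zred (x + y) = zred x + zred y.
Proof. exact: mulrzDr. Qed.

Lemma zredM x a : zred x *~ a = zred (x * a).
Proof. by rewrite /zred mulrzA. Qed.

Lemma zred_nat (k : nat) : zred k%:Z = inZp k.
Proof. by rewrite /zred -pmulrn Zp_mulrn; apply: val_inj; rewrite /= modnMml mul1n. Qed.

Lemma sliftK z : zred (slift z) = z.
Proof.
rewrite /slift; case: ifP => _; first by rewrite zred_nat valZpK.
rewrite zredD zred_nat valZpK [X in _ + X](_ : _ = 0) ?addr0//.
rewrite /zred mulrNz; apply/eqP; rewrite oppr_eq0; apply/eqP.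
by rewrite -/(zred _) zred_nat; apply: val_inj; rewrite /= modnn.
Qed.

Lemma zred_eq0 x : zred x = 0 -> (m.+1 %| `|x|)%N.
Proof.
have H (k : nat) : zred k%:Z = 0 -> (m.+1 %| k)%N.
  by rewrite zred_nat => /(congr1 val) /= /eqP.
case: x => k; first exact: H.
rewrite NegzE /zred mulrNz abszN => /eqP; rewrite oppr_eq0 => /eqP.
exact: H.
Qed.

Lemma slift_zred (x : int) : (2 * `|x| < m.+1)%N -> slift (zred x) = x.
Proof.
move=> xN; set z := zred x.
have /zred_eq0 : zred (slift z - x) = 0.
  by rewrite zredD sliftK /z /zred mulrNz subrr.
have zN : (2 * `|slift z| <= m.+1)%N.
  have := ltn_ord z; rewrite /slift; case: ifP; lia.
case: (posnP `|slift z - x|) => [|d0 /(dvdn_leq d0)]; lia.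
Qed.

End SignedLift.

Lemma sum_two_images (R : realDomainType) (T : finType) (F : T -> R) (P Q : pred T)
    (s s' : T -> T) : (forall x, 0 <= F x) -> injective s -> injective s' ->
  (forall x, P x -> Q (s x) && Q (s' x)) ->
  (forall x y, P x -> P y -> s x <> s' y) ->
  \sum_(x | P x) F (s x) + \sum_(x | P x) F (s' x) <= \sum_(x | Q x) F x.
Proof.
move=> F0 inj inj' PQ ss'.
have img (t : T -> T) : injective t ->
    \sum_(x | P x) F (t x) = \sum_x (x \in [set t x | x in P]%SET)%:R * F x.
  move=> injt; have -> : \sum_(x | P x) F (t x) = \sum_(x in [set t x | x in P]%SET) F x.
    by rewrite big_imset//= => x y _ _; exact: injt.
  by rewrite big_mkcond; apply: eq_bigr => x _; case: ifP; rewrite ?mul1r ?mul0r.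
rewrite !img// -big_split [leRHS]big_mkcond /=; apply: ler_sum => x _.
have [/imsetP[y Py ->]|_] := boolP (x \in [set s x | x in P]%SET).
  have /andP[-> _] := PQ _ Py; rewrite mul1r.
  suff -> : s y \in [set s' x | x in P]%SET = false by rewrite mul0r addr0.
  by apply/imsetP => -[z Pz]; exact: ss'.
rewrite mul0r add0r.
have [/imsetP[y Py ->]|_] := boolP (x \in [set s' x | x in P]%SET).
  by have /andP[_ ->] := PQ _ Py; rewrite mul1r.
by rewrite mul0r; case: ifP.
Qed.

Lemma sum_one_image (R : realDomainType) (T : finType) (F : T -> R) (P Q : pred T)
    (s : T -> T) : (forall x, 0 <= F x) -> injective s ->
  (forall x, P x -> Q (s x)) -> \sum_(x | P x) F (s x) <= \sum_(x | Q x) F x.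
Proof.
move=> F0 inj PQ.
have -> : \sum_(x | P x) F (s x) = \sum_(x in [set s x | x in P]%SET) F x.
  by rewrite big_imset//= => x y _ _; exact: inj.
rewrite big_mkcond [leRHS]big_mkcond; apply: ler_sum => x _.
case: ifP => [/imsetP[y Py ->]|_]; first by rewrite PQ.
by case: ifP.
Qed.

Section Sectors.
Variable n : nat.
Notation V := (Vn n).
Notation m := (2 ^ n).-1.
Implicit Type chi : V.

Definition shear_up (e : int) : 'M[int]_2 :=
  \matrix_(i, j) (if (i == 0) && (j == 1) then e else (i == j)%:R).
Definition shear_lo (e : int) : 'M[int]_2 := (shear_up e)^T.

Lemma shear_upD e e' : shear_up e *m shear_up e' = shear_up (e + e').
Proof.
apply/matrixP => i j; rewrite !mxE !big_ord_recl big_ord0 !mxE.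
by case: i => -[|[|//]] /= ?; case: j => -[|[|//]] /= ?; rewrite ?mxE /=; ring.
Qed.
Lemma shear_up0 : shear_up 0 = 1%:M.
Proof.
by apply/matrixP => i j; rewrite !mxE; case: i => -[|[|//]] /= ?; case: j => -[|[|//]] /= ?.
Qed.

Definition cx chi := slift (chi 0 0).
Definition cy chi := slift (chi 1 0).
(** On this box the shears by 2 and -2 do not wrap around modulo 2^n. *)
Definition in_box chi := (8 * `|cx chi| < m.+1)%N && (8 * `|cy chi| < m.+1)%N.
Definition steep chi := (`|cx chi| < `|cy chi|)%N.
Definition flat chi := (`|cy chi| < `|cx chi|)%N.
Definition diag chi := (cx chi == cy chi) && (cx chi != 0).
Definition antidiag chi := (cx chi == - cy chi) && (cx chi != 0).

Lemma sectorP chi : chi != 0 -> [|| ~~ in_box chi, in_box chi && steep chi, in_box chi && flat chi,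
  in_box chi && diag chi | in_box chi && antidiag chi].
Proof.
move=> chi0; case: (in_box chi) => //=.
have nz : (cx chi != 0) || (cy chi != 0).
  apply: contraNT chi0; rewrite negb_or !negbK => /andP[/eqP x0 /eqP y0].
  apply/eqP/colP => i; rewrite mxE.
  case: i => -[|[|//]] /= i2.
    by rewrite (_ : Ordinal i2 = 0); [rewrite -(sliftK (chi 0 0)) -/(cx chi) x0|exact/val_inj].
  by rewrite (_ : Ordinal i2 = 1); [rewrite -(sliftK (chi 1 0)) -/(cy chi) y0|exact/val_inj].
rewrite /steep /flat /diag /antidiag; lia.
Qed.

Lemma mxact_slift (A : 'M[int]_2) chi i :
  mxact A chi i 0 = zred m (A i 0 * cx chi + A i 1 * cy chi).
Proof.
rewrite mxE !big_ord_recl big_ord0 addr0 zredD.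
rewrite (_ : fintype.lift ord0 ord0 = 1 :> 'I_2); last exact: val_inj.
by rewrite -{1}(sliftK (chi 0 0)) -{1}(sliftK (chi 1 0)) !zredM !(mulrC (A _ _)).
Qed.

Lemma shear_up_x e chi : in_box chi -> (`|e| <= 2)%N ->
  cx (mxact (shear_up e) chi) = cx chi + e * cy chi.
Proof.
rewrite /in_box => /andP[xb yb] e2; rewrite {1}/cx mxact_slift !mxE /= mul1r slift_zred//.
nia.
Qed.
Lemma shear_up_y e chi : in_box chi -> cy (mxact (shear_up e) chi) = cy chi.
Proof.
rewrite /in_box => /andP[xb yb]; rewrite {1}/cy mxact_slift !mxE /= mul0r add0r mul1r slift_zred//.
lia.
Qed.
Lemma shear_lo_y e chi : in_box chi -> (`|e| <= 2)%N ->
  cy (mxact (shear_lo e) chi) = cy chi + e * cx chi.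
Proof.
rewrite /in_box => /andP[xb yb] e2; rewrite {1}/cy mxact_slift !mxE /= mul1r addrC slift_zred//.
nia.
Qed.
Lemma shear_lo_x e chi : in_box chi -> cx (mxact (shear_lo e) chi) = cx chi.
Proof.
rewrite /in_box => /andP[xb yb]; rewrite {1}/cx mxact_slift !mxE /= mul0r addr0 mul1r slift_zred//.
lia.
Qed.

Lemma shear_up_inj e : injective (@mxact n (shear_up e)).
Proof.
apply: (can_inj (g := @mxact n (shear_up (- e)))) => v.
by rewrite -mxactM shear_upD addNr shear_up0 mxact1.
Qed.
Lemma shear_lo_inj e : injective (@mxact n (shear_lo e)).
Proof.
apply: (can_inj (g := @mxact n (shear_lo (- e)))) => v.
by rewrite -mxactM /shear_lo -trmx_mul shear_upD subrr shear_up0 trmx1 mxact1.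
Qed.

(** The shears (x, y) -> (x + 2 y, y) and (x - 2 y, y) send the steep sector into
the flat one, injectively and with disjoint images, and the transposed shears do
the converse. If the measure F is almost invariant under them, then twice the
mass of each sector is almost at most the mass of the other one, so both are
almost null. The two diagonals are sent into the flat sector. The mass outside
the box is unknown to this argument, and becomes part of the error. *)
Lemma ping_pong (R : realType) (F : V -> R) (err : R) : (forall chi, 0 <= F chi) ->
  (forall A, A \in [:: shear_up 2; shear_up (- 2); shear_lo 2; shear_lo (- 2)] ->
     forall P : pred V, \sum_(chi | P chi) F chi <=
        3 / 2 * \sum_(chi | P chi) F (mxact A chi) + err) ->
  \sum_(chi | chi != 0) F chi <= 28 * \sum_(chi | ~~ in_box chi) F chi + 34 * err.
Proof.
move=> F0 inv.
pose M P := \sum_(chi | P chi) F chi.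
pose o := M (fun chi => ~~ in_box chi).
pose a := M (fun chi => in_box chi && steep chi).
pose b := M (fun chi => in_box chi && flat chi).
pose d := M (fun chi => in_box chi && diag chi).
pose d' := M (fun chi => in_box chi && antidiag chi).
have ME P : M P = \sum_chi (if P chi then F chi else 0) by exact: big_mkcond.
have box_le (Q : pred V) : M Q <= M (fun chi => in_box chi && Q chi) + o.
  rewrite /o !ME -big_split; apply: ler_sum => chi _ /=.
  by case: (in_box chi) => /=; case: (Q chi); rewrite ?addr0 ?add0r.
have cover : M (fun chi => chi != 0) <= o + a + b + d + d'.
  rewrite /o /a /b /d /d' !ME -!big_split; apply: ler_sum => chi _ /=.
  case: ifP => [/sectorP|_]; last by rewrite !addr_ge0//; case: ifP.
  have /= := F0 chi; set x := F chi => x0.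
  by move: (~~ in_box chi) (_ && steep _) (_ && flat _) (_ && diag _) (_ && antidiag _)
     => [] [] [] [] [] //= _; lra.
have inU e : (e == 2) || (e == - 2) -> shear_up e \in [:: shear_up 2; shear_up (- 2); shear_lo 2; shear_lo (- 2)].
  by case/orP => /eqP->; rewrite !inE eqxx ?orbT.
have inL e : (e == 2) || (e == - 2) -> shear_lo e \in [:: shear_up 2; shear_up (- 2); shear_lo 2; shear_lo (- 2)].
  by case/orP => /eqP->; rewrite !inE eqxx ?orbT.
have a_le : 2 * a <= 3 / 2 * (b + o) + 2 * err.
  have h1 chi : in_box chi && steep chi ->
      flat (mxact (shear_up 2) chi) && flat (mxact (shear_up (- 2)) chi).
    by case/andP => cb; rewrite /flat !shear_up_x// !shear_up_y// /steep; lia.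
  have h2 chi chi' : in_box chi && steep chi -> in_box chi' && steep chi' ->
      mxact (shear_up 2) chi <> mxact (shear_up (- 2)) chi'.
    case/andP => cb st /andP[cb' st'] E; have := congr1 cx E; have := congr1 cy E.
    by rewrite !shear_up_x// !shear_up_y//; move: st st'; rewrite /steep; lia.
  have := sum_two_images F0 (@shear_up_inj _) (@shear_up_inj _) h1 h2.
  have := inv _ (inU 2 isT) (fun chi => in_box chi && steep chi).
  have := inv _ (inU (- 2) isT) (fun chi => in_box chi && steep chi).
  have := box_le flat; rewrite -!/(M _) -/a -/b.
  by move: (\sum_(_ | _) _) (\sum_(_ | _) _) => u v; lra.
have b_le : 2 * b <= 3 / 2 * (a + o) + 2 * err.
  have h1 chi : in_box chi && flat chi ->
      steep (mxact (shear_lo 2) chi) && steep (mxact (shear_lo (- 2)) chi).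
    by case/andP => cb; rewrite /steep !shear_lo_y// !shear_lo_x// /flat; lia.
  have h2 chi chi' : in_box chi && flat chi -> in_box chi' && flat chi' ->
      mxact (shear_lo 2) chi <> mxact (shear_lo (- 2)) chi'.
    case/andP => cb st /andP[cb' st'] E; have := congr1 cx E; have := congr1 cy E.
    by rewrite !shear_lo_y// !shear_lo_x//; move: st st'; rewrite /flat; lia.
  have := sum_two_images F0 (@shear_lo_inj _) (@shear_lo_inj _) h1 h2.
  have := inv _ (inL 2 isT) (fun chi => in_box chi && flat chi).
  have := inv _ (inL (- 2) isT) (fun chi => in_box chi && flat chi).
  have := box_le steep; rewrite -!/(M _) -/b -/a.
  by move: (\sum_(_ | _) _) (\sum_(_ | _) _) => u v; lra.
have d_le : d <= 3 / 2 * (b + o) + err.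
  have h1 chi : in_box chi && diag chi -> flat (mxact (shear_up 2) chi).
    by case/andP => cb; rewrite /flat !shear_up_x// !shear_up_y// /diag; lia.
  have := sum_one_image F0 (@shear_up_inj _) h1.
  have := inv _ (inU 2 isT) (fun chi => in_box chi && diag chi).
  have := box_le flat; rewrite -!/(M _) -/d -/b.
  by move: (\sum_(_ | _) _) => u; lra.
have d'_le : d' <= 3 / 2 * (b + o) + err.
  have h1 chi : in_box chi && antidiag chi -> flat (mxact (shear_up (- 2)) chi).
    by case/andP => cb; rewrite /flat !shear_up_x// !shear_up_y// /antidiag; lia.
  have := sum_one_image F0 (@shear_up_inj _) h1.
  have := inv _ (inU (- 2) isT) (fun chi => in_box chi && antidiag chi).
  have := box_le flat; rewrite -!/(M _) -/d' -/b.
  by move: (\sum_(_ | _) _) => u; lra.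
have a0 : 0 <= a by exact: sumr_ge0.
have b0 : 0 <= b by exact: sumr_ge0.
have o0 : 0 <= o by exact: sumr_ge0.
rewrite -/(M _) -/(M _) -/o; lra.
Qed.

End Sectors.

(** * The uniform spectral gap of G_n relative to (Z/2^n)^2 *)

(** Translation by a basis vector multiplies the spectral component of a character
outside the box by a complex number that stays away from 1. *)
Lemma zcos_far (R : realType) : exists2 c0 : R, 0 < c0 &
  forall m (z : 'I_m.+1), (m.+1 <= 8 * `|slift z|)%N -> c0 <= 2 - 2 * zcos R z.
Proof.
have pi0 : 0 < pi :> R := pi_gt0 R.
exists (2 - 2 * cos (pi / 4)).
  have : cos (pi / 4) < cos 0 :> R.
    by rewrite ltr_cos ?in_itv /= ?lexx ?(ltW pi0)//; lra.
  rewrite cos0; lra.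
move=> m z far; set k := `|slift z|%N in far.
have k2 : (2 * k <= m.+1)%N by have := ltn_ord z; rewrite /k /slift; case: ifP; lia.
have N0 : 0 < m.+1%:R :> R by rewrite ltr0n.
have -> : zcos R z = cos (zangle R m k).
  rewrite /k /slift /zcos; case: ifP => // _.
  have zk : (z + `|(z : nat)%:Z - m.+1%:Z|)%N = m.+1 by have := ltn_ord z; lia.
  move: (`|_|%N) zk => d zk.
  have dR : d%:R = m.+1%:R - z%:R :> R by rewrite -[X in X%:R - _]zk natrD addrAC subrr add0r.
  rewrite [RHS](_ : _ = cos (- zangle R m z + pi *+ 2)).
    by rewrite cosD2pi cosN.
  by congr cos; rewrite /zangle dR mulrBr divfK ?gt_eqF// addrC.
suff : cos (zangle R m k) <= cos (pi / 4) by lra.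
have kR : m.+1%:R <= 8 * k%:R :> R by rewrite -natrM ler_nat.
have k2R : 2 * k%:R <= m.+1%:R :> R by rewrite -natrM ler_nat.
have zE : zangle R m k = pi * (2 * k%:R / m.+1%:R).
  by rewrite /zangle mulr2n; field; rewrite nat1r pnatr_eq0.
have ge4 : pi / 4 <= zangle R m k.
  rewrite zE ler_wpM2l ?(ltW pi0)// ler_pdivlMr//; lra.
have le1 : zangle R m k <= pi.
  by rewrite zE ler_piMr ?(ltW pi0)// ler_pdivrMr// mul1r.
move: ge4; rewrite le_eqVlt => /predU1P[->//|lt4].
by apply: ltW; rewrite ltr_cos ?in_itv //=; apply/andP; split; lra.
Qed.

Lemma shear_up_Q (e : int) : (2 %| e)%Z -> exists q : Q, mxSL (SL_of_Q q) = shear_up e.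
Proof.
move=> e2.
have d1 : \det (shear_up e) == 1.
  by rewrite (expand_det_row _ ord0) !big_ord_recl big_ord0 /cofactor !det_mx11 !mxE /= expr0; apply/eqP; ring.
have k : MkSL2 d1 \in in_ker_red2.
  rewrite inE; apply/eqP/val_inj/matrixP => i j; rewrite !mxE /=.
  case: ifP => [/andP[/eqP-> /eqP->]|_]; last by case: (i == j).
  by have := dvdz_pcharf (@pchar_Fp 2 isT : 2%N \in [pchar 'Z_2]) e; rewrite e2 => /esym/eqP.
by exists (MkQ k).
Qed.

Lemma shear_lo_Q (e : int) : (2 %| e)%Z -> exists q : Q, mxSL (SL_of_Q q) = shear_lo e.
Proof.
move=> e2.
have d1 : \det (shear_lo e) == 1.
  rewrite det_tr.
  by rewrite (expand_det_row _ ord0) !big_ord_recl big_ord0 /cofactor !det_mx11 !mxE /= expr0; apply/eqP; ring.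
have k : MkSL2 d1 \in in_ker_red2.
  rewrite inE; apply/eqP/val_inj/matrixP => i j; rewrite !mxE /=.
  case: ifP => [/andP[/eqP-> /eqP->]|_]; last by rewrite eq_sym; case: (i == j).
  by have := dvdz_pcharf (@pchar_Fp 2 isT : 2%N \in [pchar 'Z_2]) e; rewrite e2 => /esym/eqP.
by exists (MkQ k).
Qed.

Section RelativeT.
Variables (R : realType) (pi : {multiplicative F3 -> Q}).
Hypothesis pi_gen : gen_subgroup [set pi (fgen i) | i in [set: 'I_3]] = [set: Q].

Lemma pi_surj (q : Q) : exists w, pi w = q.
Proof.
have pi1 : pi 1%g = 1%g by apply: (@mulgI _ (pi 1%g)); rewrite -gmulfM !mulg1.
pose X := [set q : Q | exists w, pi w = q].
have : [set: Q] `<=` X; last by apply.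
rewrite -pi_gen; apply: smallest_sub => [|_ [i _ <-]]; last by exists (fgen i).
split=> [|_ _ [v <-] [w <-]|_ [w <-]]; first by exists 1%g.
- by exists (v * w)%g; rewrite gmulfM.
- by exists w^-1%g; apply: (@mulgI _ (pi w)); rewrite -gmulfM !mulgV.
Qed.

Definition Gn_word n (w : F3) : Gn pi n := inH pi (proj_sq _ w).

Lemma inHM n k l : inH pi (n := n) (k * l)%g = (inH pi k * inH pi l)%g.
Proof. by rewrite /inH (morphM (sdpair2_morphism (Haction pi n))) ?finset.in_setT. Qed.
Lemma inVD n v w : inV pi (n := n) (v + w) = (inV pi v * inV pi w)%g.
Proof. by rewrite /inV -(morphM (sdpair1_morphism (Haction pi n))) ?finset.in_setT. Qed.

Lemma Gn_wordM n v w : Gn_word n (v * w)%g = (Gn_word n v * Gn_word n w)%g.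
Proof. by rewrite /Gn_word gmulfM inHM. Qed.
Lemma Gn_word1 n : Gn_word n 1%g = 1%g.
Proof. by apply: (mulgI (Gn_word n 1%g)); rewrite -Gn_wordM !mulg1. Qed.
Lemma Gn_wordV n w : Gn_word n w^-1%g = (Gn_word n w)^-1%g.
Proof. by apply: (mulgI (Gn_word n w)); rewrite -Gn_wordM !mulgV Gn_word1. Qed.

Lemma inV_mxact n w v : inV pi (mxact (pimx pi w) v) =
  (Gn_word n w * inV pi v * (Gn_word n w)^-1)%g.
Proof. by rewrite /Gn_word inVJ HactE. Qed.

Definition energy n (f : Gn pi n -> R) := \sum_g \sum_(s in Sn pi n) (f (g * s)%g - f g) ^+ 2.

Lemma energy_ge0 n f : 0 <= @energy n f.
Proof. by apply: sumr_ge0 => g _; apply: sumr_ge0 => s _; rewrite sqr_ge0. Qed.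

Lemma energy_gen n f s : s \in Sn pi n -> \sum_g (f (g * s)%g - f g) ^+ 2 <= energy f.
Proof.
move=> sS; apply: ler_sum => g _; rewrite (bigD1 s)//= lerDl.
by apply: sumr_ge0 => t _; rewrite sqr_ge0.
Qed.

(** Telescoping along a word; K is independent of n. *)
Lemma energy_word w : exists2 K : R, 0 <= K &
  forall n (f : Gn pi n -> R), \sum_g (f (g * Gn_word n w)%g - f g) ^+ 2 <= K * energy f.
Proof.
have step w1 w2 : (exists2 K : R, 0 <= K &
    forall n (f : Gn pi n -> R), \sum_g (f (g * Gn_word n w1)%g - f g) ^+ 2 <= K * energy f) ->
  (exists2 K : R, 0 <= K &
    forall n (f : Gn pi n -> R), \sum_g (f (g * Gn_word n w2)%g - f g) ^+ 2 <= K * energy f) ->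
  exists2 K : R, 0 <= K &
    forall n (f : Gn pi n -> R), \sum_g (f (g * Gn_word n (w1 * w2))%g - f g) ^+ 2 <= K * energy f.
  move=> [K1 K10 H1] [K2 K20 H2]; exists (2 * K1 + 2 * K2); first by rewrite addr_ge0 ?mulr_ge0.
  move=> n f; apply: (@le_trans _ _ (\sum_g (2 * (f (g * Gn_word n w1)%g - f g) ^+ 2 +
     2 * (f (g * Gn_word n w1 * Gn_word n w2)%g - f (g * Gn_word n w1)%g) ^+ 2))).
    apply: ler_sum => g _; rewrite Gn_wordM mulgA.
    move: (f _) (f g) (f (g * _)%g) => a b c.
    rewrite -subr_ge0 (_ : _ - _ = (a - 2 * c + b) ^+ 2) ?sqr_ge0//; ring.
  rewrite big_split /= -!mulr_sumr (sum_mulgr (fun g => (f (g * Gn_word n w2)%g - f g) ^+ 2)).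
  have -> : (2 * K1 + 2 * K2) * energy f = 2 * (K1 * energy f) + 2 * (K2 * energy f) by ring.
  by apply: lerD; rewrite ler_wpM2l//; [exact: H1|exact: H2].
have gen i : exists2 K : R, 0 <= K &
    forall n (f : Gn pi n -> R), \sum_g (f (g * Gn_word n (fgen i))%g - f g) ^+ 2 <= K * energy f.
  exists 1 => // n f; rewrite mul1r energy_gen// inE; apply/orP; left.
  exact: imset_f.
elim/free_group_ind: w => [|i w|i w].
- exists 0 => // n f; rewrite mul0r big1// => g _.
  by rewrite Gn_word1 mulg1 subrr expr0n.
- exact: step.
- apply: step; have [K K0 H] := gen i; exists K => // n f.
  rewrite -(sum_mulgr _ (Gn_word n (fgen i))); apply: le_trans (H n f).
  by rewrite le_eqVlt; apply/orP; left; apply/eqP; apply: eq_bigr => g _; rewrite Gn_wordV mulgK -sqrrN opprB.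
Qed.

Lemma dot_mxact n (B : 'M[int]_2) (chi v : Vn n) : dot chi (mxact B v) = dot (mxact B^T chi) v.
Proof.
have dC (x y : 'I_(2 ^ n).-1.+1) : x *+ (y : nat) = y *+ (x : nat).
  by apply: val_inj; rewrite !Zp_mulrn /= mulnC.
have dz (x : 'I_(2 ^ n).-1.+1) (k : nat) a : (x *~ a) *+ k = (x *+ k) *~ a.
  by rewrite !pmulrn mulrzAC.
rewrite /dot.
under eq_bigr => i _ do rewrite mxE -sumrMnl.
rewrite exchange_big; apply: eq_bigr => j _ /=.
rewrite dC mxE -sumrMnl; apply: eq_bigr => i _.
by rewrite mxE !dz dC.
Qed.

(** The spectral measure of f is almost invariant under the four shears, because
some words map to them, and has little mass outside the box, because the basis
of V belongs to S_n; both errors are bounded by the energy of f. By [ping_pong]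
the energy bounds the mass off the trivial character, which is the part that
f (g h) - f g sees. *)
Lemma relative_T : exists2 C : R, 0 <= C & forall n (f : Gn pi n -> R) (h : Vn n),
  \sum_g (f (g * inV pi h)%g - f g) ^+ 2 <= C * energy f.
Proof.
have [c0 c00 far] := zcos_far R.
have word A : (exists q : Q, mxSL (SL_of_Q q) = A^T) -> exists2 K : R, 0 <= K &
  exists2 w, (pimx pi w)^T = A & forall n (f : Gn pi n -> R),
    \sum_g (f (g * Gn_word n w)%g - f g) ^+ 2 <= K * energy f.
  case=> q qA; have [w wq] := pi_surj q; have [K K0 H] := energy_word w.
  by exists K => //; exists w => //; rewrite /pimx wq qA trmxK.
have even2 : (2 %| 2)%Z by [].
have even2' : (2 %| - 2)%Z by [].
have [K1 K10 [w1 W1 H1]] := word (shear_up 2) (shear_lo_Q even2).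
have [K2 K20 [w2 W2 H2]] := word (shear_up (- 2)) (shear_lo_Q even2').
have [K3 K30 [w3 W3 H3]] : exists2 K : R, 0 <= K &
  exists2 w, (pimx pi w)^T = shear_lo 2 & forall n (f : Gn pi n -> R),
    \sum_g (f (g * Gn_word n w)%g - f g) ^+ 2 <= K * energy f.
  by apply: word; rewrite trmxK; exact: shear_up_Q.
have [K4 K40 [w4 W4 H4]] : exists2 K : R, 0 <= K &
  exists2 w, (pimx pi w)^T = shear_lo (- 2) & forall n (f : Gn pi n -> R),
    \sum_g (f (g * Gn_word n w)%g - f g) ^+ 2 <= K * energy f.
  by apply: word; rewrite trmxK; exact: shear_up_Q.
pose K := K1 + K2 + K3 + K4.
have words A : A \in [:: shear_up 2; shear_up (- 2); shear_lo 2; shear_lo (- 2)] ->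
    exists2 w, (pimx pi w)^T = A & forall n (f : Gn pi n -> R),
      \sum_g (f (g * Gn_word n w)%g - f g) ^+ 2 <= K * energy f.
  have weak w K' : K' <= K -> (forall n (f : Gn pi n -> R),
      \sum_g (f (g * Gn_word n w)%g - f g) ^+ 2 <= K' * energy f) ->
    forall n (f : Gn pi n -> R), \sum_g (f (g * Gn_word n w)%g - f g) ^+ 2 <= K * energy f.
    by move=> KK H n f; apply: (le_trans (H n f)); rewrite ler_wpM2r// energy_ge0.
  rewrite !inE /K => /or4P[] /eqP->; [exists w1 => // | exists w2 => //|exists w3 => //|exists w4 => //].
  - by apply: weak H1; rewrite /K; lra.
  - by apply: weak H2; rewrite /K; lra.
  - by apply: weak H3; rewrite /K; lra.
  - by apply: weak H4; rewrite /K; lra.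
have K0 : 0 <= K by rewrite !addr_ge0.
exists (4 * (28 * (2 / c0) + 34 * (3 * K))).
  by rewrite mulr_ge0// addr_ge0// mulr_ge0// ?divr_ge0 ?mulr_ge0// ltW.
move=> n f h.
pose F := mass (inV pi (n := n)) f.
have D := @inVD n.
have F0 chi : 0 <= F chi by exact: mass_ge0.
have nV0 : 0 < #|{: Vn n}|%:R ^+ 2 :> R by rewrite exprn_gt0// ltr0n; apply/card_gt0P; exists 0.
set N2 := #|{: Vn n}|%:R ^+ 2 in nV0.
have main := @ping_pong n R F (3 * (N2 * (K * energy f))) F0.
have {}main : \sum_(chi | chi != 0) F chi <=
    28 * \sum_(chi | ~~ in_box chi) F chi + 34 * (3 * (N2 * (K * energy f))).
  apply: main => A /words[w <- Hw] P.
  apply: (@le_trans _ _ (\sum_(chi | P chi) (3 / 2 * F (mxact (pimx pi w)^T chi) +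
      3 * mass (inV pi (n := n)) (fun x => f x - f (x * Gn_word n w)%g) chi))).
    apply: ler_sum => chi _.
    rewrite /F -(@mass_conj _ _ _ (inV pi (n := n)) f (Gn_word n w) (mxact (pimx pi w))).
    - exact: mass_sub.
    - apply: (can_inj (g := mxact (pimx pi w^-1%g))) => v.
      by rewrite -mxactM -pimxM mulVg pimx1 mxact1.
    - exact: inV_mxact.
    - exact: dot_mxact.
  rewrite big_split /= -!mulr_sumr lerD2l ler_wpM2l//.
  apply: (@le_trans _ _ (normsq (2 ^ n).-1 (fun x => f x - f (x * Gn_word n w)%g))).
    rewrite -(sum_mass (inV pi (n := n))) big_mkcond; apply: ler_sum => chi _.
    by case: ifP => // _; exact: mass_ge0.
  rewrite /normsq -/N2  ler_wpM2l ?(ltW nV0)//; apply: le_trans (Hw n f).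
  by rewrite le_eqVlt; apply/orP; left; apply/eqP; apply: eq_bigr => g _; rewrite -sqrrN opprB.
have out : \sum_(chi | ~~ in_box chi) F chi <= 2 / c0 * (N2 * energy f).
  rewrite -mulrA mulrCA ler_pdivlMl// mulr_sumr.
  have eS i : \sum_chi (2 - 2 * zcos R (dot chi (basis_vec _ i))) * F chi <= N2 * energy f.
    under eq_bigr => chi _ do rewrite -(mass_translate D).
    rewrite sum_mass /normsq -/N2 ler_wpM2l ?(ltW nV0)//; apply: energy_gen.
    by rewrite inE; apply/orP; right; exact: imset_f.
  rewrite mulr_natl mulr2n; apply: le_trans (lerD (eS 0) (eS 1)).
  rewrite -big_split big_mkcond; apply: ler_sum => chi _ /=.
  have p2 (z : 'I_(2 ^ n).-1.+1) : 0 <= 2 - 2 * zcos R z :> R.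
    have : zcos R z <= 1 by exact: cos_le1.
    by lra.
  rewrite !dot_basis -mulrDl; case: ifP => [|_]; last by apply: mulr_ge0 => //; exact: addr_ge0 (p2 _) (p2 _).
  rewrite /in_box negb_and -!leqNgt => xy; apply: ler_wpM2r => //.
  case/orP: xy => /far H; first by rewrite (le_trans H)// lerDl.
  by rewrite (le_trans H)// lerDr.
rewrite -(ler_pM2l nV0) -/(normsq (2 ^ n).-1 (fun g => f (g * inV pi h)%g - f g)).
rewrite -(sum_mass (inV pi (n := n))).
apply: (@le_trans _ _ (4 * \sum_(chi | chi != 0) F chi)).
  rewrite (bigD1 0)//= mass_translate// dot0l zcos0 mulr1 subrr mul0r add0r mulr_sumr.
  apply: ler_sum => chi _; rewrite mass_translate// ler_wpM2r//.
  have : -1 <= zcos R (dot chi h) by exact: cos_geN1.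
  by lra.
move: out main; set o := \sum_(_ | ~~ _) _; set t := \sum_(_ | _) _ => out main.
rewrite (_ : N2 * _ = 4 * (28 * (2 / c0 * (N2 * energy f)) + 34 * (3 * (N2 * (K * energy f))))); last by ring.
rewrite ler_wpM2l//; apply: (le_trans main).
by rewrite lerD2r ler_wpM2l.
Qed.

End RelativeT.

(** * Walls on the quotients of a free group by iterated squares *)

Section Projections.
Variables (G : groupType) (j : nat).
Local Open Scope group_scope.
Notation pr := (@proj_sq G j).

Lemma proj_sq1 : pr 1 = 1.
Proof. by apply: (mulgI (pr 1)); rewrite -proj_sqM !mulg1. Qed.

Lemma proj_sqV g : pr g^-1 = (pr g)^-1.
Proof. by apply: (mulgI (pr g)); rewrite -proj_sqM !mulgV proj_sq1. Qed.

Lemma proj_sq_eq1 g : pr g = 1 <-> squares_series j g.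
Proof.
rewrite -proj_sq1; split=> [/esym/proj_sqP|jg]; first by rewrite invg1 mul1g.
by apply/esym/proj_sqP; rewrite invg1 mul1g.
Qed.

End Projections.

Section Walls.
Variables (k j : nat).
Notation F := (free_group 'I_k).
Notation letter := ('I_k * bool)%type.
Notation H := (squares_quotient F j).
Notation pr := (@proj_sq F j).
Local Open Scope group_scope.
Implicit Types (x y : letter) (u v w g : F) (h : H) (e : H * 'I_k).

Definition letter_elt x : F := if x.2 then fgen x.1 else (fgen x.1)^-1.

Lemma letter_eltV x : letter_elt (letter_inv x) = (letter_elt x)^-1.
Proof. by case: x => a []; rewrite /letter_elt /= ?invgK. Qed.

Lemma fword_letterM x g : fword (letter_elt x * g) = cons_reduce x (fword g).
Proof. by case: x => a []. Qed.

Lemma letter_elt_ind (P : F -> Prop) : P 1 -> (forall x g, P g -> P (letter_elt x * g)) -> forall g, P g.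
Proof.
move=> P1 PM; apply: free_group_ind => // a g Pg; first exact: (PM (a, true)).
exact: (PM (a, false)).
Qed.

Lemma reduced_word_ind (P : F -> Prop) : P 1 ->
  (forall x g, P g -> fword (letter_elt x * g) = x :: fword g -> P (letter_elt x * g)) -> forall g, P g.
Proof.
move=> P1 PM [u ru]; elim: u ru => [|x u IH] ru.
  by rewrite (_ : FreeGroup ru = 1) //; exact: val_inj.
pose g := FreeGroup (reduced_behead ru).
have E : cons_reduce x u = x :: u.
  by case: u ru {IH g} => //= y u /andP[/negPf->].
rewrite (_ : FreeGroup ru = letter_elt x * g).
  by apply: PM; [exact: IH|rewrite fword_letterM].
by apply: val_inj; rewrite [RHS](fword_letterM x g) /= E.
Qed.

(** The pair (h, i) stands for the edge from h to h t_i. An inverse letter crosses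
its edge backwards, so this edge starts at the endpoint of the step. *)
Definition edge x e : bool := e == (if x.2 then 1 else pr (letter_elt x), x.1).
Definition cshift h (c : H * 'I_k -> bool) e := c (h^-1 * e.1, e.2).

Fixpoint chainw (s : seq letter) : H * 'I_k -> bool :=
  if s is x :: s' then fun e => edge x e (+) cshift (pr (letter_elt x)) (chainw s') e
  else fun=> false.
(** The mod 2 chain of the path from 1 labelled by g in the Cayley graph of H. *)
Definition chain g := chainw (fword g).

Lemma cshift1 c e : cshift 1 c e = c e.
Proof. by rewrite /cshift invg1 mul1g -surjective_pairing. Qed.

Lemma cshiftM h h' c e : cshift h (cshift h' c) e = cshift (h * h') c e.
Proof. by rewrite /cshift /= invMg mulgA. Qed.

Lemma cshift_edge x h e : cshift h (edge x) e = (e == (if x.2 then h else h * pr (letter_elt x), x.1)).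
Proof.
rewrite /cshift /edge; case: e => p i /=; rewrite !xpair_eqE; congr (_ && _).
by rewrite -(inj_eq (mulgI h)) mulKVg; case: x.2; rewrite ?mulg1.
Qed.

(** A cancelled pair of letters crosses the same edge twice. *)
Lemma chainw_cons_reduce x s : chainw (cons_reduce x s) =1 chainw (x :: s).
Proof.
case: s => [|y s] e //=; case: eqP => [->|//] /=.
have -> : cshift (pr (letter_elt x)) (fun e => edge (letter_inv x) e (+)
    cshift (pr (letter_elt (letter_inv x))) (chainw s) e) e =
  cshift (pr (letter_elt x)) (edge (letter_inv x)) e (+)
  cshift (pr (letter_elt x)) (cshift (pr (letter_elt (letter_inv x))) (chainw s)) e by [].
rewrite cshiftM cshift_edge letter_eltV proj_sqV mulgV /=.
rewrite cshift1 /edge.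
by case: x.2 => /=; rewrite addbA addbb.
Qed.

Lemma chain1 e : chain 1 e = false. Proof. by []. Qed.

Lemma chain_letterM x g e : chain (letter_elt x * g) e = edge x e (+) cshift (pr (letter_elt x)) (chain g) e.
Proof. by rewrite /chain fword_letterM chainw_cons_reduce. Qed.

Lemma chainM u v e : chain (u * v) e = chain u e (+) cshift (pr u) (chain v) e.
Proof.
elim/letter_elt_ind: u e => [|x u IH] e.
  by rewrite mul1g chain1 addFb proj_sq1 cshift1.
by rewrite -mulgA !chain_letterM -addbA proj_sqM -cshiftM {1}/cshift IH.
Qed.

Lemma chain_letter x : chain (letter_elt x) =1 edge x.
Proof. by move=> e; rewrite -[letter_elt x]mulg1 chain_letterM /cshift chain1 addbF. Qed.

Lemma chain_mul_letter g x e :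
  chain (g * letter_elt x) e = chain g e (+) (e == (if x.2 then pr g else pr g * pr (letter_elt x), x.1)).
Proof.
by rewrite chainM -cshift_edge /cshift chain_letter.
Qed.

Lemma chainV u v e : chain (u^-1 * v) e = cshift (pr u)^-1 (fun e => chain u e (+) chain v e) e.
Proof.
have := chainM u^-1 u e; rewrite mulVg chain1 [chain (_ * v) e]chainM proj_sqV /cshift.
by case: (chain u^-1 e) (chain u _) (chain v _) => [] [] [].
Qed.

(** The mod 2 boundary of a chain; a loop contributes twice to its vertex. *)
Definition degree (c : H * 'I_k -> bool) h : bool :=
  \big[addb/false]_(i < k) (c (h, i) (+) c (h * (pr (fgen i))^-1, i)).

Lemma degreeD c c' h : degree (fun e => c e (+) c' e) h = degree c h (+) degree c' h.
Proof. by rewrite /degree -big_split; apply: eq_bigr => i _ /=; rewrite addbACA. Qed.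

Lemma degree_edge x h : degree (edge x) h = (h == 1) (+) (h == pr (letter_elt x)).
Proof.
rewrite /degree (bigD1 x.1)//= big1 ?addbF => [|i /negPf ix]; last first.
  by rewrite /edge !xpair_eqE ix !andbF.
rewrite /edge !xpair_eqE eqxx !andbT; case: x => a [] /=.
  by rewrite -eq_mulgV1.
rewrite /letter_elt /= proj_sqV addbC; congr (_ (+) _).
by rewrite -[X in _ == X]mul1g (inj_eq (mulIg _)).
Qed.

Lemma degree_chain g h : degree (chain g) h = (h == 1) (+) (h == pr g).
Proof.
elim/letter_elt_ind: g h => [|x g IH] h.
  rewrite proj_sq1 addbb /degree big1// => i _; by rewrite !chain1.
transitivity (degree (edge x) h (+) degree (cshift (pr (letter_elt x)) (chain g)) h).
  rewrite -degreeD /degree; apply: eq_bigr => i _; by rewrite !chain_letterM.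
have -> : degree (cshift (pr (letter_elt x)) (chain g)) h = degree (chain g) ((pr (letter_elt x))^-1 * h).
  by apply: eq_bigr => i _; rewrite /cshift /= mulgA.
rewrite IH degree_edge proj_sqM -!addbA; congr (_ (+) _).
move: (pr (letter_elt x)) (pr g) => a b.
have E c : (a^-1 * h == c) = (h == a * c) by rewrite -(inj_eq (mulgI a)) mulKVg.
by rewrite !E mulg1 addbA addbb addFb.
Qed.

Definition chain_size g := #|[set e | chain g e]%SET|.

Lemma chain_size_dist u v : chain_size (u^-1 * v) = #|[set e | chain u e != chain v e]%SET|.
Proof.
rewrite /chain_size -(card_imset _ (f := fun e => (pr u * e.1, e.2))); last first.
  by move=> [a b] [c d] /= [/mulgI-> ->].
apply: eq_card => e; rewrite !inE; apply/imsetP/idP => [[e']|ce].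
  by rewrite inE chainV /cshift /= invgK => ce ->; case: (chain u _) (chain v _) ce => [] [].
exists ((pr u)^-1 * e.1, e.2); last by rewrite mulKVg -surjective_pairing.
by rewrite inE chainV /cshift /= invgK mulKVg -surjective_pairing; case: (chain u _) (chain v _) ce => [] [].
Qed.

Lemma squares_seriesS g : squares_series j.+1 g -> squares_series j g.
Proof.
suff : @squares_series F j.+1 `<=` squares_series j by apply.
apply: smallest_sub => [|_ [z jz <-]]; first exact: squares_series_subgroup.
by rewrite expgS expg1; exact: squares_seriesM.
Qed.

(** On Gamma_j the chain map is a morphism to a group of exponent 2. *)
Lemma chain_squaresS g e : squares_series j.+1 g -> chain g e = false.
Proof.
move=> gS; pose X := [set g : F | squares_series j g /\ chain g =1 xpred0].
have chainj u v e' : squares_series j u -> chain (u * v) e' = chain u e' (+) chain v e'.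
  move=> /proj_sq_eq1 u1; by rewrite chainM u1 cshift1.
suff XS : squares_series j.+1 `<=` X by have [_ ->] := XS _ gS.
apply: smallest_sub => [|_ [z jz <-]].
  split=> [|u v [ju cu] [jv cv]|u [ju cu]]; split.
  - exact: squares_series1.
  - by [].
  - exact: squares_seriesM.
  - by move=> e'; rewrite chainj// cu cv.
  - exact: squares_seriesV.
  - have jV := squares_seriesV ju.
    by move=> e'; have := chainj _ u e' jV; rewrite mulVg chain1 cu addbF => <-.
rewrite expgS expg1; split; first exact: squares_seriesM.
by move=> e'; rewrite chainj// addbb.
Qed.

Notation A := (squares_quotient F j.+1).
Notation prA := (@proj_sq F j.+1).

Definition coset_rep h : F := generic_quotient.repr h.
Lemma coset_repK h : pr (coset_rep h) = h. Proof. exact: proj_sq_reprK. Qed.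

Definition schreier e : F := coset_rep e.1 * fgen e.2 * (coset_rep (e.1 * pr (fgen e.2)))^-1.

Lemma schreier_in e : squares_series j (schreier e).
Proof. by apply/proj_sq_eq1; rewrite /schreier !proj_sqM proj_sqV !coset_repK mulgV. Qed.

Lemma schreier_invol e : prA (schreier e) * prA (schreier e) = 1.
Proof.
rewrite -proj_sqM; apply/proj_sq_eq1; rewrite -expg2.
exact: squares_series_sq (schreier_in e).
Qed.

Lemma schreier_comm e e' :
  prA (schreier e) * prA (schreier e') = prA (schreier e') * prA (schreier e).
Proof.
have /proj_sq_eq1 E := sq_comm (schreier_in e) (schreier_in e').
have C (a b : F) : a * b = b * a * [~ a, b] by rewrite commgEl conjgE !mulgA mulgK mulgV mul1g.
by rewrite -proj_sqM C proj_sqM E mulg1 proj_sqM.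
Qed.

Definition schreier_prod (s : seq (H * 'I_k)) (c : H * 'I_k -> bool) : A :=
  \prod_(e <- s | c e) prA (schreier e).

Lemma schreier_prod_toggle f s c : uniq s ->
  schreier_prod s (fun e => (e == f) (+) c e) = (if f \in s then prA (schreier f) else 1) * schreier_prod s c.
Proof.
elim: s => [|e s IH] /=; first by rewrite /schreier_prod !big_nil mulg1.
case/andP=> es us; have := IH us; rewrite /schreier_prod !big_cons inE => ->.
have [->|ef] := eqVneq f e.
  rewrite (negPf es) /= mul1g; case: (c e) => //=.
  by rewrite mulgA schreier_invol mul1g.
rewrite /=; case: (c e) => //; case: (f \in s); rewrite ?mul1g//.
by rewrite !mulgA schreier_comm.
Qed.

(** A word is a product of Schreier generators, one for each edge of its path, up
to the representatives of its endpoints. Modulo Gamma_(j+1) these generators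
are commuting involutions, so that only the chain matters. *)
Lemma schreier_chain h g :
  prA (coset_rep h * g * (coset_rep (h * pr g))^-1) = schreier_prod (enum {: H * 'I_k}) (cshift h (chain g)).
Proof.
elim/letter_elt_ind: g h => [|x g IH] h.
  rewrite proj_sq1 !mulg1 mulgV proj_sq1 /schreier_prod big1// => e; by rewrite /cshift chain1.
pose h' := h * pr (letter_elt x).
have -> : coset_rep h * (letter_elt x * g) * (coset_rep (h * pr (letter_elt x * g)))^-1 =
   (coset_rep h * letter_elt x * (coset_rep h')^-1) * (coset_rep h' * g * (coset_rep (h' * pr g))^-1).
  by rewrite proj_sqM mulgA -/h' !mulgA mulgVK.
rewrite proj_sqM IH.
pose f := (if x.2 then h else h', x.1).
have -> : schreier_prod (enum {: H * 'I_k}) (cshift h (chain (letter_elt x * g))) =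
    schreier_prod (enum {: H * 'I_k}) (fun e => (e == f) (+) cshift h' (chain g) e).
  apply: eq_bigl => e; rewrite -cshiftM -cshift_edge.
  by rewrite /cshift /= chain_letterM.
rewrite schreier_prod_toggle ?enum_uniq// mem_enum; congr (_ * _).
rewrite /f /h'; case: x {h' f IH} => a [] //=.
set e := (h * pr (letter_elt (a, false)), a).
apply: (mulgI (prA (schreier e))); rewrite schreier_invol.
rewrite -proj_sqM /schreier /letter_elt /= proj_sqV mulgVK !mulgA mulgVK mulgK mulgV.
exact: proj_sq1.
Qed.

(** The first homology mod 2 of the Cayley graph of H, which is the quotient of
Gamma_j by Gamma_(j+1), embeds into the chains. *)
Lemma chain_inj u v : pr u = pr v -> chain u =1 chain v -> prA u = prA v.
Proof.
move=> uv cuv; have := schreier_chain 1 u; have := schreier_chain 1 v.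
have -> : schreier_prod (enum {: H * 'I_k}) (cshift 1 (chain v)) = schreier_prod (enum {: H * 'I_k}) (cshift 1 (chain u)).
  by apply: eq_bigl => e; rewrite /cshift cuv.
by move=> <-; rewrite uv !proj_sqM => /mulIg/mulgI.
Qed.

Lemma size_letterM x g : (size (fword (letter_elt x * g)%g) <= (size (fword g)).+1)%N.
Proof.
rewrite fword_letterM; case: (fword g) => [|y s] //=; case: eqP => _ //=.
by apply: leqW; exact: leqnSn.
Qed.

Lemma size_fmul u v : (size (fword (u * v)%g) <= size (fword u) + size (fword v))%N.
Proof.
elim/reduced_word_ind: u => [|x u IH E]; first by rewrite mul1g.
by rewrite -mulgA E (leq_trans (size_letterM _ _)).
Qed.

Lemma size_letter x : size (fword (letter_elt x)) = 1%N.
Proof. by case: x => a []. Qed.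

Lemma endpoint_edge g : pr g != 1 -> exists x, chain g (if x.2 then pr g else pr g * pr (letter_elt x), x.1).
Proof.
move=> g1; have := degree_chain g (pr g); rewrite eqxx (negPf g1) addFb /degree.
have [[i]|no] := pselect (exists i, chain g (pr g, i) || chain g (pr g * (pr (fgen i))^-1, i)).
  by case/orP => ci _; [exists (i, true)|exists (i, false); rewrite /letter_elt /= proj_sqV].
rewrite big1 // => i _; have /negP := contra_not (ex_intro _ i) no.
by rewrite negb_or => /andP[/negPf-> /negPf->].
Qed.

Lemma chain_size_strip g x : chain g (if x.2 then pr g else pr g * pr (letter_elt x), x.1) ->
  chain_size g = (chain_size (g * letter_elt x)).+1.
Proof.
set f := (_, _) => cf; rewrite /chain_size (cardsD1 f) inE cf add1n; congr _.+1.
apply: eq_card => e; rewrite !inE chain_mul_letter -/f.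
by have [->|] := eqVneq e f; rewrite ?cf ?addbF.
Qed.

Lemma chain_size0_squares g : pr g = 1 -> chain_size g = 0%N -> squares_series j.+1 g.
Proof.
move=> g1 /eqP; rewrite cards_eq0 => /eqP/setP w0.
apply/proj_sq_eq1; rewrite -proj_sq1; apply: chain_inj; rewrite ?g1 ?proj_sq1//.
by move=> e; have := w0 e; rewrite !inE chain1.
Qed.

Lemma chain_size_conj g u : pr g = 1 -> chain_size (u * g * u^-1) = chain_size g.
Proof.
move=> g1.
have E e : chain (u * g * u^-1) e = chain g ((pr u)^-1 * e.1, e.2).
  rewrite !chainM proj_sqM g1 mulg1 addbAC.
  by have := chainM u u^-1 e; rewrite mulgV chain1 => <-.
rewrite /chain_size -[RHS](card_imset _ (f := fun e => (pr u * e.1, e.2))); last first.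
  by move=> [a b] [c d] /= [/mulgI-> ->].
apply: eq_card => e; rewrite !inE E; apply/idP/imsetP => [ce|[e']].
  by exists ((pr u)^-1 * e.1, e.2); rewrite ?inE// mulKVg -surjective_pairing.
by rewrite inE => ce -> /=; rewrite mulKg -surjective_pairing.
Qed.

(** Below the girth, the number of walls between 1 and g bounds the word length of
g. If the path of g is not closed in H, its chain has an edge at its endpoint,
because the degree there is odd; walking along this edge removes it from the
chain. If the path is closed but crosses some edge, a conjugate of g crosses an
edge at 1, and removing it provides a representative of length at most m in
Gamma_j, which has to be trivial. *)
Lemma short_representative m g : (chain_size g <= m)%N ->
  (forall v, squares_series j v -> (size (fword v) <= m)%N -> v = 1) ->
  exists2 g', (size (fword g') <= m)%N & squares_series j.+1 (g^-1 * g').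
Proof.
elim: m g => [|m IH] g gm girth.
  have g1 : pr g = 1.
    apply/eqP/negP => /negP/endpoint_edge[x /chain_size_strip E].
    by move: gm; rewrite E.
  exists 1 => //; rewrite mulg1; apply: squares_seriesV; apply: chain_size0_squares => //.
  by apply/eqP; rewrite -leqn0.
have girth' v : squares_series j v -> (size (fword v) <= m)%N -> v = 1.
  by move=> jv vm; apply: girth => //; exact: leqW.
have [g1|] := eqVneq (pr g) 1; last first.
  case/endpoint_edge => x /chain_size_strip E; move: gm; rewrite E ltnS => gm.
  have [g' g'm gg'] := IH _ gm girth'.
  exists (g' * (letter_elt x)^-1).
    by rewrite (leq_trans (size_fmul _ _))// -letter_eltV size_letter addn1.
  have -> : g^-1 * (g' * (letter_elt x)^-1) = ((g * letter_elt x)^-1 * g') ^ (letter_elt x)^-1.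
    by rewrite conjgE invMg invgK !mulgA mulgV mul1g.
  exact: squares_seriesJ.
have [/(chain_size0_squares g1) gS|] := eqVneq (chain_size g) 0%N.
  by exists 1 => //; rewrite mulg1; exact: squares_seriesV.
rewrite -lt0n => /card_gt0P[[h i]]; rewrite inE => ce.
have [u Eu] : exists u, u = (coset_rep h)^-1 by eexists.
have [g2 Eg2] : exists g2, g2 = u * g * u^-1 by eexists.
have g21 : pr g2 = 1 by rewrite Eg2 !proj_sqM g1 mulg1 -proj_sqM mulgV proj_sq1.
have c2 : chain g2 (if true then pr g2 else pr g2 * pr (letter_elt (i, true)), i).
  rewrite g21 Eg2 !chainM proj_sqM g1 mulg1 addbAC.
  have := chainM u u^-1 (1, i); rewrite mulgV chain1 => <-.
  by rewrite addFb /cshift Eu proj_sqV invgK coset_repK mulg1.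
have E := @chain_size_strip g2 (i, true) c2.
move: gm; rewrite -(chain_size_conj u g1) -Eg2 E ltnS => gm.
have [g' g'm gg'] := IH _ gm girth'.
have S3 : squares_series j.+1 (g2^-1 * (g' * (letter_elt (i, true))^-1)).
  have -> : g2^-1 * (g' * (letter_elt (i, true))^-1) = ((g2 * letter_elt (i, true))^-1 * g') ^ (letter_elt (i, true))^-1.
    by rewrite conjgE invMg invgK !mulgA mulgV mul1g.
  exact: squares_seriesJ.
(* It lies in Gamma_j and has length at most m. *)
have g3 : g' * (letter_elt (i, true))^-1 = 1.
  apply: girth; last by rewrite (leq_trans (size_fmul _ _))// -letter_eltV size_letter addn1.
  rewrite -[X in squares_series _ X](mulKVg g2); apply: squares_seriesM; first exact/proj_sq_eq1.
  exact: squares_seriesS.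
exists 1 => //; rewrite mulg1; move: S3; rewrite g3 mulg1.
move/(@squares_seriesJ F j.+1 _ u).
by rewrite Eg2 conjgE !invMg invgK !mulgA mulVg mul1g mulgVK.
Qed.

Lemma chainw_mem s e : chainw s e ->
  exists s1 y s2, s = s1 ++ y :: s2 /\ cshift (pr (\prod_(x <- s1) letter_elt x)) (edge y) e.
Proof.
elim: s e => //= x s IH e; have [ex _|_] := boolP (edge x e).
  by exists [::], x, s; rewrite big_nil proj_sq1 cshift1.
rewrite addFb => /IH[s1 [y [s2 [-> ey]]]].
by exists (x :: s1), y, s2; split; rewrite // big_cons proj_sqM -cshiftM.
Qed.

Lemma fword_prod s : reduced s -> fword (\prod_(x <- s) letter_elt x) = s.
Proof.
elim: s => [|x s IH] r; first by rewrite big_nil.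
rewrite big_cons fword_letterM IH ?(reduced_behead r)//.
by case: s r {IH} => //= y s /andP[/negPf->].
Qed.

(** A nontrivial element of Gamma_j of minimal length labels a simple cycle, which
crosses its first edge only once, whereas the chain of an element of
Gamma_(j+1) vanishes. *)
Lemma girth_step m : (forall v, squares_series j v -> (size (fword v) <= m)%N -> v = 1) ->
  forall v, squares_series j.+1 v -> (size (fword v) <= m.+1)%N -> v = 1.
Proof.
move=> girth v vS; rewrite leq_eqVlt => /predU1P[vm|]; last first.
  by rewrite ltnS; apply: girth; exact: squares_seriesS.
exfalso; have rv := freduced v.
case Ev : (fword v) rv vm => [//|x s] rv [sm].
pose f := (if x.2 then 1 : H else pr (letter_elt x), x.1).
have := chain_squaresS f vS; rewrite /chain Ev /= {1}/edge -/f eqxx /= => /negbFE.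
move=> /chainw_mem[s1 [y [s2 [Es ey]]]].
have {ey} : cshift (pr (\prod_(z <- x :: s1) letter_elt z)) (edge y) f.
  by rewrite big_cons proj_sqM -cshiftM.
have rx : reduced (x :: s1).
  by move: rv; rewrite Es -cat_cons /reduced => /cat_sorted2[].
have szs1 : (size s1 < m)%N by rewrite -sm Es size_cat /= addnS ltnS leq_addr.
set p := \prod_(z <- _) _; have fp : fword p = x :: s1 by exact: fword_prod.
rewrite cshift_edge /f xpair_eqE => /andP[pe /eqP xy].
have pN1 : p <> 1 by move=> p1; move: fp; rewrite p1.
have [xy2|xy2] := eqVneq x.2 y.2.
  have yx : y = x by rewrite (surjective_pairing y) -xy -xy2 -surjective_pairing.
  apply: pN1; apply: girth; last by rewrite fp.
  apply/proj_sq_eq1; move: pe; rewrite yx; case: x.2 => /eqP; first by [].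
  by rewrite -[LHS]mul1g => /mulIg.
have yx : y = letter_inv x.
  by rewrite (surjective_pairing y) /letter_inv -xy; congr (_, _); case: x.2 y.2 xy2 => [] [].
have px : pr p = pr (letter_elt x).
  move: pe; rewrite yx letter_eltV proj_sqV /letter_inv /=; case: x.2 => /= /eqP; last by [].
  by move/esym/eqP; rewrite -eq_mulgV1 => /eqP.
have s10 : s1 = [::].
  rewrite -(@fword_prod s1) ?(reduced_behead rx)// [\prod_(_ <- _) _]girth//; last first.
    by rewrite fword_prod ?(reduced_behead rx)// ltnW.
  apply/proj_sq_eq1; move: px; rewrite /p big_cons proj_sqM -[RHS]mulg1 => /mulgI.
  exact.
by move: rv; rewrite Es s10 yx /reduced /= eqxx.
Qed.

End Walls.

Lemma girth_squares_series (k j : nat) (v : free_group 'I_k) :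
  squares_series j v -> (size (fword v) <= j)%N -> v = 1%g.
Proof.
elim: j v => [|j IH]; last exact: girth_step.
by move=> v _; rewrite leqn0 => /eqP/size0nil v0; exact: val_inj.
Qed.

(** * Balls in finite groups and expansion in finite graphs *)

Section SetPowers.
Variable gT : finGroupType.
Local Open Scope group_scope.
Implicit Types (A B T : {set gT}).

Lemma card_mulg_le A B : (#|(A * B)%g| <= #|A| * #|B|)%N.
Proof. by rewrite -cardsX /mulg /= /set_mulg curry_imset2X; exact: leq_imset_card. Qed.

Lemma card_expg_le A m : (#|(A ^+ m)%g| <= #|A| ^ m)%N.
Proof.
elim: m => [|m IH]; first by rewrite expg0 cards1.
by rewrite expgS expnS (leq_trans (card_mulg_le _ _))// leq_mul2l IH orbT.
Qed.

Lemma mem_expg1 A m : 1 \in A -> 1 \in A ^+ m.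
Proof.
move=> A1; elim: m => [|m IH]; first by rewrite expg0 set11.
by rewrite expgS -[1]mulg1 mem_mulg.
Qed.

Lemma sub_expg A m n : 1 \in A -> (m <= n)%N -> A ^+ m \subset A ^+ n.
Proof.
move=> A1 /subnK <-; rewrite expgD; apply/fintype.subsetP => x xm.
by rewrite -[x]mul1g mem_mulg// mem_expg1.
Qed.

Lemma mem_expgV A m x : (forall y, y \in A -> y^-1 \in A) -> x \in A ^+ m -> x^-1 \in A ^+ m.
Proof.
move=> AV; elim: m x => [|m IH] x; first by rewrite !expg0 !inE => /eqP->; rewrite invg1.
rewrite expgS => /mulsgP[a b aA bm ->]; rewrite invMg -expgS expgSr.
by rewrite mem_mulg ?AV ?IH.
Qed.

Definition unit_ball (S : {set gT}) : {set gT} := 1 |: (S :|: S^-1).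

Lemma card_unit_ball S : (#|unit_ball S| <= (2 * #|S|).+1)%N.
Proof.
rewrite /unit_ball (leq_trans (leq_card_setU _ _))// cards1 add1n ltnS.
by rewrite (leq_trans (leq_card_setU _ _))// card_invg mul2n addnn.
Qed.
Lemma unit_ball1 S : 1 \in unit_ball S. Proof. by rewrite !inE eqxx. Qed.
Lemma unit_ballV S x : x \in unit_ball S -> x^-1 \in unit_ball S.
Proof. by rewrite !inE invg_eq1 invgK => /or3P[->|->|->]; rewrite ?orbT. Qed.

End SetPowers.

Lemma card_bigcup_le (I T : finType) (P : pred I) (B : I -> {set T}) :
  (#|(\bigcup_(i | P i) B i)%SET| <= \sum_(i | P i) #|B i|)%N.
Proof.
elim/big_rec2: _ => [|i m C _ IH]; first by rewrite cards0.
by rewrite (leq_trans (leq_card_setU _ _))// leq_add2l.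
Qed.

Section Distance.
Variables (T : finType) (e : rel T).
Implicit Types (A : {set T}) (x y z : T).

Lemma gdist_le x y p : path e x p -> last x p = y -> (gdist e x y <= size p)%N.
Proof.
case/shortenP => p' ep' up' sub ly.
have sp' : (size p' <= size p)%N.
  by apply: uniq_leq_size => //; case/andP: up'.
apply: leq_trans sp'; rewrite /gdist leqNgt; apply/negP => lt.
have szT : (size p' < #|T|)%N by move: (uniq_leq_size up' (fun z _ => mem_enum T z)); rewrite -cardE.
have := before_find 0%N lt; rewrite nth_iota// add0n => /existsP; case.
by exists (in_tuple p'); rewrite /= ep' ly eqxx.
Qed.

Lemma gdist_path x y d : (gdist e x y <= d)%N -> (d < #|T|)%N ->
  exists2 p, path e x p /\ last x p = y & (size p <= d)%N.
Proof.
move=> gd dT; have lt : (gdist e x y < #|T|)%N by exact: leq_ltn_trans dT.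
have := lt; rewrite -[X in (_ < X)%N](size_iota 0) -has_find => hs.
have := nth_find 0%N hs; rewrite nth_iota// add0n -/(gdist e x y).
by case/existsP => p /andP[ep /eqP lp]; exists p; rewrite ?size_tuple.
Qed.

Lemma gdist_connect x y : connect e x y -> (gdist e x y < #|T|)%N.
Proof.
case/connectP => p ep ->; have [p' ep' up' _] := shortenP ep.
apply: (@leq_ltn_trans (size p')); first exact: gdist_le.
by have := uniq_leq_size up' (fun z _ => mem_enum T z); rewrite -cardE.
Qed.

Lemma gdist_edge x y : (x == y) || e x y -> (gdist e x y <= 1)%N.
Proof.
case/orP => [/eqP->|xy]; first by apply: (@leq_trans 0%N) => //; exact: (@gdist_le y y [::]).
by apply: (@gdist_le x y [:: y]) => //=; rewrite xy.
Qed.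

Definition nbhd (A : {set T}) : {set T} := A :|: [set y | [exists x in A, e x y]]%SET.

Lemma sub_nbhd A : A \subset nbhd A. Proof. exact: finset.subsetUl. Qed.

Lemma nbhdP A y : reflect (exists2 x, x \in A & (x == y) || e x y) (y \in nbhd A).
Proof.
apply: (iffP idP) => [|[x xA]].
  rewrite !inE => /orP[yA|/exists_inP[x xA xy]]; first by exists y; rewrite ?eqxx.
  by exists x; rewrite ?xy ?orbT.
by case/orP => [/eqP<-|xy]; rewrite !inE ?xA//; apply/orP; right; apply/exists_inP; exists x.
Qed.

Lemma iter_nbhd_path r A y : reflect (exists2 p, exists2 x, x \in A & path e x p /\ last x p = y &
    (size p <= r)%N) (y \in iter r nbhd A).
Proof.
apply: (iffP idP).
  elim: r y => [|r IH] y /=; first by move=> yA; exists [::] => //; exists y.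
  case/nbhdP => z /IH[p [x xA [ep lp]] sp] zy.
  case/orP: zy => [/eqP<-|zy]; first by exists p; [exists x|exact: leqW].
  exists (rcons p y); last by rewrite size_rcons.
  by exists x => //; rewrite rcons_path ep lp zy last_rcons.
case=> p [x xA [ep <-]]; elim: r p ep => [|r IH] p ep.
  by case: p ep.
elim/last_ind: p ep => [|p z _] ep.
  move=> _ /=; apply/nbhdP; exists x; rewrite ?eqxx//; exact: (IH [::]).
rewrite size_rcons ltnS last_rcons => sp; move: ep; rewrite rcons_path => /andP[ep pz] /=.
by apply/nbhdP; exists (last x p); [exact: IH|rewrite pz orbT].
Qed.

Lemma iter_nbhd_gdist x y r : (gdist e x y <= r)%N -> connect e x y -> y \in iter r nbhd [set x]%SET.
Proof.
move=> gr /gdist_connect lt; have [p [ep lp] sp] := gdist_path (leqnn _) lt.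
by apply/iter_nbhd_path; exists p; [exists x; rewrite ?inE|exact: leq_trans gr].
Qed.

Lemma gdist_iter_nbhd x y r : y \in iter r nbhd [set x]%SET -> (gdist e x y <= r)%N.
Proof.
case/iter_nbhd_path => p [z /set1P-> [ep lp]]; apply: leq_trans.
exact: gdist_le.
Qed.

Lemma iter_nbhd_point r A y : y \in iter r nbhd A -> exists2 x, x \in A & y \in iter r nbhd [set x]%SET.
Proof.
case/iter_nbhd_path => p [x xA [ep lp]] sp; exists x => //.
by apply/iter_nbhd_path; exists p => //; exists x; rewrite ?inE.
Qed.

Hypothesis esym : symmetric e.

Lemma iter_nbhd_sym r x y : (y \in iter r nbhd [set x]%SET) = (x \in iter r nbhd [set y]%SET).
Proof.
wlog suff : x y / y \in iter r nbhd [set x]%SET -> x \in iter r nbhd [set y]%SET.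
  by move=> H; apply/idP/idP; exact: H.
case/iter_nbhd_path => p [z /set1P-> [ep lp]] sp.
apply/iter_nbhd_path; exists (rev (belast x p)); last by rewrite size_rev size_belast.
exists y; rewrite ?inE//; split.
  by rewrite -lp rev_path (eq_path (e' := e))// => a b; exact: esym.
by case: p {ep sp} lp => [<-//|a p _]; rewrite /= rev_cons last_rcons.
Qed.

Lemma iter_nbhd_trans r s x y z : y \in iter r nbhd [set x]%SET -> z \in iter s nbhd [set y]%SET ->
  z \in iter (s + r) nbhd [set x]%SET.
Proof.
case/iter_nbhd_path => p [u /set1P-> [ep lp]] sp.
case/iter_nbhd_path => q [v /set1P-> [eq lq]] sq.
apply/iter_nbhd_path; exists (p ++ q); last by rewrite size_cat addnC leq_add.
by exists x; rewrite ?inE// cat_path last_cat ep lp eq lq.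
Qed.

Variable D : nat.
Hypothesis eD : forall x, (#|e x| <= D)%N.

Lemma card_nbhd A : (#|nbhd A| <= D.+1 * #|A|)%N.
Proof.
rewrite /nbhd (leq_trans (leq_card_setU _ _))// mulSn leq_add2l.
have -> : [set y | [exists x in A, e x y]]%SET = (\bigcup_(x in A) [set y | e x y])%SET.
  apply/setP => y; rewrite inE; apply/exists_inP/bigcupP => -[x xA xy]; exists x => //.
    by rewrite inE.
  by move: xy; rewrite inE.
rewrite (leq_trans (card_bigcup_le _ _))// mulnC -sum_nat_const; apply: leq_sum => x _.
by rewrite cardsE.
Qed.

Lemma card_iter_nbhd r A : (#|iter r nbhd A| <= D.+1 ^ r * #|A|)%N.
Proof.
elim: r => [|r IH] /=; first by rewrite mul1n.
by rewrite (leq_trans (card_nbhd _))// expnS -mulnA leq_mul2l IH orbT.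
Qed.

Variables (R : realType) (c0 : R).
Hypothesis c0_gt0 : 0 < c0.
Hypothesis exp : (c0%:E <= cheeger R e)%E.

Lemma cheeger_le A : (0 < #|A|)%N -> (2 * #|A| <= #|T|)%N ->
  c0 * #|A|%:R <= #|edge_boundary e A|%:R.
Proof.
move=> A0 A2; have := @bigmin_le_cond _ _ _ (+oo%E : \bar R) A
  (fun A : {set T} => (0 < #|A|)%N && (2 * #|A| <= #|T|)%N)
  (fun A : {set T} => (#|edge_boundary e A|%:R / #|A|%:R : R)%:E) (introT andP (conj A0 A2)).
by move=> /(le_trans exp); rewrite lee_fin ler_pdivlMr// ltr0n.
Qed.

(** The Cheeger bound applied to the smaller one of A and its complement. *)
Lemma cut_boundary A : c0 * (#|A| * (#|T| - #|A|))%:R <=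
  #|T|%:R * #|[set xy : T * T | e xy.1 xy.2 && ((xy.1 \in A) != (xy.2 \in A))]%SET|%:R.
Proof.
set B := finset _.
have sub A' : A' \in [:: A; ~: A]%SET -> #|edge_boundary e A'|%:R <= #|B|%:R :> R.
  move=> A'A; rewrite ler_nat; apply: subset_leq_card; apply/fintype.subsetP => -[x y].
  rewrite !inE /= => /and3P[xA yA ->] /=.
  by move: A'A xA yA; rewrite !inE => /orP[] /eqP->; rewrite ?inE; case: (x \in A) (y \in A) => [] [].
have [A0|A0] := posnP #|A|; first by rewrite A0 mul0n mulr0 mulr_ge0.
have [A2|A2] := leqP (2 * #|A|)%N #|T|.
  apply: (@le_trans _ _ (#|T|%:R * (c0 * #|A|%:R))); last first.
    by rewrite ler_wpM2l// (le_trans (cheeger_le A0 A2))// sub// inE eqxx.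
  by rewrite mulrCA ler_wpM2l ?(ltW c0_gt0)// -natrM ler_nat mulnC leq_mul2r leq_subr orbT.
have cA : #|~: A|%SET = (#|T| - #|A|)%N by rewrite cardsCs finset.setCK.
have [A'0|A'0] := posnP #|(~: A)%SET|; first by rewrite -cA A'0 muln0 mulr0 mulr_ge0.
have A'2 : (2 * #|(~: A)%SET| <= #|T|)%N by rewrite cA; lia.
apply: (@le_trans _ _ (#|T|%:R * (c0 * #|(~: A)%SET|%:R))); last first.
  by rewrite ler_wpM2l// (le_trans (cheeger_le A'0 A'2))// sub// !inE eqxx orbT.
by rewrite mulrCA ler_wpM2l ?(ltW c0_gt0)// -natrM ler_nat cA leq_mul2r max_card orbT.
Qed.

Lemma vertex_expansion A : (2 * #|A| <= #|T|)%N -> (1 + c0 / D.+1%:R) * #|A|%:R <= #|nbhd A|%:R.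
Proof.
move=> A2; have [A0|A0] := posnP #|A|; first by rewrite A0 mulr0.
have -> : #|nbhd A| = (#|A| + #|nbhd A :\: A|%SET)%N.
  by rewrite -(cardsID A (nbhd A)) (finset.setIidPr (sub_nbhd A)).
rewrite natrD mulrDl mul1r lerD2l -mulrA mulrCA ler_pdivrMl ?ltr0n//.
apply: (le_trans (cheeger_le A0 A2)); rewrite -natrM ler_nat.
have sub : edge_boundary e A \subset (\bigcup_(y in nbhd A :\: A) [set (x, y) | x in e y])%SET.
  apply/fintype.subsetP => -[x y]; rewrite inE /= => /and3P[xA yA xy].
  apply/bigcupP; exists y; last by apply/imsetP; exists x; rewrite // unfold_in esym.
  by rewrite !inE yA /=; apply/orP; right; apply/exists_inP; exists x.
apply: (leq_trans (subset_leq_card sub)); apply: (leq_trans (card_bigcup_le _ _)).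
rewrite mulnC -sum_nat_const; apply: leq_sum => y _.
by rewrite (leq_trans (leq_imset_card _ _))// (leq_trans (eD y)).
Qed.

Lemma iter_expansion r A : (2 * #|iter r nbhd A| <= #|T|)%N ->
  (1 + c0 / D.+1%:R) ^+ r * #|A|%:R <= #|iter r nbhd A|%:R.
Proof.
have d0 : 0 <= 1 + c0 / D.+1%:R by rewrite addr_ge0// divr_ge0// ltW.
elim: r => [|r IH] /= A2; first by rewrite mul1r.
have A2' : (2 * #|iter r nbhd A| <= #|T|)%N.
  by rewrite (leq_trans _ A2)// leq_mul2l subset_leq_card ?sub_nbhd.
by apply: le_trans (vertex_expansion A2'); rewrite exprS -mulrA ler_wpM2l// IH.
Qed.

End Distance.

(** * Expanders over abelian groups *)

Section AbelianGrowth.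
Variables (gT : finGroupType) (B : {set gT}).
Local Open Scope group_scope.
Hypothesis cB : forall x y, x \in B -> y \in B -> commute x y.

Definition monom (m : nat) (a : {ffun {x | x \in B} -> 'I_m.+1}) : gT :=
  \prod_(x <- enum {: {x | x \in B}}) val x ^+ a x.

(** A product of commuting factors is determined by their multiplicities. *)
Lemma card_abelian_power m : (#|(B ^+ m)%g| <= m.+1 ^ #|B|)%N.
Proof.
have sub : B ^+ m \subset [set @monom m a | a in [set: {ffun {x | x \in B} -> 'I_m.+1}]]%SET.
  apply/fintype.subsetP => z zm.
  suff [a am az] : exists2 a : {x | x \in B} -> nat, (forall x, (a x <= m)%N) &
      z = \prod_(x <- enum {: {x | x \in B}}) val x ^+ a x.
    apply/imsetP; exists [ffun x => inord (a x)]; rewrite ?inE// az /monom.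
    by apply: eq_bigr => x _; rewrite ffunE inordK// ltnS am.
  elim: (m) z zm => [|i IH] z.
    rewrite expg0 => /set1P ->; exists (fun=> 0%N) => //.
    by rewrite big1// => x _; rewrite expg0.
  rewrite expgS => /mulsgP[b c bB /IH[a ai ->] ->].
  pose b' : {x | x \in B} := exist _ b bB.
  exists (fun x => (x == b') + a x)%N.
    by move=> x; have := ai x; case: (x == b') => /=; lia.
  have key (s : seq {x | x \in B}) : uniq s ->
     \prod_(x <- s) val x ^+ ((x == b') + a x) =
     (if b' \in s then b else 1) * \prod_(x <- s) val x ^+ a x.
    elim: s => [|x s IHs] /=; first by rewrite !big_nil mul1g.
    case/andP => xs us; rewrite !big_cons inE IHs//.
    have [xb|xb] := eqVneq x b'; rewrite /=.
      by move: xs; rewrite xb => /negPf->; rewrite mul1g add1n expgS mulgA.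
    rewrite add0n; case: (b' \in s); rewrite ?mul1g//.
    rewrite !mulgA; congr (_ * _); apply/commute_sym/commuteX; apply: cB => //.
    exact: (valP x).
  by rewrite key ?enum_uniq// mem_enum.
apply: leq_trans (subset_leq_card sub) _.
by rewrite (leq_trans (leq_imset_card _ _))// cardsT card_ffun card_ord card_sig.
Qed.

(** Otherwise the powers of B would grow exponentially. *)
Lemma doubling_power K : 1 \in B -> (K.+1 ^ #|B| < 2 ^ K)%N ->
  exists2 m, (m < K)%N & (#|(B ^+ m.+1)%g| <= 2 * #|(B ^+ m)%g|)%N.
Proof.
move=> B1 small; apply: contrapT => no.
have grow m : (m <= K)%N -> (2 ^ m <= #|(B ^+ m)%g|)%N.
  elim: m => [|m IH] mK; first by rewrite expg0 cards1.
  rewrite leqNgt; apply/negP => lt; apply: no; exists m => //.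
  rewrite ltnW// (leq_trans lt)// expnS leq_mul2l IH// ltnW//.
have := leq_trans (grow K (leqnn K)) (card_abelian_power K).
by rewrite leqNgt small.
Qed.

End AbelianGrowth.

Lemma leq_exp_mono a b n : (a <= b)%N -> (a ^ n <= b ^ n)%N.
Proof. by case: n => // n; rewrite leq_exp2r. Qed.

Lemma exp_beats_power N : exists K, (K.+1 ^ N < 2 ^ K)%N.
Proof.
(* 2^q >= (s + 1)^2, which exceeds q N for this s. *)
pose s := (2 * N).+1; pose q := (s + s)%N.
exists (2 ^ q).-1; rewrite prednK ?expn_gt0// -expnM ltn_exp2l//.
have s2 : (s < 2 ^ s)%N by rewrite ltn_expl.
have : (s.+1 * s.+1 <= 2 ^ q)%N by rewrite /q expnD leq_mul.
by rewrite /q /s; nia.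
Qed.

Lemma expr_unbounded (R : realType) (d x : R) : 0 < d -> exists r, x < (1 + d) ^+ r.
Proof.
move=> d0; have bern r : 1 + d *+ r <= (1 + d) ^+ r.
  elim: r => [|r IH]; first by rewrite mulr0n addr0 expr0.
  rewrite exprS; apply: (@le_trans _ _ ((1 + d) * (1 + d *+ r))); last first.
    by rewrite ler_wpM2l// addr_ge0// ltW.
  rewrite -subr_ge0 (_ : _ - _ = d * (d *+ r)); last by rewrite mulrSr; ring.
  by rewrite mulr_ge0 ?mulrn_wge0// ltW.
have [x0|x0] := leP x 0; first by exists 0%N; rewrite expr0 (le_lt_trans x0).
exists (Num.bound (x / d)); apply: lt_le_trans (bern _).
have : x / d < (Num.bound (x / d))%:R by rewrite archi_boundP// divr_ge0 ?ltW.
rewrite ltr_pdivrMr// mulr_natl => H; apply: (lt_trans H); by rewrite ltrDr.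
Qed.

Section AbelianFibre.
Variables (R : realType).

Lemma big_fibre (I J : finType) (h : I -> J) (A : {set I}) (F : {set J}) :
  (forall x, x \in A -> h x \in F) -> (0 < #|A|)%N ->
  exists y, (#|A| <= #|F| * #|h @^-1: [set y]|%SET)%N.
Proof.
move=> AF A0.
have [x0 x0A] := card_gt0P A0.
have [y _ ymax'] := @arg_maxnP _ (h x0) xpredT (fun y => #|(h @^-1: [set y])%SET|) isT.
exists y; have ymax z : (#|(h @^-1: [set z])%SET| <= #|(h @^-1: [set y])%SET|)%N by exact: ymax'.
rewrite -sum_nat_const; apply: (@leq_trans (\sum_(z in F) #|(h @^-1: [set z])%SET|)); last exact: leq_sum.
apply: leq_trans (card_bigcup_le _ _); apply: subset_leq_card; apply/fintype.subsetP => x xA.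
by apply/bigcupP; exists (h x); [exact: AF|rewrite !inE].
Qed.

(** Let B be the intersection of V with T^(2 r), let F be a power of B such that
|B F| <= 2 |F|, and let A_t be the part of A that lies over the translate t F.
Each point of A lies in |F| of the sets A_t. If a vertex is within distance r
of some A_t, then it determines t up to a translate of B F, so each vertex lies
in at most 2 |F| of the r-neighbourhoods of the A_t. Hence some A_t is multiplied
by at most 2 / c when it is replaced by its r-neighbourhood. For r large, small
sets of an expander grow more than that, so A_t contains a definite proportion
of the vertices; and F has a bounded number of points. *)
Lemma abelian_fibre (D tau : nat) (c0 c : R) : 0 < c0 -> 0 < c ->
  exists2 c' : R, 0 < c' & forall (X : finType) (e : rel X) (gT : finGroupType)
    (T V : {set gT}) (h : X -> gT) (A : {set X}),
    symmetric e -> (forall x, (#|e x| <= D)%N) -> (c0%:E <= cheeger R e)%E ->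
    (0 < #|X|)%N -> (#|T| <= tau)%N -> (1 \in T)%g -> (forall t, t \in T -> t^-1 \in T)%g ->
    (forall x y, x \in V -> y \in V -> commute x y)%g -> (group_set V)%g ->
    (forall x y, e x y -> (h x)^-1 * h y \in T)%g ->
    (forall x y, x \in A -> y \in A -> (h x)^-1 * h y \in V)%g ->
    c * #|X|%:R <= #|A|%:R -> exists y, c' * #|X|%:R <= #|(h @^-1: [set y])%SET|%:R.
Proof.
move=> c00 c_0.
have [r rc] : exists r, 2 / c < (1 + c0 / D.+1%:R) ^+ r.
  by apply: expr_unbounded; rewrite divr_gt0.
pose N := (tau ^ (r + r))%N.
have [K HK] := exp_beats_power N.
pose M := (K.+1 ^ N)%N.
have M0 : 0 < M%:R :> R by rewrite ltr0n expn_gt0.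
exists (c / (4 * M%:R)); first by rewrite divr_gt0// mulr_gt0.
move=> X e gT T V h A esym eD ch X0 Ttau T1 TV cV gV hT hV cA.
have X0R : 0 < #|X|%:R :> R by rewrite ltr0n.
have A0 : (0 < #|A|)%N by rewrite -(ltr0n R) (lt_le_trans _ cA)// mulr_gt0.
have [a0 a0A] := card_gt0P A0.
have V1 : (1 \in V)%g by have := hV _ _ a0A a0A; rewrite mulVg.
pose B := (V :&: T ^+ (r + r))%g.
have B1 : (1 \in B)%g by rewrite inE V1 mem_expg1.
have BV x : x \in B -> (x^-1 \in B)%g.
  by rewrite !inE => /andP[xV xT]; rewrite mem_expgV// andbT (groupV (Group gV)).
have BN : (#|B| <= N)%N.
  rewrite (leq_trans (subset_leq_card (finset.subsetIr _ _)))//.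
  by rewrite (leq_trans (card_expg_le _ _))// leq_exp_mono.
have cB x y : x \in B -> y \in B -> commute x y.
  by rewrite !inE => /andP[xV _] /andP[yV _]; exact: cV.
have [m mK dbl] : exists2 m, (m < K)%N & (#|(B ^+ m.+1)%g| <= 2 * #|(B ^+ m)%g|)%N.
  apply: doubling_power => //; apply: leq_ltn_trans HK; exact: leq_pexp2l.
pose F := (B ^+ m)%g.
have F1 : (1 \in F)%g by exact: mem_expg1.
have F0 : (0 < #|F|)%N by apply/card_gt0P; exists 1%g.
have FM : (#|F| <= M)%N.
  rewrite (leq_trans (card_abelian_power cB m))// (leq_trans (leq_pexp2l _ BN))//.
  by rewrite leq_exp_mono// ltnS ltnW.
have VM x y : x \in V -> y \in V -> (x * y)%g \in V by exact: (@groupM _ (Group gV)).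
have VI x : x \in V -> (x^-1)%g \in V by exact: (@groupVr _ (Group gV)).
have FV x : x \in F -> x \in V.
  rewrite /F; elim: (m) x => [|i IH] x; first by rewrite expg0 => /set1P->.
  rewrite expgS => /mulsgP[b y]; rewrite inE => /andP[bV _] /IH yV ->.
  exact: VM.
have FI x : x \in F -> (x^-1 \in F)%g by exact: mem_expgV.
have [v vE] : exists v : X -> gT, forall x, v x = ((h a0)^-1 * h x)%g.
  by exists (fun x => (h a0)^-1 * h x)%g.
have vV x : x \in A -> v x \in V by move=> xA; rewrite vE; exact: hV.
pose A_ t := [set x in A | (t^-1 * v x)%g \in F]%SET.
(* Double counts of the points of the A_t and of their r-neighbourhoods. *)
have sumA : (\sum_(t in V) #|A_ t| = #|A| * #|F|)%N.
  under eq_bigr => t _ do rewrite -sum1_card.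
  rewrite (exchange_big_dep (mem A)) /=; last by move=> t x _; rewrite inE => /andP[].
  rewrite -sum_nat_const; apply: eq_bigr => x xA; rewrite sum1_card.
  rewrite -[RHS](card_imset _ (f := fun y => (v x * y^-1)%g)); last first.
    by move=> y z /mulgI/invg_inj.
  apply: eq_card => t; rewrite unfold_in inE xA /=; apply/andP/imsetP => [[tV tF]|[y yF ->]].
    exists (t^-1 * v x)%g; first exact: tF.
    by rewrite invMg invgK mulgA mulgV mul1g.
  split; last by rewrite invMg invgK -mulgA mulVg mulg1.
  by apply: VM; [exact: vV|exact/VI/FV].
have hstep i x y : y \in iter i (nbhd e) [set x]%SET -> ((h x)^-1 * h y \in T ^+ i)%g.
  elim: i y => [|i IH] y /=; first by move/set1P->; rewrite mulVg expg0 set11.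
  case/nbhdP => z /IH zi zy; rewrite expgSr -[(h x)^-1%g](mulgK (h z)) -mulgA mem_mulg//.
  by case/orP: zy => [/eqP->|/hT//]; rewrite mulVg.
have sumN : (\sum_(t in V) #|iter r (nbhd e) (A_ t)| <= #|X| * (2 * #|F|))%N.
  under eq_bigr => t _ do rewrite -sum1_card.
  rewrite (exchange_big_dep predT) //= -sum_nat_const; apply: leq_sum => x _.
  rewrite sum1_card; apply: leq_trans dbl.
  have [[t1 /andP[t1V /iter_nbhd_point[a]]]|no] :=
      pselect (exists t, (t \in V) && (x \in iter r (nbhd e) (A_ t))); last first.
    rewrite (_ : #|_| = 0%N) //; apply: eq_card0 => t; apply/negP => tx; apply: no.
    by exists t.
  rewrite inE => /andP[aA aF] xa.
  rewrite -(card_imset (mem (B ^+ m.+1)%g) (mulgI (v a))); apply: subset_leq_card.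
  apply/fintype.subsetP => t; rewrite unfold_in => /andP[tV /iter_nbhd_point[b]].
  rewrite inE => /andP[bA bF] xb; apply/imsetP.
  exists ((h a)^-1 * h b * (t^-1 * v b)^-1)%g; last first.
    by rewrite !vE !invMg !invgK !mulgA !mulgK mulVg mul1g.
  have hab : ((h a)^-1 * h b \in T ^+ (r + r))%g.
    have -> : ((h a)^-1 * h b = (h a)^-1 * h x * ((h b)^-1 * h x)^-1)%g.
      by rewrite invMg invgK mulgA mulgK.
    by rewrite expgD mem_mulg ?mem_expgV ?hstep.
  by rewrite expgS mem_mulg ?FI// inE hV.
have [t [tV At0 Nt]] : exists t, [/\ t \in V, (0 < #|A_ t|)%N &
    #|iter r (nbhd e) (A_ t)|%:R <= 2 / c * #|A_ t|%:R :> R].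
  apply: contrapT => no.
  have lt t : t \in V -> (0 < #|A_ t|)%N -> 2 / c * #|A_ t|%:R < #|iter r (nbhd e) (A_ t)|%:R.
    by move=> tV At; rewrite ltNge; apply/negP => le; apply: no; exists t.
  have le t : t \in V -> 2 / c * #|A_ t|%:R <= #|iter r (nbhd e) (A_ t)|%:R.
    by move=> tV; have [->|/(lt t tV)/ltW//] := posnP #|A_ t|; rewrite mulr0.
  have A1 : (0 < #|A_ 1%g|)%N.
    by apply/card_gt0P; exists a0; rewrite inE a0A vE mulVg invg1 mulg1.
  have : \sum_(t in V) (2 / c * #|A_ t|%:R) < \sum_(t in V) #|iter r (nbhd e) (A_ t)|%:R :> R.
    rewrite (bigD1 1%g) //= [ltRHS](bigD1 1%g) //=; apply: ltr_leD; first exact: lt.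
    by apply: ler_sum => t /andP[tV _]; exact: le.
  rewrite -mulr_sumr -!natr_sum sumA ltNge => /negP; apply.
  apply: (@le_trans _ _ (#|X|%:R * (2 * #|F|%:R))); first by rewrite -!natrM ler_nat.
  rewrite natrM -(mulrA 2) [leLHS]mulrCA ler_pM2l// mulrA ler_wpM2r// ler_pdivlMl//.
have big : (#|X| < 2 * #|iter r (nbhd e) (A_ t)|)%N.
  rewrite ltnNge; apply/negP => small.
  have := le_trans (iter_expansion esym eD c00 ch small) Nt.
  by rewrite ler_pM2r ?ltr0n// leNgt rc.
have [y Hy] : exists y, (#|A_ t| <= #|[set (h a0 * t * f)%g | f in F]%SET| * #|(h @^-1: [set y])%SET|)%N.
  apply: big_fibre => // x; rewrite inE => /andP[xA xF].
  by apply/imsetP; exists (t^-1 * v x)%g; rewrite // vE !mulgA mulgK mulgV mul1g.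
have AtR : c * #|X|%:R <= 4 * #|A_ t|%:R.
  have bigR : #|X|%:R <= 2 * #|iter r (nbhd e) (A_ t)|%:R :> R.
    by rewrite -natrM ler_nat ltnW.
  have := le_trans bigR (ler_wpM2l (ltW (ltr0n _ 2)) Nt).
  by rewrite mulrCA -ler_pdivlMl// -mulrA mulrCA [c^-1 * _]mulrC; lra.
have YM : (#|A_ t| <= M * #|(h @^-1: [set y])%SET|)%N.
  rewrite (leq_trans Hy)// leq_mul2r; apply/orP; right.
  exact: leq_trans (leq_imset_card _ _) FM.
rewrite -(ler_nat R) natrM in YM.
exists y; rewrite mulrAC ler_pdivrMr ?mulr_gt0// (le_trans AtR)//.
by rewrite [leRHS]mulrCA ler_wpM2l// [leRHS]mulrC.
Qed.

End AbelianFibre.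

(** * Expanders over the quotients of a free group *)

Section WallFibre.
Variable k : nat.
Notation F := (free_group 'I_k).

Definition free_gens j : {set squares_quotient F j} := [set proj_sq j (fgen i) | i : 'I_k]%SET.

(** Walls are defined on the quotient by Gamma_(j+1). *)
Lemma chain_congr j (u v : F) : squares_series j.+1 (u^-1 * v)%g -> @chain k j u =1 @chain k j v.
Proof.
move=> uv e; rewrite -[in RHS](mulKVg u v) chainM /cshift.
by rewrite (chain_squaresS _ uv) addbF.
Qed.

Lemma chain_size_unit_ball j (g : F) : proj_sq j.+1 g \in unit_ball (free_gens j.+1) -> (@chain_size k j g <= 1)%N.
Proof.
have congr_letter (x : 'I_k * bool) : proj_sq j.+1 g = proj_sq j.+1 (letter_elt x) -> (@chain_size k j g <= 1)%N.
  move/esym/proj_sqP/chain_congr => E; rewrite /chain_size.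
  rewrite -(cards1 (if x.2 then 1%g else proj_sq j (letter_elt x), x.1)).
  by apply: subset_leq_card; apply/fintype.subsetP => e; rewrite !inE -E chain_letter.
rewrite !inE => /or3P[/eqP g1|/imsetP[i _ gi]|/imsetP[i _ gi]].
- have g1S : squares_series j.+1 g by apply/proj_sq_eq1.
  rewrite /chain_size (_ : [set e | _]%SET = finset.set0) ?cards0//.
  by apply/setP => e; rewrite !inE chain_squaresS.
- exact: (congr_letter (i, true)).
- by apply: (congr_letter (i, false)); rewrite /letter_elt /= proj_sqV -gi invgK.
Qed.

Lemma proj_word_ball j (g : F) m : (size (fword g) <= m)%N ->
  proj_sq j g \in (unit_ball (free_gens j) ^+ m)%g.
Proof.
move=> sm; suff H : proj_sq j g \in (unit_ball (free_gens j) ^+ size (fword g))%g.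
  by move: H; apply/fintype.subsetP; rewrite sub_expg// unit_ball1.
elim/reduced_word_ind: g {sm} => [|x g IH E]; first by rewrite proj_sq1 mem_expg1// unit_ball1.
rewrite E expgS proj_sqM mem_mulg// !inE; case: x E => a [] _; rewrite /letter_elt /=.
  by rewrite imset_f ?orbT.
by rewrite proj_sqV invgK imset_f ?orbT.
Qed.

Lemma card_cut (T : finType) (A : {set T}) :
  #|[set xy : T * T | (xy.1 \in A) != (xy.2 \in A)]%SET| = (2 * (#|A| * (#|T| - #|A|)))%N.
Proof.
have -> : [set xy : T * T | (xy.1 \in A) != (xy.2 \in A)]%SET = (finset.setX A (~: A) :|: finset.setX (~: A) A)%SET.
  by apply/setP => -[x y]; rewrite !inE /=; case: (x \in A) (y \in A) => [] [].
rewrite cardsU !cardsX (_ : (_ :&: _)%SET = finset.set0); last first.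
  by apply/setP => -[x y]; rewrite !inE /=; case: (x \in A) (y \in A) => [] [].
have -> : #|(~: A)%SET| = (#|T| - #|A|)%N by rewrite [LHS]cardsCs finset.setCK.
by rewrite cards0 subn0; lia.
Qed.

(** The expansion inequality is applied to every wall and summed. As an edge of X
crosses at most one wall, the mean over pairs of vertices of the number of walls
that separate them is bounded. So half of the vertices are separated from one of
them by at most m walls, and [short_representative] puts their images in a ball
of radius m. *)
Lemma wall_fibre (R : realType) (D : nat) (c0 : R) : 0 < c0 ->
  exists m : nat, exists2 c : R, 0 < c & forall j (X : finType) (e : rel X) (h : X -> squares_quotient F j.+1),
    (m <= j)%N -> symmetric e -> (forall x, (#|e x| <= D)%N) -> (c0%:E <= cheeger R e)%E ->
    (0 < #|X|)%N -> (forall x y, e x y -> (h x)^-1 * h y \in unit_ball (free_gens j.+1))%g ->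
    exists a, c * #|X|%:R <= #|(h @^-1: [set a])%SET|%:R.
Proof.
move=> c00.
have [m m_gt0 mD] : exists2 m : nat, (0 < m)%N & 4 * D%:R <= c0 * m%:R.
  exists (Num.bound (4 * D%:R / c0)).+1 => //.
  rewrite -ler_pdivrMl// mulrC; apply: (@le_trans _ _ (Num.bound (4 * D%:R / c0))%:R); last by rewrite ler_nat.
  apply/ltW/archi_boundP; by rewrite divr_ge0 ?mulr_ge0 ?(ltW c00).
pose M := ((2 * k).+1 ^ m)%N.
have M0 : 0 < M%:R :> R by rewrite ltr0n expn_gt0.
exists m; exists (2 * M%:R)^-1; first by rewrite invr_gt0 mulr_gt0.
move=> j X e h mj esym eD ch X0 hstep.
have X0R : 0 < #|X|%:R :> R by rewrite ltr0n.
pose w x : F := coset_rep (h x).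
have wK x : proj_sq j.+1 (w x) = h x by exact: coset_repK.
pose d x y := @chain_size k j ((w x)^-1 * w y)%g.
have d1 x y : e x y -> (d x y <= 1)%N.
  by move=> /hstep xy; apply: chain_size_unit_ball; rewrite proj_sqM proj_sqV !wK.
pose W f := [set x | @chain k j (w x) f]%SET.
have wall_count (P : pred (X * X)) : (\sum_f #|[set xy : X * X | P xy && ((xy.1 \in W f) != (xy.2 \in W f))]%SET| =
    \sum_(xy | P xy) d xy.1 xy.2)%N.
  under eq_bigr => f _ do rewrite -sum1_card.
  rewrite (exchange_big_dep P) /=; last by move=> f xy _; rewrite inE => /andP[].
  apply: eq_bigr => xy Pxy; rewrite sum1_card /d chain_size_dist; apply: eq_card => f.
  by rewrite unfold_in -[LHS]/(xy \in finset _) !inE Pxy.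
(* Each wall separates |W| (|X| - |W|) pairs, counted in both orders. *)
have tot : (\sum_x \sum_y d x y = \sum_f 2 * (#|W f| * (#|X| - #|W f|)))%N.
  rewrite pair_bigA /= -(wall_count predT); apply: eq_bigr => f _; rewrite -card_cut.
  by apply: eq_card => xy; rewrite !inE.
have bdry : (\sum_(xy | e xy.1 xy.2) d xy.1 xy.2 <= #|X| * D)%N.
  apply: (@leq_trans (\sum_(xy | e xy.1 xy.2) 1)); first by apply: leq_sum => -[x y] /d1.
  rewrite -(pair_big_dep predT e (fun _ _ => 1%N)) /= -sum_nat_const; apply: leq_sum => x _.
  by rewrite sum1_card.
have avg : c0 * (\sum_x \sum_y d x y)%:R <= 2 * (#|X|%:R * (#|X|%:R * D%:R)).
  rewrite tot -big_distrr /= natrM mulrCA ler_wpM2l// natr_sum mulr_sumr.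
  apply: (@le_trans _ _ (\sum_f (#|X|%:R *
      #|[set xy : X * X | e xy.1 xy.2 && ((xy.1 \in W f) != (xy.2 \in W f))]%SET|%:R))).
    by apply: ler_sum => f _; exact: cut_boundary.
  by rewrite -mulr_sumr ler_wpM2l// -natr_sum (wall_count (fun xy => e xy.1 xy.2)) -natrM ler_nat.
have [x0 x0avg] : exists x, c0 * (\sum_y d x y)%:R <= 2 * (#|X|%:R * D%:R).
  apply: contrapT => no; move: avg; rewrite leNgt => /negP; apply.
  have [x1 _] := card_gt0P X0.
  rewrite natr_sum mulr_sumr.
  rewrite (_ : 2 * _ = \sum_(x : X) 2 * (#|X|%:R * D%:R)); last first.
    by rewrite sumr_const -[_ *+ _]mulr_natl; ring.
  have lt x : 2 * (#|X|%:R * D%:R) < c0 * (\sum_y d x y)%:R.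
    by rewrite ltNge; apply/negP => le; apply: no; exists x.
  rewrite (bigD1 x1)//= [ltRHS](bigD1 x1)//=; apply: ltr_leD; first exact: lt.
  by apply: ler_sum => x _; exact: ltW.
pose good := [set y | (d x0 y <= m)%N]%SET.
have bad_le : (m * #|(~: good)%SET| <= \sum_y d x0 y)%N.
  rewrite mulnC -sum_nat_const [leqRHS](bigID (mem (~: good)%SET)) /=.
  apply: leq_trans (leq_addr _ _); apply: leq_sum => y; rewrite !inE -ltnNge; exact: ltnW.
have good_ge : #|X|%:R <= 2 * #|good|%:R :> R.
  have cX : (#|good| + #|(~: good)%SET| = #|X|)%N by rewrite cardsC.
  have m0 : 0 < c0 * m%:R by rewrite mulr_gt0// ltr0n.
  have : c0 * m%:R * (2 * #|(~: good)%SET|%:R) <= c0 * m%:R * #|X|%:R.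
    rewrite -(ler_nat R) natrM in bad_le.
    have := le_trans (ler_wpM2l (ltW c00) bad_le) x0avg => H.
    have H' := ler_wpM2r (ltW X0R) mD.
    rewrite (_ : c0 * _ * _ = 2 * (c0 * (m%:R * #|(~: good)%SET|%:R))); last by ring.
    apply: (@le_trans _ _ (2 * (2 * (#|X|%:R * D%:R)))); first by rewrite ler_wpM2l.
    by rewrite (_ : 2 * _ = 4 * D%:R * #|X|%:R); last by ring.
  rewrite ler_pM2l// => H; have : #|X|%:R = #|good|%:R + #|(~: good)%SET|%:R :> R by rewrite -natrD cX.
  lra.
have good0 : (0 < #|good|)%N.
  by rewrite -(ltr0n R); move: good_ge X0R; lra.
have goodF y : y \in good -> h y \in [set h x0 * t | t in unit_ball (free_gens j.+1) ^+ m]%g%SET.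
  rewrite inE => yg.
  have [g' g'm gg'] := short_representative yg (fun v jv vm => girth_squares_series jv (leq_trans vm mj)).
  apply/imsetP; exists (proj_sq j.+1 g'); first exact: proj_word_ball.
  move/proj_sqP: gg' => <-; by rewrite proj_sqM proj_sqV !wK mulVKg.
have [a Ha] := big_fibre goodF good0.
exists a; rewrite ler_pdivrMl ?mulr_gt0// (le_trans good_ge)// -mulrA ler_wpM2l//.
rewrite -natrM ler_nat (leq_trans Ha)//.
rewrite leq_mul2r; apply/orP; right.
rewrite (leq_trans (leq_imset_card _ _))// (leq_trans (card_expg_le _ _))// leq_exp_mono//.
rewrite (leq_trans (card_unit_ball _))// ltnS leq_mul2l /=.
by rewrite (leq_trans (leq_imset_card _ _))// card_ord.
Qed.

End WallFibre.

(** * The groups G_n: expanders and coarse embeddings *)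

Section CayleyGraphs.
Variables (gT : finGroupType) (S : {set gT}).
Local Open Scope group_scope.

Lemma cayley_step x y : cayley S x y -> x^-1 * y \in unit_ball S.
Proof. by case/andP => _; rewrite !inE invMg invgK => ->; rewrite orbT. Qed.

Lemma word_dist_ball x y d : (word_dist S x y <= d)%N -> (d < #|gT|)%N ->
  x^-1 * y \in unit_ball S ^+ d.
Proof.
move=> xyd dG; have [p [ep <-] pd] := gdist_path xyd dG.
suff : x^-1 * last x p \in unit_ball S ^+ size p.
  by apply/fintype.subsetP; rewrite sub_expg// unit_ball1.
elim: p x ep {xyd pd} => [|z p IH] x /=; first by rewrite mulVg expg0 set11.
case/andP => /cayley_step xz /IH zp.
by rewrite expgS -[x^-1](mulgK z) -mulgA mem_mulg.
Qed.

Lemma word_dist1_ball x y : (word_dist S x y <= 1)%N -> x^-1 * y \in unit_ball S.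
Proof.
move=> xy; have [G1|] := leqP #|gT| 1; last by move/(word_dist_ball xy); rewrite expg1.
have /fintype_le1P : (#|gT| <= 1)%N by [].
by move=> /(_ x y) ->; rewrite mulVg unit_ball1.
Qed.

Lemma word_dist_gen g s : s \in S -> (word_dist S g (g * s) <= 1)%N.
Proof.
move=> sS; apply: gdist_edge; rewrite /cayley mulKg sS andbT.
by case: (_ == _).
Qed.

End CayleyGraphs.

Section GnStructure.
Variables (pi : {multiplicative F3 -> Q}) (n : nat).
Notation G := (Gn pi n).
Notation H := (squares_quotient F3 (3 * n - 3)).
Local Open Scope group_scope.

Definition toH (g : G) : H := (pair_of_sd g).1.

Lemma toHM g g' : toH (g * g') = toH g * toH g'. Proof. by []. Qed.
Lemma toH_inV v : toH (inV pi v) = 1.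
Proof. by rewrite /toH /inV /sdpair1 val_insubd; case: ifP. Qed.
Lemma toH_inH k : toH (inH pi k) = k.
Proof. by rewrite /toH /inH /sdpair2 val_insubd !inE. Qed.
Lemma toHV g : toH g^-1 = (toH g)^-1. Proof. by []. Qed.
Lemma toH_ker g : toH g = 1 -> exists v, g = inV pi v.
Proof.
move=> g1; exists (pair_of_sd g).2; rewrite [LHS]sdpairE -/(toH g) g1.
by rewrite /inV (morph1 (sdpair2_morphism (Haction pi n))) mul1g.
Qed.

Lemma toH_unit_ball g : g \in unit_ball (Sn pi n) -> toH g \in unit_ball (free_gens 3 (3 * n - 3)).
Proof.
have HS s : s \in Sn pi n -> toH s \in unit_ball (free_gens 3 (3 * n - 3)) .
  rewrite inE => /orP[] /imsetP[i _ ->]; last by rewrite toH_inV unit_ball1.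
  by rewrite toH_inH !inE imset_f ?orbT.
rewrite 3!inE => /or3P[/eqP->|/HS//|]; first exact: unit_ball1.
by rewrite inE => /HS/unit_ballV; rewrite toHV invgK.
Qed.

Lemma inV_inj : injective (@inV pi n).
Proof.
move=> v w; have /injmP := injm_sdpair1 (Haction pi n).
by move=> /(_ v w); rewrite !finset.in_setT; exact.
Qed.

Definition Vgrp : {group G} := (sdpair1_morphism (Haction pi n) @* [set: Vn n])%G.

Lemma VgrpP g : reflect (exists v, g = inV pi v) (g \in Vgrp).
Proof.
apply: (iffP morphimP) => [[v _ _ ->]|[v ->]]; first by exists v.
by exists v; rewrite ?finset.in_setT.
Qed.

Lemma Vgrp_comm x y : x \in Vgrp -> y \in Vgrp -> commute x y.
Proof.
move=> /VgrpP[v ->] /VgrpP[w ->]; by rewrite /commute -!inVD addrC.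
Qed.

Lemma Vgrp_normal : fingroup.normal Vgrp [set: G]%SET.
Proof.
rewrite /fingroup.normal finset.subsetT /=; apply/fintype.subsetP => g _; rewrite inE.
apply/fintype.subsetP => _ /imsetP[x /VgrpP[v ->] ->].
have /toH_ker[w ->] : toH (inV pi v ^ g) = 1.
  by rewrite conjgE !toHM toH_inV toHV mul1g mulVg.
by apply/VgrpP; exists w.
Qed.

Lemma card_Gn_gens : (#|Sn pi n| <= 5)%N.
Proof.
rewrite /Sn (leq_trans (leq_card_setU _ _))// -[5%N]/(3 + 2)%N leq_add//.
  by rewrite (leq_trans (leq_imset_card _ _))// card_ord.
by rewrite (leq_trans (leq_imset_card _ _))// card_ord.
Qed.

Lemma card_Vn : #|{: Vn n}| = ((2 ^ n) ^ 2)%N.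
Proof. by rewrite card_mx card_ord muln1 prednK// expn_gt0. Qed.

End GnStructure.

Section Expanders.
Variables (R : realType) (pi : {multiplicative F3 -> Q}).
Variables (X : nat -> finType) (e : forall n, rel (X n)) (h : forall n, X n -> Gn pi n).
Hypothesis expX : expander R e.
Hypothesis lip : forall n (x y : X n),
  (word_dist (Sn pi n) (@h n x) (@h n y) <= gdist (@e n) x y)%N.

Lemma lipschitz_step n (x y : X n) : @e n x y -> ((@h n x)^-1 * h y)%g \in unit_ball (Sn pi n).
Proof.
move=> xy; apply: word_dist1_ball; apply: leq_trans (lip x y) _.
by apply: gdist_edge; rewrite xy orbT.
Qed.

(** The finitely many n for which H has small girth are treated with the bounded
order of the groups; for the other ones [wall_fibre] yields a coset of V with
many preimages, to which [abelian_fibre] applies. *)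
Lemma fibres_large : exists2 c : R, 0 < c & forall n, exists y,
  c * #|X n|%:R <= #|(@h n @^-1: [set y])%SET|%:R.
Proof.
case: expX => conn [D eD] _ [c0 c00 ch].
have [m [c1 c10 wall]] := @wall_fibre 3 R D c0 c00.
have [c2 c20 abel] := @abelian_fibre R D 11 c0 c1 c00 c10.
pose s := (\sum_(i < m.+2) #|Gn pi i|)%N.
exists (Num.min c2 s.+1%:R^-1); first by rewrite lt_min c20 invr_gt0 ltr0n.
move=> n; have [esym _ X0 _] := conn n.
have [small|large] := leqP n m.+1.
  have XT : (0 < #|[set: X n]%SET|)%N by rewrite cardsT.
  have [y Hy] := @big_fibre _ _ (@h n) [set: X n]%SET [set: Gn pi n]%SET (fun x _ => finset.in_setT _) XT.
  exists y; apply: (@le_trans _ _ (s.+1%:R^-1 * #|X n|%:R)).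
    by rewrite ler_wpM2r// ge_min lexx orbT.
  rewrite ler_pdivrMl ?ltr0n// -natrM ler_nat.
  rewrite cardsT in Hy; apply: (leq_trans Hy); rewrite leq_mul2r; apply/orP; right.
  by rewrite cardsT /s (bigD1 (Ordinal (small : (n < m.+2)%N)))//= -addnS leq_addr.
have [a Ha] : exists a, c1 * #|X n|%:R <= #|((fun x => toH (@h n x)) @^-1: [set a])%SET|%:R.
  have wall' J (hJ : X n -> squares_quotient F3 J) : (m < J)%N ->
      (forall x y, @e n x y -> ((hJ x)^-1 * hJ y)%g \in unit_ball (free_gens 3 J)) ->
      exists a, c1 * #|X n|%:R <= #|(hJ @^-1: [set a])%SET|%:R.
    case: J hJ => // J hJ mJ hstep.
    exact: (wall J (X n) (@e n) hJ mJ esym (eD n) (ch n) X0 hstep).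
  apply: wall' => [|x y xy]; first by lia.
  by rewrite -toHV -toHM; apply/toH_unit_ball/lipschitz_step.
have [y Hy] : exists y, c2 * #|X n|%:R <= #|(@h n @^-1: [set y])%SET|%:R.
  apply: (abel (X n) (@e n) (Gn pi n) (unit_ball (Sn pi n)) (Vgrp pi n) (@h n) _ esym (eD n) (ch n) X0 _ _ _ _ _ _ _ Ha).
  - by rewrite (leq_trans (card_unit_ball _))// ltnS (leq_mul2l 2 _ 5) card_Gn_gens.
  - exact: unit_ball1.
  - exact: unit_ballV.
  - exact: Vgrp_comm.
  - exact: groupP.
  - exact: lipschitz_step.
  - move=> x y; rewrite !inE => /eqP hx /eqP hy.
    apply/VgrpP; apply: toH_ker; by rewrite toHM toHV hx hy mulVg.
exists y; apply: le_trans Hy; rewrite ler_wpM2r// ge_min lexx //.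
Qed.

(** With L the diameter of the fibre, bounded degree gives |X| <= (D + 2)^(L + t),
where t accounts for the constant c. By expansion, balls of radius r contain more
than half of X as soon as the r-th power of the growth rate d exceeds |X|. The
exponent s compares d with D + 2, so that r = s (L + t) is enough. *)
Lemma fibre_diameter (c : R) (y : forall n, Gn pi n) : 0 < c ->
  (forall n, c * #|X n|%:R <= #|(@h n @^-1: [set y n])%SET|%:R) ->
  exists2 c' : R, 0 < c' & \forall n \near \oo,
    c' * (diam (@e n) [set: X n]%SET)%:R <= (diam (@e n) (@h n @^-1: [set y n])%SET)%:R.
Proof.
move=> c_0 fib; case: expX => conn [D eD] Xoo [c0 c00 ch].
have d0 : 0 < c0 / D.+1%:R by rewrite divr_gt0.
have [s sD] := expr_unbounded (D.+2%:R) d0.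
have [t tc] := expr_unbounded (c^-1) (ltr01 : 0 < 1 :> R).
set d := 1 + _ in sD.
exists (2 * (s * t.+1).+1%:R)^-1; first by rewrite invr_gt0 mulr_gt0.
have [B Bc] : exists B : nat, c^-1 < B%:R by exists (Num.bound c^-1); rewrite archi_boundP// invr_ge0 ltW.
have /cvgnyPge/(_ B) := Xoo; apply: filterS => n Bn.
have [esym _ X0 con] := conn n.
set Y := (_ @^-1: _)%SET; have cY : c * #|X n|%:R <= #|Y|%:R := fib n.
set L := diam (@e n) Y.
have Y1 : (1 < #|Y|)%N.
  rewrite -(ltr_nat R); apply: lt_le_trans cY.
  rewrite -ltr_pdivrMl// mulr1 (lt_le_trans Bc)// ler_nat//.
have [y0 y0Y] : exists y0, y0 \in Y by apply/card_gt0P; exact: ltnW.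
have YL : (#|Y| <= D.+1 ^ L)%N.
  have := card_iter_nbhd (eD n) L [set y0]%SET; rewrite cards1 muln1; apply: leq_trans.
  apply: subset_leq_card; apply/fintype.subsetP => z zY; apply: iter_nbhd_gdist => //.
  have row : (gdist (@e n) y0 z <= (\max_(y in Y) gdist (@e n) y0 y)%N)%N.
    exact: (leq_bigmax_cond (P := fun x => x \in Y) (F := fun y => gdist (@e n) y0 y)) zY.
  by apply: (leq_trans row); rewrite /L /diam [leqRHS](bigD1 y0)//= leq_maxl.
have L0 : (0 < L)%N.
  by rewrite lt0n; apply: contraTneq Y1 => L0; rewrite -leqNgt (leq_trans YL)// L0.
pose r := (s * (L + t))%N.
have dr : #|X n|%:R < d ^+ r.
  have d1 : 1 <= d by rewrite lerDl ltW.
  rewrite /r exprM; apply: (@lt_le_trans _ _ (D.+2%:R ^+ (L + t))); last first.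
    apply: lerXn2r; rewrite ?nnegrE//; last exact: ltW.
    exact/exprn_ge0/(le_trans ler01 d1).
  rewrite exprD; apply: (@le_lt_trans _ _ (#|Y|%:R * c^-1)); first by rewrite ler_pdivlMr// mulrC.
  apply: ltr_pM; rewrite ?ler0n ?invr_ge0 ?(ltW c_0)//.
    apply: (@le_lt_trans _ _ (D.+1 ^ L)%:R); first by rewrite ler_nat.
    by rewrite natrX -!natrX ltr_nat ltn_exp2r.
  apply: (lt_le_trans tc); rewrite lerXn2r ?nnegrE//.
  by rewrite -[1 + 1]/(2%:R) ler_nat.
have diamX : (diam (@e n) [set: X n]%SET <= r + r)%N.
  have ball x : (#|X n| < 2 * #|iter r (nbhd (@e n)) [set x]%SET|)%N.
    rewrite ltnNge; apply/negP => small.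
    have := iter_expansion esym (eD n) c00 (ch n) small.
    rewrite cards1 mulr1 -/d => H; have := lt_le_trans dr H; rewrite ltr_nat ltnNge => /negP; apply.
    by rewrite (leq_trans _ small)// leq_pmull.
  apply/bigmax_leqP => x _; apply/bigmax_leqP => z _.
  apply: gdist_iter_nbhd; have : exists u, u \in (iter r (nbhd (@e n)) [set x] :&: iter r (nbhd (@e n)) [set z])%SET.
    apply/card_gt0P; have := ball x; have := ball z.
    set A := iter r _ _; set A' := iter r _ _ => bA bA'.
    have := cardsUI A' A; have : (#|(A' :|: A)%SET| <= #|X n|)%N by exact: max_card.
    by lia.
  case=> u; rewrite inE => /andP[ux uz].
  by apply: iter_nbhd_trans ux _; rewrite iter_nbhd_sym.
rewrite ler_pdivrMl ?mulr_gt0// -!natrM ler_nat (leq_trans diamX)//.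
by rewrite /r; nia.
Qed.

End Expanders.

Section NoCoarseEmbedding.
Variables (R : realType) (pi : {multiplicative F3 -> Q}) (X : normedModType R).

(** Averaging the inequality over g gives, for each v, some g such that the images of
g and g v are at bounded distance. Then v has bounded length, but balls have
bounded size and V does not. *)
Lemma no_coarse_embedding (q C : R) : 1 <= q -> 0 < C ->
  (forall n (f : Gn pi n -> X) (v : Vn n),
     relative_poincare (Sn pi n) (inV pi v) Num.norm q C f) ->
  ~ exists phi : forall n, Gn pi n -> X,
    coarse_embedding (fun n x y => (word_dist (Sn pi n) x y)%:R : R)
      (fun x y : X => `|x - y|) phi.
Proof.
move=> q1 C0 poinc [phi [rho [gam [[rho0 rho_pr] [gam0 _] emb]]]].
have q0 : 0 <= q by exact: le_trans q1.
pose K := Num.max (gam 0) (gam 1).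
have K0 : 0 <= K by rewrite le_max gam0.
pose Z := C * (5 * K `^ q) + 1.
have Z1 : 1 <= Z by rewrite lerDr !mulr_ge0 ?powR_ge0// ltW.
have [B HB] := rho_pr Z.
have [b bB] : exists b : nat, B <= b%:R.
  exists (Num.bound `|B|); apply/ltW/(le_lt_trans (ler_norm B)).
  by rewrite archi_boundP.
have close n (v : Vn n) : exists g, (word_dist (Sn pi n) g (g * inV pi v)%g <= b)%N.
  have [g gZ] : exists g, `|phi n (g * inV pi v)%g - phi n g| `^ q <= Z.
    apply: contrapT => no.
    have lt g : Z < `|phi n (g * inV pi v)%g - phi n g| `^ q.
      by rewrite ltNge; apply/negP => le; apply: no; exists g.
    have := poinc n (phi n) v; rewrite /relative_poincare leNgt => /negP; apply.
    apply: (@le_lt_trans _ _ (\sum_(g : Gn pi n) C * (5 * K `^ q))).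
      rewrite mulr_sumr; apply: ler_sum => g _; rewrite ler_wpM2l ?(ltW C0)//.
      apply: (@le_trans _ _ (\sum_(s in Sn pi n) K `^ q)).
        apply: ler_sum => s sS; apply: ge0_ler_powR; rewrite ?nnegrE//.
        have /andP[_] := emb n g (g * s)%g; rewrite distrC => /le_trans; apply.
        have := word_dist_gen g sS; rewrite leq_eqVlt ltnS leqn0 => /orP[] /eqP ->.
          by rewrite le_max lexx orbT.
        by rewrite le_max lexx.
      by rewrite sumr_const -[_ *+ _]mulr_natl ler_wpM2r ?powR_ge0// ler_nat card_Gn_gens.
    rewrite (bigD1 1%g)//= [ltRHS](bigD1 1%g)//=; apply: ltr_leD.
      by apply: lt_trans (lt _); rewrite ltrDl.
    by apply: ler_sum => g _; apply/ltW/(lt_trans _ (lt _)); rewrite ltrDl.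
  exists g; rewrite -(ler_nat R) (le_trans _ bB)//; apply: HB => //.
  have /andP[H _] := emb n g (g * inV pi v)%g; apply: (le_trans H); rewrite distrC.
  rewrite leNgt; apply/negP => lt; move: gZ; rewrite leNgt => /negP; apply.
  apply: (lt_le_trans lt); rewrite -[leLHS]powRr1//.
  by apply: ler_powR => //; rewrite (le_trans Z1)// ltW.
pose n := (11 ^ b + b)%N.
have Vb : (11 ^ b + b < #|{: Vn n}|)%N.
  rewrite card_Vn -[X in (X < _)%N]/n; apply: (@leq_trans (2 ^ n)); first exact: ltn_expl.
  by rewrite -[leqLHS]expn1 leq_pexp2l ?expn_gt0.
have bG : (b < #|Gn pi n|)%N.
  apply: (@leq_trans #|{: Vn n}|); first by rewrite (leq_ltn_trans _ Vb)// leq_addl.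
  by rewrite -(card_imset _ (@inV_inj pi n)) max_card.
have sub : [set inV pi v | v in [set: Vn n]]%SET \subset (unit_ball (Sn pi n) ^+ b)%g.
  apply/fintype.subsetP => _ /imsetP[v _ ->]; have [g gb] := close n v.
  by have := word_dist_ball gb bG; rewrite mulKg.
have := subset_leq_card sub; rewrite card_imset; last exact: inV_inj.
rewrite cardsT leqNgt => /negP; apply; apply: leq_ltn_trans Vb.
rewrite (leq_trans (card_expg_le _ _))// (leq_trans _ (leq_addr _ _))// leq_exp_mono//.
by rewrite (leq_trans (card_unit_ball _))// ltnS (leq_mul2l 2 _ 5) card_Gn_gens.
Qed.

End NoCoarseEmbedding.

(** * Poincare inequalities for uniformly curved spaces and for L^p-spaces *)

(** For k large the walk operator has norm at most eps on L^2 by the spectral gap,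
so its extension to X-valued functions has norm at most 1 / 8. A function F' with
mean zero on the cosets of V is therefore controlled by F' - walk k F', hence by
its gradient. *)
Lemma uniformly_curved_poincare (R : realType) (pi : {multiplicative F3 -> Q})
    (pi_gen : gen_subgroup [set pi (fgen i) | i in [set: 'I_3]] = [set: Q])
    (X : completeNormedModType R) : uniformly_curved X ->
  exists q C : R, [/\ 1 <= q, 0 < C &
    forall (n : nat) (f : Gn pi n -> X) (h : Vn n),
      relative_poincare (Sn pi n) (inV pi h) Num.norm q C f].
Proof.
case=> Delta Delta0 curved.
have [C0 C00 relT] := relative_T R pi_gen.
pose C := C0 + 1; have C1 : 1 <= C by rewrite lerDr.
have Cpos : 0 < C by exact: lt_le_trans C1.
pose kap := (20 * C)^-1.
have kap0 : 0 < kap by rewrite invr_gt0 mulr_gt0.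
have kap1 : kap < 1 by rewrite invf_lt1 ?mulr_gt0//; lra.
have [eps eps0 De] : exists2 eps : R, 0 < eps & `|Delta eps| <= 8^-1.
  have e8 : 0 < 8^-1 :> R by [].
  have /cvgrPdist_le/(_ _ e8) near0 := Delta0.
  have : \forall eps \near (0 : R)^'+, `|0 - Delta eps| <= 8^-1 /\ 0 < eps.
    exact: filterI near0 (nbhs_right_gt (0 : R)).
  case/(@filter_ex _ _ (at_right_proper_filter (0 : R))) => eps [De eps0].
  by exists eps => //; move: De; rewrite sub0r normrN.
have [k kk] : exists k, (1 - kap) ^+ k <= eps ^+ 2.
  have q0 : 0 < 1 - kap by rewrite subr_gt0.
  have [k kk] := expr_unbounded (eps ^- 2) (divr_gt0 kap0 q0).
  exists k; apply: ltW; move: kk.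
  rewrite (_ : 1 + kap / (1 - kap) = (1 - kap)^-1); last by field; rewrite gt_eqF.
  by rewrite exprVn ltf_pV2 ?posrE ?exprn_gt0.
pose K := walk_cst R k.
exists 2, (64 * K + 1); split; first by rewrite ler1n.
  by rewrite ltr_wpDl// mulr_ge0// walk_cst_ge0.
move=> n F h.
have S0 : (0 < #|Sn pi n|)%N.
  apply/card_gt0P; exists (inH pi (proj_sq _ (fgen 0))); rewrite inE; apply/orP; left.
  exact: imset_f.
have S5 := @card_Gn_gens pi n.
have nV := @Vgrp_normal pi n.
have poinc (f : Gn pi n -> R) v : v \in Vgrp pi n -> \sum_g (f (g * v)%g - f g) ^+ 2 <=
   C * \sum_g \sum_(s in Sn pi n) (f (g * s)%g - f g) ^+ 2.
  case/VgrpP => w ->; apply: (le_trans (relT n f w)); rewrite ler_wpM2r ?energy_ge0// lerDl//.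
set S := Sn pi n in S0 S5 poinc *; set V := Vgrp pi n in nV poinc *.
have S0R : 0 < #|S|%:R :> R by rewrite ltr0n.
have S5R : #|S|%:R <= 5 :> R by rewrite ler_nat.
have gap_le : 1 - (4 * #|S|%:R * C)^-1 <= 1 - kap.
  rewrite lerD2l lerN2 lef_pV2 ?posrE ?mulr_gt0// ler_wpM2r ?(ltW Cpos)//; lra.
have S1R : 1 <= #|S|%:R :> R by rewrite ler1n.
have gap0 : 0 <= 1 - (4 * #|S|%:R * C)^-1.
  rewrite subr_ge0 invf_le1 ?mulr_gt0//.
  by rewrite -[leLHS]mulr1 ler_pM//; lra.
have dec (f : Gn pi n -> R) : energy2 (walk_op S V k (f : _ -> R^o)) <= eps ^+ 2 * energy2 (f : _ -> R^o).
  apply: (le_trans (walk_op_decay nV Cpos S0 poinc k f gap0)).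
  rewrite ler_wpM2r ?energy2_ge0//; apply: le_trans kk.
  by apply: lerXn2r; rewrite ?nnegrE// (le_trans gap0).
have bX := curved eps eps0 _ _ _ _ (@walk_L2_linear R _ S V k)
  (@walk_L2_bounded2 R _ S V k eps (ltW eps0) dec) (@walk_L2_bounded1 R _ S V k) (@walk_L2_boundedoo R _ S V k).
have bnd := walk_op_bochner bX.
pose F' := centred V F.
have F'mean g : coset_mean V F' g = 0 by exact: centred_mean.
have F'c : centred V F' = F' by apply/funext => g; rewrite /centred F'mean subr0.
have walkF' : energy2 (walk S k F') <= 16^-1 * energy2 F'.
  have -> : energy2 (walk S k F') = 4 * energy2 (walk_op S V k F').
    rewrite /energy2 mulr_sumr; apply: eq_bigr => g _; rewrite /walk_op F'c normrZ exprMn.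
    by rewrite ger0_norm ?invr_ge0//; field.
  have : Delta eps ^+ 2 <= 64^-1.
    rewrite -[leLHS]real_normK ?num_real// (_ : 64^-1 = 8^-1 ^+ 2); last by field.
    by rewrite ler_sqr ?nnegrE.
  move/(ler_wpM2r (energy2_ge0 F')); have := bnd F'; lra.
pose En (f : Gn pi n -> X) := \sum_g \sum_(s in S) `|f (g * s)%g - f g| ^+ 2.
have EnF' : En F' <= 4 * En F.
  rewrite /En exchange_big [X in _ * X]exchange_big mulr_sumr; apply: ler_sum => s _ /=.
  have := energy2_centred V (fun g => F (g * s)%g - F g); apply: le_trans.
  rewrite le_eqVlt; apply/orP; left; apply/eqP; apply: eq_bigr => g _; congr (`|_| ^+ 2).
  rewrite /F' /centred coset_mean_mulr// coset_meanB !opprB [LHS]addrACA [RHS]addrACA.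
  by congr (_ + _); rewrite addrC.
have F'En : energy2 F' <= 4 * K * En F'.
  have : energy2 F' <= 2 * energy2 (fun g => F' g - walk S k F' g) + 2 * energy2 (walk S k F').
    apply: le_trans (energy2_add _ _); rewrite le_eqVlt; apply/orP; left; apply/eqP.
    by apply: eq_bigr => g _; rewrite subrK.
  have H1 := energy2_walk_sub S k F'.
  have H2 := ler_wpM2l (walk_cst_ge0 R k) (energy2_lazy_sub F' S0).
  move: walkF' H1 H2 (energy2_ge0 F'); rewrite -/(En F') -/K -(mulrA 4).
  set a := energy2 (walk S k F'); set b := energy2 F'; set c := energy2 _.
  by set d := K * energy2 _; set e := K * En F'; lra.
have sq (x : X) : `|x| `^ 2 = `|x| ^+ 2 by rewrite powR_mulrn.
rewrite /relative_poincare.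
under eq_bigr => g _ do rewrite sq.
under [X in _ <= _ * X]eq_bigr => g _ do under eq_bigr => s _ do rewrite sq.
rewrite -/(En F).
apply: (@le_trans _ _ (4 * energy2 F')).
  have -> : \sum_g `|F (g * inV pi h)%g - F g| ^+ 2 = energy2 (fun g => F' (g * inV pi h)%g - F' g).
    apply: eq_bigr => g _; congr (`|_| ^+ 2); rewrite /F' /centred coset_meanV.
      by rewrite opprB addrA subrK.
    by apply/VgrpP; exists h.
  apply: (le_trans (energy2_sub _ _)).
  have -> : energy2 (fun g => F' (g * inV pi h)%g) = energy2 F'.
    exact: (sum_mulgr (fun g => `|F' g| ^+ 2)).
  lra.
have En0 : 0 <= En F by apply: sumr_ge0 => g _; apply: sumr_ge0 => s _; exact: sqr_ge0.
have := ler_wpM2l (mulr_ge0 (ler0n R 4) (walk_cst_ge0 R k)) EnF'; rewrite -/K.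
move: F'En; rewrite (_ : 4 * K * (4 * En F) = 16 * K * En F); last by ring.
rewrite (_ : (64 * K + 1) * En F = 4 * (16 * K * En F) + En F); last by ring.
move: (4 * K * _) (16 * K * _) => a b; lra.
Qed.

Section LpTransfer.
Variables (R : realType) (p : R) (p1 : (1 <= p%:E)%E).
Context d (T : measurableType d) (nu : {measure set T -> \bar R}).
Notation Lp := (LfunType nu p1).

Let p0 : 0 < p. Proof. by rewrite -lte_fin (lt_le_trans _ p1)// lte_fin. Qed.

Lemma powR_Lpnorm (u : Lp) : ((Lpnorm u `^ p)%:E = \int[nu]_x (`|u x| `^ p)%:E)%E.
Proof.
have := finite_norm_fine u; rewrite -/(Lpnorm u) => E.
by rewrite -poweR_EFin E poweR_Lnorm ?gt_eqF.
Qed.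

Lemma measurable_powR_norm (u : Lp) : @measurable_fun _ _ T (\bar R) setT (fun x => (`|u x| `^ p)%:E).
Proof.
apply/measurable_EFinP; apply: (measurableT_comp (measurable_powR p)).
by apply: measurableT_comp.
Qed.

Lemma ge0_integral_sum_in (I : finType) (A : {set I}) (F : I -> T -> \bar R) :
  (forall i, @measurable_fun _ _ T (\bar R) setT (F i)) -> (forall i x, 0 <= F i x)%E ->
  (\int[nu]_x \sum_(i in A) F i x = \sum_(i in A) \int[nu]_x F i x)%E.
Proof.
move=> mF F0; rewrite -[RHS]big_enum -ge0_integral_sum//.
by apply: eq_integral => x _; rewrite big_enum.
Qed.

Lemma relative_poincare_Lp (gT : finGroupType) (S : {set gT}) (h : gT) (C : R) : 0 <= C ->
  (forall f : gT -> R, relative_poincare S h (Num.norm : R -> R) p C f) ->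
  forall f : gT -> Lp, relative_poincare S h (@Lpnorm R d T nu p p1) p C f.
Proof.
move=> C0 H f; rewrite /relative_poincare -lee_fin -sumEFin EFinM -sumEFin.
rewrite (eq_bigr (fun g => \int[nu]_x (`|(f (g * h)%g - f g) x| `^ p)%:E)%E); last first.
  by move=> g _; exact: powR_Lpnorm.
rewrite [X in (_ <= _ * X)%E](eq_bigr (fun g =>
    \int[nu]_x \sum_(s in S) (`|(f (g * s)%g - f g) x| `^ p)%:E)%E); last first.
  move=> g _; rewrite -sumEFin ge0_integral_sum_in.
  - by apply: eq_bigr => s _; exact: powR_Lpnorm.
  - by move=> s; exact: measurable_powR_norm.
  - by move=> s x; rewrite lee_fin powR_ge0.
have sum_ge0 g x : (0 <= \sum_(s in S) (`|(f (g * s)%g - f g) x| `^ p)%:E)%E.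
  by apply: sume_ge0 => s _; rewrite lee_fin powR_ge0.
have sum_meas g : @measurable_fun _ _ T (\bar R) setT (fun x => \sum_(s in S) (`|(f (g * s)%g - f g) x| `^ p)%:E)%E.
  rewrite (_ : (fun x => _) = (fun x => \sum_(s <- enum S) (`|(f (g * s)%g - f g) x| `^ p)%:E)%E).
    by apply: emeasurable_sum => s; exact: measurable_powR_norm.
  by apply/funext => x; rewrite big_enum.
have A_meas g : @measurable_fun _ _ T (\bar R) setT (fun x => (`|(f (g * h)%g - f g) x| `^ p)%:E).
  exact: measurable_powR_norm.
have A_ge0 g x : (0 <= (`|(f (g * h)%g - f g) x| `^ p)%:E)%E by rewrite lee_fin powR_ge0.
rewrite -(ge0_integral_sum nu measurableT A_meas (fun g x _ => A_ge0 g x)).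
rewrite -(ge0_integral_sum nu measurableT sum_meas (fun g x _ => sum_ge0 g x)).
rewrite -ge0_integralZl_EFin//; last 2 first.
- by move=> x _; exact: sume_ge0.
- exact: emeasurable_sum.
apply: ge0_le_integral => //.
- by move=> x _; apply: sume_ge0 => g _; rewrite lee_fin powR_ge0.
- by apply: emeasurable_sum => g; exact: measurable_powR_norm.
- by apply: measurable_funeM; exact: emeasurable_sum.
move=> x _; under [X in (_ <= _ * X)%E]eq_bigr => g _ do rewrite sumEFin.
rewrite !sumEFin -EFinM lee_fin.
exact: (H (fun g => f g x)).
Qed.

End LpTransfer.

Theorem theorem7p1 (R : realType) (pi : {multiplicative F3 -> Q})
    (pi_gen : gen_subgroup [set pi (fgen i) | i in [set: 'I_3]] = [set: Q])
    (p : R) (p1 : (1 <= p%:E)%E) :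
  [/\ exists2 C : R, 0 < C &
        forall (n : nat) (d : measure_display) (T : measurableType d)
          (nu : {measure set T -> \bar R})
          (f : Gn pi n -> LfunType nu p1) (h : Vn n),
          relative_poincare (Sn pi n) (inV pi h) (@Lpnorm R d T nu p p1) p C f,
      forall X : completeNormedModType R, uniformly_curved X ->
        exists q C : R,
          [/\ 1 <= q, 0 < C &
              forall (n : nat) (f : Gn pi n -> X) (h : Vn n),
                relative_poincare (Sn pi n) (inV pi h) Num.norm q C f],
      forall X : completeNormedModType R, uniformly_curved X ->
        ~ exists phi : forall n, Gn pi n -> X,
            coarse_embedding
              (fun n x y => (word_dist (Sn pi n) x y)%:R : R)
              (fun x y : X => `|x - y|) phi &
      forall (X : nat -> finType) (e : forall n, rel (X n))
        (h : forall n, X n -> Gn pi n),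
        expander R e ->
        (forall n (x y : X n),
           (word_dist (Sn pi n) (h n x) (h n y) <= gdist (e n) x y)%N) ->
        exists (c : R) (y : forall n, Gn pi n),
          [/\ 0 < c,
              forall n, c * #|X n|%:R <= #|(h n @^-1: [set y n])%SET|%:R &
              \forall n \near \oo,
                c * (diam (e n) [set: X n]%SET)%:R <=
                (diam (e n) (h n @^-1: [set y n])%SET)%:R]].
Proof.
have p1' : 1 <= p by rewrite -lee_fin.
have banach X := @uniformly_curved_poincare R pi pi_gen X.
split.
- have [C C0 relT] := relative_T R pi_gen.
  have [C' C'0 poinc] := poincare_extrapolation 5 p1' C0.
  exists C' => // n d T nu f h.
  apply: relative_poincare_Lp => [|f0]; first exact: ltW.
  apply: (poinc _ _ (Vgrp pi n)).
  - exact: Vgrp_normal.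
  - exact: card_Gn_gens.
  - move=> v f1 /VgrpP[w ->]; rewrite /relative_poincare.
    have sq (x : R) : `|x| `^ 2 = x ^+ 2 by rewrite powR_mulrn// real_normK ?num_real.
    under eq_bigr => g _ do rewrite sq.
    under [X in _ <= _ * X]eq_bigr => g _ do under eq_bigr => s _ do rewrite sq.
    exact: relT.
  - by apply/VgrpP; exists h.
- by move=> X curv; exact: banach.
- by move=> X /banach[q [C [q1 C0 poinc]]]; exact: no_coarse_embedding q1 C0 poinc.
- move=> X e h expX lip.
  have [c c0 fib] := @fibres_large R pi X e h expX lip.
  pose y n := projT1 (cid (fib n)).
  have yP n : c * #|X n|%:R <= #|(h n @^-1: [set y n])%SET|%:R := projT2 (cid (fib n)).
  have [c' c'0 dia] := @fibre_diameter R pi X e h expX c y c0 yP.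
  exists (Num.min c c'), y; split; first by rewrite lt_min c0.
  + by move=> n; apply: le_trans (yP n); rewrite ler_wpM2r// ge_min lexx.
  + by apply: filterS dia => n; apply: le_trans; rewrite ler_wpM2r// ge_min lexx orbT.
Qed.
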